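(* Let $d\geq1$, $k\geq1$, $(\boldsymbol\mu,\rho)\in\mathbb{S}^d\times[-1,1]$, $\boldsymbol X\sim\mathrm{C}_k(\boldsymbol\mu,\rho)$ and $\boldsymbol\gamma\in\mathbb{S}^d$. Then the density and cdf of $\boldsymbol\gamma^\top\boldsymbol X$ on $[-1,1]$ are $$f_{\boldsymbol\gamma}(x)=f_d(x)\big\{1+\rho\,\tilde C_k^{(d-1)/2}(\boldsymbol\gamma^\top\boldsymbol\mu)\tilde C_k^{(d-1)/2}(x)\big\},\qquad F_{\boldsymbol\gamma}(x)=F_d(x)-\rho\,\eta_k(\boldsymbol\gamma^\top\boldsymbol\mu)G_k(x),$$ where $f_d(x)=\frac{\omega_{d-1}}{\omega_d}(1-x^2)^{d/2-1}$, $F_d(x)=\int_{-1}^xf_d(t)\,\mathrm dt$, $\eta_k(s)=\frac{\omega_{d-1}}{\omega_d}\frac{C_k^{(d-1)/2}(s)}{\{C_k^{(d-1)/2}(1)\}^2}$, and $G_k(x)=\frac1k\sin(k\cos^{-1}x)$ if $d=1$, $G_k(x)=\frac{d-1}{k(k+d-1)}C_{k-1}^{(d+1)/2}(x)(1-x^2)^{d/2}$ if $d\geq2$.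
   Context: For $d\geq1$, $\mathbb{S}^d$ is the unit sphere of $\mathbb{R}^{d+1}$ with surface area measure $\sigma_d$ and total area $\omega_d=2\pi^{(d+1)/2}/\Gamma((d+1)/2)$ (with $\omega_0=2$). For $\lambda>0$, $C_k^{\lambda}$ is the standard Gegenbauer polynomial of degree $k$ and index $\lambda$ (generating function $(1-2xt+t^2)^{-\lambda}$); for $d=1$, $C_k^0:=T_k$, $T_k(x)=\cos(k\cos^{-1}x)$. $\tilde C_k^{(d-1)/2}=C_k^{(d-1)/2}/C_k^{(d-1)/2}(1)$. $\mathrm{C}_k(\boldsymbol\mu,\rho)$ is the distribution on $\mathbb{S}^d$ with density $\omega_d^{-1}\{1+\rho\,\tilde C_k^{(d-1)/2}(\boldsymbol x^\top\boldsymbol\mu)\}$ w.r.t. $\sigma_d$. *)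

(* Defs.v *)
From HB Require Import structures.
From mathcomp Require Import all_boot all_order all_algebra.
From mathcomp Require Import all_classical all_reals all_analysis.
Set Implicit Arguments. Unset Strict Implicit. Unset Printing Implicit Defensive.
Import Order.TTheory GRing.Theory Num.Theory.
Import numFieldNormedType.Exports.
Local Open Scope classical_set_scope.
Local Open Scope ring_scope.

Section Defs.
Variable R : realType.

Definition dotp n (u v : 'rV[R]_n) : R := \sum_(i < n) u ord0 i * v ord0 i.

Definition sphere d : set 'rV[R]_(d.+1) := [set x | dotp x x = 1].

(* Iterated Lebesgue integral over R^n (Tonelli: for nonnegative Borel
   integrands this is the integral w.r.t. n-dimensional Lebesgue measure).
   Coordinate n-1 is integrated outermost, coordinate 0 innermost. *)
Fixpoint iterint (n : nat) (h : (nat -> R) -> \bar R) : \bar R :=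
  match n with
  | 0 => h (fun _ => 0)
  | m.+1 => (\int[@lebesgue_measure R]_x
               iterint m (fun v => h (fun i => if i == m then x else v i)))%E
  end.

Definition leb_int n (h : 'rV[R]_n -> \bar R) : \bar R :=
  iterint n (fun v => h (\row_(i < n) v i)).

(* Integral w.r.t. the surface area measure sigma_d on S^d, via the cone
   construction: sigma_d(A) = (d+1) * Leb_{d+1}{x : 0 < |x| <= 1, x/|x| in A}. *)
Definition cone_integrand d (g : 'rV[R]_(d.+1) -> \bar R) (x : 'rV[R]_(d.+1))
  : \bar R :=
  if (0 < dotp x x) && (dotp x x <= 1)
  then g ((Num.sqrt (dotp x x))^-1 *: x) else 0%E.

Definition sphere_int d (g : 'rV[R]_(d.+1) -> \bar R) : \bar R :=
  ((d.+1)%:R%:E * leb_int (cone_integrand g))%E.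

Definition Gamma (s : R) : R :=
  Rintegral (@lebesgue_measure R) `]0, +oo[ (fun t => t `^ (s - 1) * expR (- t)).

(* omega_d = 2 pi^{(d+1)/2} / Gamma((d+1)/2), total area of S^d. *)
Definition omega (d : nat) : R :=
  2 * pi `^ ((d.+1)%:R / 2) / Gamma ((d.+1)%:R / 2).

(* Gegenbauer polynomial C_k^lam (explicit form, DLMF 18.5.10, equivalent
   to the generating function (1 - 2xt + t^2)^{-lam}). *)
Definition gegenbauer (lam : R) (k : nat) (x : R) : R :=
  \sum_(j < k./2.+1)
     (-1) ^+ j * (\prod_(i < k - j) (lam + i%:R))
     / ((j`!)%:R * ((k - 2 * j)`!)%:R) * (2 * x) ^+ (k - 2 * j).

(* C_k^{(d-1)/2}, with the convention C_k^0 := T_k when d = 1. *)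
Definition gegC (d k : nat) (x : R) : R :=
  if d == 1%N then cos (k%:R * acos x)
  else gegenbauer ((d%:R - 1) / 2) k x.

Definition gegtilde (d k : nat) (x : R) : R := gegC d k x / gegC d k 1.

Definition Ck_density d k (mu : 'rV[R]_(d.+1)) (rho : R) (x : 'rV[R]_(d.+1)) : R :=
  (1 + rho * gegtilde d k (dotp x mu)) / omega d.

Definition proj_law d k (mu : 'rV[R]_(d.+1)) (rho : R) (gam : 'rV[R]_(d.+1))
  (B : set R) : \bar R :=
  sphere_int (fun x => if dotp gam x \in B then (Ck_density k mu rho x)%:E
                       else 0%E).

Definition f_d (d : nat) (x : R) : R :=
  omega d.-1 / omega d * (1 - x ^+ 2) `^ (d%:R / 2 - 1).

Definition F_d (d : nat) (x : R) : R :=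
  Rintegral (@lebesgue_measure R) `[-1, x] (f_d d).

Definition eta_k (d k : nat) (s : R) : R :=
  omega d.-1 / omega d * gegC d k s / (gegC d k 1) ^+ 2.

Definition G_k (d k : nat) (x : R) : R :=
  if d == 1%N then k%:R^-1 * sin (k%:R * acos x)
  else (d%:R - 1) / (k%:R * (k%:R + d%:R - 1))
       * gegenbauer ((d%:R + 1) / 2) k.-1 x * (1 - x ^+ 2) `^ (d%:R / 2).

End Defs.

(* Main.v *)
(* For fixed gamma, rotate the ball so that gamma becomes the last axis and substitute
   x_last = |y| t / sqrt (1 - t ^ 2), y being the remaining coordinates.  The law of
   gamma . X then has at t the density (1 - t ^ 2) ^ (d / 2 - 1) times the mean of the
   density of X over the parallel gamma . x = t.  There mu . x = s t + sqrt (1 - s ^ 2)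
   sqrt (1 - t ^ 2) u with s = gamma . mu and u one coordinate of a uniform point of
   S^(d-1), so the first claim is the product formula: for P = C_k^((d-1)/2) the mean of
   P (s t + sqrt (1 - s ^ 2) sqrt (1 - t ^ 2) u) over u is P(s) P(t) / P(1).  Taylor
   expansion at s t and the even moments of u turn this mean into
   sum_j e_j ((1 - s ^ 2) (1 - t ^ 2)) ^ j P^(2j)(s t), which satisfies in s the
   Gegenbauer equation, whose polynomial solutions are determined by their value at 1.
   The distribution function follows from the self-adjoint form of that equation:
   ((1 - x ^ 2) ^ (d / 2) P')' = - k (k + d - 1) (1 - x ^ 2) ^ (d / 2 - 1) P. *)

Require Import Defs.
From HB Require Import structures.
From mathcomp Require Import all_boot all_order all_algebra.
From mathcomp Require Import all_classical all_reals all_analysis.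
From mathcomp Require Import measurable_realfun zify ring lra.
Import Order.TTheory GRing.Theory Num.Theory.
Import numFieldNormedType.Exports.
Set Implicit Arguments. Unset Strict Implicit. Unset Printing Implicit Defensive.
Local Open Scope classical_set_scope.
Local Open Scope ring_scope.

(** * Iterated integrals over finitely many coordinates *)

(** Surface measure is given by iterated one-dimensional integrals over a cone, so every change of
    variables is assembled from moves of a single coordinate: translations by functions of the other
    coordinates (whose composites contain the rotations), reflections, dilations and the cotangent
    substitution. Polar coordinates are replaced by a layer-cake identity for homogeneous functions;
    combined with the Gaussian, which factors over the coordinates, it yields all moments over the
    ball. All integrals are of nonnegative functions with values in the extended reals, so that
    Tonelli applies without integrability conditions. This is why the density has to be nonnegative,
    hence why |P| <= |P(1)| on [-1, 1] is proved, why functions are truncated at 0 outside [-1, 1],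
    and why signed polynomials are shifted by constants before they are averaged. *)

Section coord_integral.
Variable R : realType.
Notation mu := (@lebesgue_measure R).

(* Vectors are functions on nat, as in [iterint], with the sigma-algebra generated by
   the coordinates; the n-dimensional statements only look at coordinates below n. *)
Definition coord_sets : set (set (nat -> R)) :=
  [set A | exists i (B : set R), measurable B /\ A = (fun v => v i) @^-1` B].

Notation vec := (g_sigma_algebraType coord_sets).

Lemma measurable_coord i : measurable_fun [set: vec] (fun v : vec => v i).
Proof.
move=> _ B mB; rewrite setTI; apply: sub_sigma_algebra.
by exists i, B.
Qed.

Lemma measurable_vecP d (T : measurableType d) (f : T -> vec) :
  (forall i, measurable_fun setT (fun t => f t i)) -> measurable_fun setT f.
Proof.
move=> mf; apply: (@measurability _ _ T vec setT f coord_sets) => //.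
move=> _ [_ [i [B [mB ->]]] <-].
exact: (mf i measurableT B mB).
Qed.

Definition upd (i : nat) (x : R) (v : vec) : vec :=
  fun j => if j == i then x else v j.

Lemma upd_same i x v : upd i x v i = x.
Proof. by rewrite /upd eqxx. Qed.

Lemma upd_neq i j x v : j != i -> upd i x v j = v j.
Proof. by rewrite /upd => /negbTE ->. Qed.

Lemma upd_upd i x y v : upd i x (upd i y v) = upd i x v.
Proof. by apply/funext => j; rewrite /upd; case: eqP. Qed.

Lemma updC i j x y v : i != j -> upd i x (upd j y v) = upd j y (upd i x v).
Proof.
move=> ij; apply/funext => k; rewrite /upd.
by case: (eqVneq k i) => // ->; rewrite (negbTE ij).
Qed.

Lemma measurable_upd d (T : measurableType d) i (f : T -> R) (g : T -> vec) :
  measurable_fun setT f -> measurable_fun setT g ->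
  measurable_fun setT (fun t => upd i (f t) (g t)).
Proof.
move=> mf mg; apply: measurable_vecP => j; rewrite /upd.
case: (j == i) => //.
by apply: (measurableT_comp (measurable_coord j)).
Qed.

Definition nnmeas (h : vec -> \bar R) :=
  measurable_fun [set: vec] h /\ forall v, (0 <= h v)%E.

(** The result is again a function of the whole vector, constant in coordinate i. Integrals over
    different coordinates are thus operators on one type and can be commuted. *)
Definition coord_int (i : nat) (h : vec -> \bar R) : vec -> \bar R :=
  fun v => (\int[mu]_x h (upd i x v))%E.

Lemma measurable_upd_arg i h v : measurable_fun setT h ->
  measurable_fun setT (fun x : measurableTypeR R => h (upd i x v) : \bar R).
Proof.
move=> mh; apply: (measurableT_comp mh).
exact: measurable_upd.
Qed.

Lemma nnmeas_coord_int i h : nnmeas h -> nnmeas (coord_int i h).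
Proof.
move=> [mh h0]; split; last by move=> v; apply: integral_ge0 => x _.
have := @measurable_fun_fubini_tonelli_F _ _ vec (measurableTypeR R) R mu
  (fun z => h (upd i z.2 z.1)).
apply => //.
by apply: (measurableT_comp mh); exact: measurable_upd.
Qed.

Lemma coord_intC i j h : nnmeas h ->
  coord_int i (coord_int j h) = coord_int j (coord_int i h).
Proof.
move=> [mh h0]; have [->//|ij] := eqVneq i j.
apply/funext => v.
pose F (z : measurableTypeR R * measurableTypeR R) := h (upd j z.2 (upd i z.1 v)).
have mF : measurable_fun setT F.
  apply: (measurableT_comp mh); apply: measurable_upd => //.
  exact: measurable_upd.
have := @fubini_tonelli _ _ _ _ R mu mu F mF (fun z => h0 _).
rewrite /F /coord_int /= => ->.
apply: eq_integral => x _; apply: eq_integral => y _.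
by rewrite updC // eq_sym.
Qed.

Lemma coord_intD i h k : nnmeas h -> nnmeas k ->
  coord_int i (fun v => h v + k v)%E = (fun v => coord_int i h v + coord_int i k v)%E.
Proof.
move=> [mh h0] [mk k0]; apply/funext => v.
by rewrite /coord_int ge0_integralD //; exact: measurable_upd_arg.
Qed.

Lemma coord_intZ i (c : vec -> \bar R) h : nnmeas h ->
  (forall v, 0 <= c v)%E -> (forall x v, c (upd i x v) = c v) ->
  coord_int i (fun v => c v * h v)%E = (fun v => c v * coord_int i h v)%E.
Proof.
move=> [mh h0] c0 ci; apply/funext => v; rewrite /coord_int.
under eq_integral do rewrite ci.
by rewrite ge0_integralZl //; exact: measurable_upd_arg.
Qed.

(** Lebesgue measure is determined by its values on the intervals ]a, b]. The dilation and cotangent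
    formulas rest on the same principle. *)
Lemma lebesgue_measure_shift (c : R) (A : set R) : measurable A ->
  pushforward mu (fun x : measurableTypeR R => x + c : measurableTypeR R) A = mu A.
Proof.
have mc : measurable_fun setT (fun x : measurableTypeR R => x + c : measurableTypeR R).
  exact: measurable_funD.
pose f := HB.pack_for {mfun measurableTypeR R >-> measurableTypeR R}
  (fun x : measurableTypeR R => x + c : measurableTypeR R)
  (isMeasurableFun.Build _ _ _ _ _ mc).
move=> mA; apply/esym.
apply: (@lebesgue_measure_unique R (pushforward mu f)) => //= _ [[a b]] _ <-.
rewrite /pushforward /=.
have -> : (fun x => x + c) @^-1` `]a, b] = `]a - c, b - c]%classic.
  by apply/seteqP; split => x /=; rewrite !in_itv /= ltrBlDr lerBrDr.
by rewrite !lebesgue_measure_itv /= !lte_fin ltrD2r -!EFinB opprB addrA subrK.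
Qed.

Lemma ge0_integral_shift (c : R) (f : R -> \bar R) : measurable_fun setT f ->
  (forall x, 0 <= f x)%E -> (\int[mu]_x f (x + c)%R = \int[mu]_x f x)%E.
Proof.
move=> mf f0.
have mc : measurable_fun setT (fun x : measurableTypeR R => x + c : measurableTypeR R).
  exact: measurable_funD.
rewrite -[LHS](@ge0_integral_pushforward _ _ _ _ _ _ mc mu setT f) //.
by apply: eq_measure_integral => A mA _; exact: lebesgue_measure_shift.
Qed.

Lemma ge0_integral_opp (f : R -> \bar R) : measurable_fun setT f ->
  (forall x, 0 <= f x)%E -> (\int[mu]_x f (- x)%R = \int[mu]_x f x)%E.
Proof.
move=> mf f0.
have mN : measurable_fun setT (fun x : measurableTypeR R => - x : measurableTypeR R).
  exact: oppr_measurable.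
rewrite -[LHS](@ge0_integral_pushforward _ _ _ _ _ _ mN mu setT f) //.
by apply: eq_measure_integral => A mA _; exact: lebesgue_measureN.
Qed.

Lemma ge0_integral_dilate (a : R) (f : R -> \bar R) : 0 < a ->
  measurable_fun setT f -> (forall x, 0 <= f x)%E ->
  (a%:E * \int[mu]_x f (a * x)%R = \int[mu]_x f x)%E.
Proof.
move=> a0 mf f0.
have ma : measurable_fun setT (fun x : measurableTypeR R => a * x : measurableTypeR R).
  exact: measurable_funM.
pose g := HB.pack_for {mfun measurableTypeR R >-> measurableTypeR R}
  (fun x : measurableTypeR R => a * x : measurableTypeR R)
  (isMeasurableFun.Build _ _ _ _ _ ma).
pose m := mscale (NngNum (ltW a0)) mu.
have mE A : measurable A -> mu A = pushforward m g A.
  apply: (@lebesgue_measure_unique R (pushforward m g)) => //= _ [[x y]] _ <-.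
  rewrite /m /mscale /pushforward /=.
  have -> : (fun x => a * x) @^-1` `]x, y] = `]x / a, y / a]%classic.
    by apply/seteqP; split => z /=; rewrite !in_itv /=
       ltr_pdivrMr // ler_pdivlMr // mulrC.
  rewrite !lebesgue_measure_itv /= !lte_fin ltr_pM2r ?invr_gt0 //.
  case: ifPn => _; last by rewrite mule0.
  by rewrite -!EFinB -EFinM -mulrBl mulrC divfK // gt_eqF.
rewrite -[LHS](@ge0_integral_mscale _ _ _ mu setT _ (NngNum (ltW a0))
  (fun x => f (a * x))) //; last exact: (measurableT_comp mf ma).
rewrite -[LHS](@ge0_integral_pushforward _ _ _ _ _ _ ma m setT f) //.
by apply: eq_measure_integral => A mA _; exact/esym/mE.
Qed.

(** The shift may depend on the other coordinates, which is exactly a shear; with these fixed it is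
    a translation of the line. *)
Lemma coord_int_shift i (c : vec -> R) h : nnmeas h ->
  (forall x v, c (upd i x v) = c v) ->
  coord_int i (fun v => h (upd i (v i + c v) v)) = coord_int i h.
Proof.
move=> [mh h0] ci; apply/funext => v; rewrite /coord_int.
under eq_integral do rewrite upd_same ci upd_upd.
rewrite (@ge0_integral_shift (c v) (fun x => h (upd i x v))) //.
exact: measurable_upd_arg.
Qed.

Lemma coord_int_dilate i (c : vec -> R) h : nnmeas h ->
  (forall x v, c (upd i x v) = c v) -> (forall v, 0 < c v) ->
  (fun v => (c v)%:E * coord_int i (fun v => h (upd i (c v * v i) v)) v)%E
  = coord_int i h.
Proof.
move=> [mh h0] ci c0; apply/funext => v; rewrite /coord_int.
under eq_integral do rewrite upd_same ci upd_upd.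
rewrite (@ge0_integral_dilate (c v) (fun x => h (upd i x v))) //.
exact: measurable_upd_arg.
Qed.

Lemma coord_int_opp i h : nnmeas h ->
  coord_int i (fun v => h (upd i (- v i) v)) = coord_int i h.
Proof.
move=> [mh h0]; apply/funext => v; rewrite /coord_int.
under eq_integral do rewrite upd_same upd_upd.
rewrite (@ge0_integral_opp (fun x => h (upd i x v))) //.
exact: measurable_upd_arg.
Qed.

(** A nonzero coordinate forces a positive norm, so this discards the points where division by the
    norm is meaningless. *)
Lemma coord_int_neq0 i h h' : nnmeas h -> nnmeas h' ->
  (forall v, v i != 0 -> h v = h' v) -> coord_int i h = coord_int i h'.
Proof.
move=> [mh h0] [mh' h'0] hh'; apply/funext => v; rewrite /coord_int.
apply: ge0_ae_eq_integral => //; try exact: measurable_upd_arg.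
exists [set 0]; split => //; first exact: lebesgue_measure_set1.
move=> x /= nx; apply: contrapT => /eqP x0; apply: nx => _.
by apply: hh'; rewrite upd_same.
Qed.

(** The head of the list is integrated innermost, in agreement with the order of [iterint] when the
    list is [iota 0 n]. *)
Fixpoint multi_int (s : seq nat) (h : vec -> \bar R) : vec -> \bar R :=
  if s is i :: s' then multi_int s' (coord_int i h) else h.

Lemma nnmeas_multi_int s h : nnmeas h -> nnmeas (multi_int s h).
Proof.
by elim: s h => //= i s IH h hh; apply: IH; exact: nnmeas_coord_int.
Qed.

Lemma multi_int_coord_int s i h : nnmeas h ->
  multi_int s (coord_int i h) = coord_int i (multi_int s h).
Proof.
elim: s h => //= j s IH h hh.
by rewrite coord_intC // IH //; exact: nnmeas_coord_int.
Qed.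

(** By Tonelli any listed coordinate can be made the innermost one, which transfers the
    one-coordinate lemmas to iterated integrals. *)
Lemma multi_int_rem s i h : nnmeas h -> i \in s ->
  multi_int s h = multi_int (rem i s) (coord_int i h).
Proof.
elim: s h => //= j s IH h hh; rewrite inE; have [->//|ij /= si] := eqVneq i j.
by rewrite IH ?(coord_intC i) //; exact: nnmeas_coord_int.
Qed.

Lemma multi_int_cat s t h : multi_int (s ++ t) h = multi_int t (multi_int s h).
Proof. by elim: s h => /=. Qed.

Lemma multi_intD s h k : nnmeas h -> nnmeas k ->
  multi_int s (fun v => h v + k v)%E = (fun v => multi_int s h v + multi_int s k v)%E.
Proof.
elim: s h k => //= i s IH h k hh hk.
by rewrite coord_intD // IH //; exact: nnmeas_coord_int.
Qed.

Lemma nnmeasM c h : nnmeas c -> nnmeas h -> nnmeas (fun v => c v * h v)%E.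
Proof.
move=> [mc c0] [mh h0]; split; first exact: emeasurable_funM.
by move=> v; exact: mule_ge0.
Qed.

Lemma multi_intZ s (c : vec -> \bar R) h : nnmeas c -> nnmeas h ->
  (forall i x v, i \in s -> c (upd i x v) = c v) ->
  multi_int s (fun v => c v * h v)%E = (fun v => c v * multi_int s h v)%E.
Proof.
elim: s h => //= i s IH h hc hh ci.
rewrite coord_intZ //; first rewrite IH //.
- exact: nnmeas_coord_int.
- by move=> j x v js; apply: ci; rewrite inE js orbT.
- by case: hc.
- by move=> x v; apply: ci; rewrite inE eqxx.
Qed.

Lemma multi_int_shear s i (c : vec -> R) h : i \in s ->
  measurable_fun setT c -> nnmeas h ->
  (forall x v, c (upd i x v) = c v) ->
  multi_int s (fun v => h (upd i (v i + c v) v)) = multi_int s h.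
Proof.
move=> si mc hh ci; rewrite !(multi_int_rem _ si) ?coord_int_shift //.
case: hh => mh h0; split => //; apply: (measurableT_comp mh).
apply: measurable_upd => //; apply: measurable_funD => //.
exact: measurable_coord.
Qed.

Lemma multi_int_opp s i h : i \in s -> nnmeas h ->
  multi_int s (fun v => h (upd i (- v i) v)) = multi_int s h.
Proof.
move=> si hh; rewrite !(multi_int_rem _ si) ?coord_int_opp //.
case: hh => mh h0; split => //; apply: (measurableT_comp mh).
apply: measurable_upd => //; apply: measurableT_comp => //.
exact: measurable_coord.
Qed.

Lemma multi_int_neq0 s i h h' : i \in s -> nnmeas h -> nnmeas h' ->
  (forall v, v i != 0 -> h v = h' v) -> multi_int s h = multi_int s h'.
Proof.
move=> si hh hh' e; rewrite !(multi_int_rem _ si) //.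
by rewrite (coord_int_neq0 hh hh').
Qed.

Definition dilate (s : seq nat) (a : R) (v : vec) : vec :=
  fun j => if j \in s then a * v j else v j.

Lemma measurable_dilate s a : measurable_fun setT (dilate s a).
Proof.
apply: measurable_vecP => j; rewrite /dilate; case: (j \in s).
  by apply: measurable_funM => //; exact: measurable_coord.
exact: measurable_coord.
Qed.

Lemma coord_int_upd i j x h v : i != j ->
  coord_int i (fun w => h (upd j x w)) v = coord_int i h (upd j x v).
Proof.
by move=> ij; rewrite /coord_int; apply: eq_integral => y _; rewrite updC // eq_sym.
Qed.

Lemma multi_int_upd s j x h : j \notin s ->
  multi_int s (fun w => h (upd j x w)) = (fun v => multi_int s h (upd j x v)).
Proof.
elim: s h => //= i s IH h; rewrite inE negb_or => /andP[ij js].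
rewrite -IH //; congr multi_int; apply/funext => v.
by rewrite coord_int_upd // eq_sym.
Qed.

Lemma multi_int_dilate s a h : uniq s -> 0 < a -> nnmeas h ->
  (fun v => (a ^+ size s)%:E * multi_int s (h \o dilate s a) v)%E = multi_int s h.
Proof.
move=> + a0; elim: s h => [|i s IH] h /=.
  move=> _ [_ h0]; apply/funext => v.
  rewrite expr0 mul1e /=; congr h; exact/funext.
move=> /andP[si us] hh.
have hD (t : seq nat) : nnmeas (h \o dilate t a).
  case: hh => mh h0; split; last by move=> v; exact: h0.
  apply: (measurableT_comp mh); exact: measurable_dilate.
have dE v x : dilate (i :: s) a (upd i x v) = upd i (a * x) (dilate s a v).
  apply/funext => j; rewrite /dilate /upd inE.
  by have [->|] := eqVneq j i.
rewrite -(IH (coord_int i h)) //; last exact: nnmeas_coord_int.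
apply/funext => v /=; rewrite exprSr EFinM -muleA; congr (_ * _)%E.
(* Along coordinate i the dilation costs a factor 1/a; the dilation along s does not touch
   coordinate i, as i is not in s, so it leaves the integral. *)
have -> : coord_int i (h \o dilate (i :: s) a) =
   (fun v => a^-1%:E * (coord_int i h \o dilate s a) v)%E.
  apply/funext => w /=.
  rewrite -(@coord_int_dilate i (fun=> a) h) // muleA -EFinM mulVf ?gt_eqF// mul1e.
  apply: eq_integral => x _; rewrite /= dE upd_same; congr h.
  apply/funext => j; rewrite /upd /dilate.
  by case: eqP => // ->; rewrite (negbTE si).
rewrite (@multi_intZ s (fun=> a^-1%:E)) //; last first.
- have [mh h0] := nnmeas_coord_int i hh.
  split; last by move=> w; exact: h0.
  apply: (measurableT_comp mh); exact: measurable_dilate.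
- by split => // w; rewrite lee_fin invr_ge0 ltW.
by rewrite muleA -EFinM mulfV ?gt_eqF// mul1e.
Qed.

(** The base vector 0 is the default that [iterint] assigns to the coordinates from n on. *)
Lemma iterintE n h : iterint n h = multi_int (iota 0 n) h (fun=> 0).
Proof.
elim: n h => // n IH h.
have -> : iota 0 n.+1 = iota 0 n ++ [:: n] by rewrite -addn1 iotaD.
rewrite multi_int_cat /= /coord_int.
apply: eq_integral => x _; rewrite IH multi_int_upd //.
by rewrite mem_iota ltnn.
Qed.

End coord_integral.

(** * Linear isometries *)

Section orthogonal_maps.
Variable R : realType.
Notation vec := (g_sigma_algebraType (@coord_sets R)).
Implicit Types (a v w : vec) (h : vec -> \bar R).

Definition dotv n a v : R := \sum_(k < n) a k * v k.

Lemma dotvC n a v : dotv n a v = dotv n v a.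
Proof. by apply: eq_bigr => k _; rewrite mulrC. Qed.

Lemma dotv_recr n a v : dotv n.+1 a v = dotv n a v + a n * v n.
Proof. by rewrite /dotv big_ord_recr. Qed.

Lemma dotvv_ge0 n v : 0 <= dotv n v v.
Proof. by apply: sumr_ge0 => k _; rewrite -expr2 sqr_ge0. Qed.

Lemma measurable_dotv n a : measurable_fun setT (dotv n a).
Proof.
apply: measurable_sum => k; apply: measurable_funM => //.
exact: measurable_coord.
Qed.

Lemma measurable_dotvv n : measurable_fun setT (fun v => dotv n v v).
Proof.
by apply: measurable_sum => k; apply: measurable_funM; exact: measurable_coord.
Qed.

Lemma dotvD n a v w : dotv n a (fun k => v k + w k) = dotv n a v + dotv n a w.
Proof. by rewrite /dotv -big_split; apply: eq_bigr => k _; rewrite mulrDr. Qed.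

Lemma dotvZ n a c v : dotv n a (fun k => c * v k) = c * dotv n a v.
Proof. by rewrite /dotv mulr_sumr; apply: eq_bigr => k _; rewrite mulrCA. Qed.

Lemma cauchy_schwarz_dotv n a v : (dotv n a v) ^+ 2 <= dotv n a a * dotv n v v.
Proof.
have [v0|v0] := eqVneq (dotv n v v) 0.
  have vk (k : 'I_n) : v k = 0.
    apply/eqP; rewrite -sqrf_eq0 expr2; apply/eqP.
    by have /psumr_eq0P := v0; apply => // j _; rewrite -expr2 sqr_ge0.
  rewrite v0 mulr0 {1}/dotv big1 ?expr0n // => k _.
  by rewrite vk mulr0.
pose c := dotv n a v / dotv n v v.
have := dotvv_ge0 n (fun k => a k + - c * v k : R).
rewrite dotvD dotvZ (dotvC _ _ a) (dotvC _ _ v) !dotvD !dotvZ (dotvC _ v a).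
have vp : 0 < dotv n v v by rewrite lt_def v0 dotvv_ge0.
rewrite -(ler_pM2r vp) mul0r -subr_ge0 /c => H; rewrite -subr_ge0.
apply: le_trans H _; rewrite le_eqVlt; apply/orP; left; apply/eqP.
by field.
Qed.

Lemma dotv_split n i j a v : (i < n)%N -> (j < n)%N -> i != j ->
  dotv n a v = a i * v i + a j * v j
    + \sum_(k < n | (k != i :> nat) && (k != j :> nat)) a k * v k.
Proof.
move=> li lj ij; rewrite /dotv (bigD1 (Ordinal li)) //= (bigD1 (Ordinal lj)) /=.
  by rewrite addrA.
by rewrite -val_eqE /= eq_sym.
Qed.

(* T' is the transpose of the orthogonal map T. *)
Definition isometry_pair n (T T' : vec -> vec) :=
  [/\ measurable_fun setT T,
      forall h, nnmeas h ->
        multi_int (iota 0 n) (h \o T) = multi_int (iota 0 n) h,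
      forall a v, dotv n a (T v) = dotv n (T' a) v,
      forall v w, dotv n (T v) (T w) = dotv n v w &
      forall v w, dotv n (T' v) (T' w) = dotv n v w].

Lemma isometry_pair_id n : isometry_pair n id id.
Proof. by split => //; exact: measurable_id. Qed.

Lemma nnmeas_comp h (T : vec -> vec) :
  nnmeas h -> measurable_fun setT T -> nnmeas (h \o T).
Proof.
move=> [mh h0] mT; split; last by move=> v; exact: h0.
exact: (measurableT_comp mh).
Qed.

Lemma isometry_pair_comp n T T' U U' : isometry_pair n T T' ->
  isometry_pair n U U' -> isometry_pair n (T \o U) (U' \o T').
Proof.
move=> [mT iT aT oT oT'] [mU iU aU oU oU']; split.
- exact: (measurableT_comp mT).
- by move=> h hh; rewrite compA iU ?iT //; exact: nnmeas_comp.
- by move=> a v; rewrite /= aT aU.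
- by move=> v w; rewrite /= oT oU.
- by move=> v w; rewrite /= oU' oT'.
Qed.

Definition plane_rot i j (c s : R) v : vec :=
  upd i (c * v i - s * v j) (upd j (s * v i + c * v j) v).

Definition shear i j (t : R) v : vec := upd i (v i + t * v j) v.

(* A plane rotation of angle not a multiple of pi is a product of three
   shears, which preserve Lebesgue measure by translation invariance. *)
Lemma plane_rot_shear i j c s v : i != j -> s != 0 -> c ^+ 2 + s ^+ 2 = 1 ->
  plane_rot i j c s v
  = shear i j ((c - 1) / s) (shear j i s (shear i j ((c - 1) / s) v)).
Proof.
move=> ij s0 cs; apply/funext => k.
have ji : j != i by rewrite eq_sym.
rewrite /plane_rot /shear /upd /= !eqxx (negbTE ij) (negbTE ji).
have e : s * s = 1 - c * c by rewrite -!expr2 -cs; ring.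
have [_|ki] := eqVneq k i; last first.
  have [_|//] := eqVneq k j; by field.
apply: (mulIf s0); apply/eqP; rewrite -subr_eq0; apply/eqP.
rewrite (_ : _ - _ = (1 - c * c - s * s) * v j); first by rewrite e; ring.
by field.
Qed.

Lemma measurable_shear i j t : measurable_fun setT (shear i j t).
Proof.
apply: measurable_upd => //; apply: measurable_funD; first exact: measurable_coord.
by apply: measurable_funM => //; exact: measurable_coord.
Qed.

Lemma multi_int_comp_shear r i j t h : i \in r -> i != j -> nnmeas h ->
  multi_int r (h \o shear i j t) = multi_int r h.
Proof.
move=> ir ij hh; apply: (@multi_int_shear R r i (fun v => t * v j)) => //.
  by apply: measurable_funM => //; exact: measurable_coord.
by move=> x v; rewrite upd_neq // eq_sym.
Qed.

Lemma isometry_pair_rot n i j c s : (i < n)%N -> (j < n)%N -> i != j -> s != 0 ->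
  c ^+ 2 + s ^+ 2 = 1 ->
  isometry_pair n (plane_rot i j c s) (plane_rot i j c (- s)).
Proof.
move=> li lj ij s0 cs.
have rI (u : R) v : plane_rot i j c u v i = c * v i - u * v j.
  by rewrite /plane_rot upd_same.
have rJ (u : R) v : plane_rot i j c u v j = u * v i + c * v j.
  by rewrite /plane_rot upd_neq ?upd_same // eq_sym.
have rK (u : R) v k : k != i -> k != j -> plane_rot i j c u v k = v k.
  by move=> ki kj; rewrite /plane_rot !upd_neq.
have iso u v w : c ^+ 2 + u ^+ 2 = 1 ->
    dotv n (plane_rot i j c u v) (plane_rot i j c u w) = dotv n v w.
  move=> cu; rewrite !(dotv_split _ _ li lj ij) !rI !rJ; congr (_ + _).
    transitivity ((c ^+ 2 + u ^+ 2) * (v i * w i + v j * w j)); first by ring.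
    by rewrite cu mul1r.
  by apply: eq_bigr => k /andP[ki kj]; rewrite !rK.
split.
- apply: measurable_upd.
    by apply: measurable_funB; apply: measurable_funM => //; exact: measurable_coord.
  apply: measurable_upd => //.
  by apply: measurable_funD; apply: measurable_funM => //; exact: measurable_coord.
- move=> h hh.
  have -> : h \o plane_rot i j c s = ((h \o shear i j ((c - 1) / s)) \o shear j i s)
      \o shear i j ((c - 1) / s).
    by apply/funext => v /=; rewrite plane_rot_shear.
  have m t k l := measurable_shear k l t.
  rewrite !multi_int_comp_shear ?mem_iota ?add0n //; do ?apply: nnmeas_comp => //.
  by rewrite eq_sym.
- move=> a v; rewrite !(dotv_split _ _ li lj ij) !rI !rJ; congr (_ + _).
    by ring.
  by apply: eq_bigr => k /andP[ki kj]; rewrite !rK.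
- by move=> v w; exact: iso.
- by move=> v w; apply: iso; rewrite sqrrN.
Qed.

Lemma isometry_pair_opp n i : (i < n)%N ->
  isometry_pair n (fun v => upd i (- v i) v) (fun v => upd i (- v i) v).
Proof.
move=> li.
have E a v : dotv n a v = a i * v i + \sum_(k < n | k != i :> nat) a k * v k.
  by rewrite /dotv (bigD1 (Ordinal li)).
split.
- by apply: measurable_upd => //; apply: measurableT_comp => //; exact: measurable_coord.
- by move=> h hh; apply: multi_int_opp => //; rewrite mem_iota.
- move=> a v; rewrite !E !upd_same mulrN mulNr; congr (_ + _).
  by apply: eq_bigr => k ki; rewrite !upd_neq.
- move=> a v; rewrite !E !upd_same mulrNN; congr (_ + _).
  by apply: eq_bigr => k ki; rewrite !upd_neq.
- move=> a v; rewrite !E !upd_same mulrNN; congr (_ + _).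
  by apply: eq_bigr => k ki; rewrite !upd_neq.
Qed.

(** Givens rotations: in the plane (m, n) a rotation moves the m-th entry of the image of a into the
    n-th one, for each m < n. The length of a is then left in the last entry up to sign, and a
    reflection corrects the sign. *)
Lemma isometry_to_axis n a : exists T T', [/\ isometry_pair n.+1 T T',
  forall k, (k < n)%N -> T' a k = 0 & T' a n = Num.sqrt (dotv n.+1 a a)].
Proof.
have [T [T' [TT' Ta]]] : exists T T', isometry_pair n.+1 T T' /\
    forall k, (k < n)%N -> T' a k = 0.
  suff : forall m, (m <= n)%N -> exists T T', isometry_pair n.+1 T T' /\
    forall k, (k < m)%N -> T' a k = 0 by apply.
  elim=> [_|m IH mn]; first by exists id, id; split => //; exact: isometry_pair_id.
  have [T [T' [TT' Ta]]] := IH (ltnW mn).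
  (* An entry that vanishes already is left alone: its rotation would have sine 0, which the
     factorization into shears excludes. *)
  have [b0|b0] := eqVneq (T' a m) 0.
    exists T, T'; split => // k; rewrite ltnS leq_eqVlt => /predU1P[->//|].
    exact: Ta.
  pose r := Num.sqrt (T' a m ^+ 2 + T' a n ^+ 2).
  have r2 : r ^+ 2 = T' a m ^+ 2 + T' a n ^+ 2.
    by rewrite sqr_sqrtr // addr_ge0 // sqr_ge0.
  have r0 : r != 0.
    by rewrite -sqrf_eq0 r2 paddr_eq0 ?sqr_ge0 // negb_and sqrf_eq0 b0.
  have mn' : m != n by rewrite neq_ltn mn.
  have rot := @isometry_pair_rot n.+1 m n (T' a n / r) (- (T' a m / r))
    (leqW mn) (leqnn _) mn'.
  exists (T \o plane_rot m n (T' a n / r) (- (T' a m / r))),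
    (plane_rot m n (T' a n / r) (- - (T' a m / r)) \o T'); split.
    apply: (isometry_pair_comp TT'); apply: rot.
      by rewrite oppr_eq0 mulf_neq0 // invr_eq0.
    rewrite sqrrN !expr_div_n -mulrDl addrC -r2 divff //.
    by rewrite sqrf_eq0.
  move=> k; rewrite ltnS leq_eqVlt => /predU1P[->|km] /=.
    rewrite /plane_rot upd_same opprK; by field.
  rewrite /plane_rot !upd_neq ?Ta //.
    by rewrite neq_ltn (ltn_trans km mn).
  by rewrite neq_ltn km.
have En U U' : isometry_pair n.+1 U U' -> (forall k, (k < n)%N -> U' a k = 0) ->
    U' a n ^+ 2 = dotv n.+1 a a.
  move=> [_ _ _ _ o] Ua; rewrite -o dotv_recr {1}/dotv big1 ?add0r // => k _.
  by rewrite Ua // mul0r.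
have [pos|neg] := leP 0 (T' a n).
  exists T, T'; split => //.
  by rewrite -(En _ _ TT' Ta) sqrtr_sqr ger0_norm.
have flip := isometry_pair_comp TT' (isometry_pair_opp (leqnn n.+1)).
have fa k : (k < n)%N -> upd n (- T' a n) (T' a) k = 0.
  by move=> kn; rewrite upd_neq ?Ta // neq_ltn kn.
eexists; eexists; split; [exact: flip|exact: fa|] => /=.
by rewrite -(En _ _ flip fa) /= upd_same sqrtr_sqr ger0_norm // oppr_ge0 ltW.
Qed.

End orthogonal_maps.

(** * Measures with density and the substitution t / sqrt (1 - t ^ 2) *)

Section weighted_measure.
Local Open Scope ereal_scope.
Context d (T : measurableType d) (R : realType).
Variables (m : {measure set T -> \bar R}) (w : T -> R).
Hypothesis mw : measurable_fun setT w.
Hypothesis w0 : forall x, (0 <= w x)%R.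

Definition weighted_measure (A : set T) : \bar R := \int[m]_(x in A) (w x)%:E.

Let weighted_measure0 : weighted_measure set0 = 0.
Proof. by rewrite /weighted_measure integral_set0. Qed.

Let weighted_measure_ge0 A : 0 <= weighted_measure A.
Proof. by apply: integral_ge0 => x _; rewrite lee_fin. Qed.

Let weighted_measure_sigma_additive : semi_sigma_additive weighted_measure.
Proof.
move=> F mF tF mUF; rewrite /weighted_measure ge0_integral_bigcup //=; first last.
- by move=> x _; rewrite lee_fin.
- by apply: measurable_funTS; exact/measurable_EFinP.
by apply: is_cvg_ereal_nneg_natsum_cond => n _ _; apply: integral_ge0 => x _; rewrite lee_fin.
Qed.

HB.instance Definition _ := isMeasure.Build _ _ _ weighted_measure
  weighted_measure0 weighted_measure_ge0 weighted_measure_sigma_additive.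

Definition measure_with_density : {measure set T -> \bar R} := weighted_measure.

Import HBNNSimple.

(** Both sides are limits along an increasing sequence of simple functions, and for the indicator of
    a level set the identity is the definition of the weighted measure. *)
Lemma ge0_integral_weighted_measure (f : T -> \bar R) :
  measurable_fun setT f -> (forall x, 0 <= f x) ->
  \int[weighted_measure]_x f x = \int[m]_x (f x * (w x)%:E).
Proof.
move=> mf f0.
have mwE : measurable_fun setT (fun x => (w x)%:E) by exact/measurable_EFinP.
pose g := nnsfun_approx measurableT mf.
have gf x : EFin \o g ^~ x @ \oo --> f x.
  by apply: (@cvg_nnsfun_approx _ _ _ _ measurableT) => // y _; exact: f0.
have ndg x : {homo (fun n => (g n x)%:E) : a b / (a <= b)%N >-> a <= b}.
  by move=> a b ab; rewrite lee_fin; exact/lefP/nd_nnsfun_approx.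
transitivity (limn (fun n => \int[weighted_measure]_x (g n x)%:E)).
  rewrite -monotone_convergence //; last 2 first.
  - by move=> n; exact/measurable_EFinP/measurable_funP.
  - by move=> n x _; rewrite lee_fin.
  by apply: eq_integral => x _; apply/esym/cvg_lim => //; exact: gf.
transitivity (limn (fun n => \int[m]_x ((g n x)%:E * (w x)%:E))); last first.
  rewrite -monotone_convergence //; last 3 first.
  - move=> n; apply: emeasurable_funM => //.
    exact/measurable_EFinP/measurable_funP.
  - by move=> n x _; rewrite mule_ge0 // lee_fin.
  - by move=> x _ a b ab; rewrite lee_wpmul2r ?lee_fin //; exact: ndg.
  apply: eq_integral => x _; apply/cvg_lim => //.
  by apply: cvgeZr => //; exact: gf.
congr (limn _); apply/funext => n.
rewrite integralT_nnsfun sintegralE.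
transitivity (\int[m]_x \sum_(r \in range (g n))
    (r%:E * (\1_(g n @^-1` [set r]) x)%:E * (w x)%:E)).
  rewrite ge0_integral_fsum //.
  - apply: eq_fsbigr => r; rewrite inE => -[t _ gr].
    under eq_integral do rewrite -muleA.
    rewrite ge0_integralZl //.
    + congr (_ * _); rewrite -[LHS]/(\int[m]_(x in _) (w x)%:E).
      rewrite [LHS]integral_mkcond; apply: eq_integral => x _; rewrite /patch indicE.
      by case: ifPn; rewrite ?mul1e ?mul0e.
    + apply: emeasurable_funM => //; apply/measurable_EFinP.
      exact: measurable_indic.
    + by move=> x _; rewrite mule_ge0 // lee_fin.
    + by rewrite lee_fin -gr.
  - move=> r; apply: emeasurable_funM => //; apply/measurable_EFinP.
    apply: measurable_funM => //; exact: measurable_indic.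
  - by move=> r x _; apply: mule_ge0; [exact: nnfun_muleindic_ge0|rewrite lee_fin].
apply: eq_integral => x _.
rewrite -ge0_mule_fsuml; last by move=> r; rewrite nnfun_muleindic_ge0.
by congr (_ * _); rewrite [in RHS]fimfunE -fsumEFin.
Qed.

End weighted_measure.

Section substitution.
Variable R : realType.
Notation mu := (@lebesgue_measure R).

Lemma integral_is_derive (f F : R -> R) (a b : R) : a < b ->
  (forall x, a <= x <= b -> is_derive x 1 F (f x)) ->
  (forall x, a <= x <= b -> {for x, continuous f}) ->
  (\int[mu]_(x in `[a, b]) (f x)%:E = (F b - F a)%:E)%E.
Proof.
move=> ab dF cf.
have cF x : a <= x <= b -> {for x, continuous F}.
  move=> /dF [dFx _].
  by apply/differentiable_continuous; exact/derivable1_diffP.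
rewrite (@continuous_FTC2 _ f F) ?EFinB //.
- by apply: continuous_in_subspaceT => x; rewrite inE /= in_itv /=; exact: cf.
- split.
  + by move=> x; rewrite in_itv /= => /andP[ax xb]; have [] := dF x; rewrite ?ltW.
  + by apply: cvg_at_right_filter; apply: cF; rewrite lexx ltW.
  + by apply: cvg_at_left_filter; apply: cF; rewrite lexx ltW.
- move=> x; rewrite in_itv /= => /andP[ax xb].
  by rewrite derive1E; apply: derive_val; apply: dF; rewrite !ltW.
Qed.

Lemma measurable_invr : measurable_fun setT (fun x : R => x^-1).
Proof.
(* Measurability of real powers gives that of the inverse; at 0 both sides are 0, the left one by
   convention. *)
rewrite (_ : (fun x => x^-1) = (fun x : R => x * (x ^+ 2) `^ (-1))).
  apply: measurable_funM => //.
  have m2 : measurable_fun [set: R] (fun x : R => x ^+ 2) by exact: exprn_measurable.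
  exact: (measurableT_comp (measurable_powR (-1)) m2).
apply/funext => x; rewrite powR_inv1 ?sqr_ge0 //.
have [->|x0] := eqVneq x 0; first by rewrite invr0 mul0r.
by field.
Qed.

Lemma measurable_sqrtr : measurable_fun setT (@Num.sqrt R).
Proof. by apply: continuous_measurable_fun; exact: sqrt_continuous. Qed.

(** For t = cos theta this is cot theta: it recovers the ratio of the last coordinate to the norm of
    the others from the cosine t of the angle to the last axis. *)
Definition cotangent_map (t : R) : R := t / Num.sqrt (1 - t ^+ 2).

(** The derivative (1 - t ^ 2) ^ (-3/2) of [cotangent_map], extended by 0 so that the substitution
    can be written with integrals over the whole line. *)
Definition cotangent_weight (t : R) : R :=
  if (-1 < t) && (t < 1) then ((1 - t ^+ 2) * Num.sqrt (1 - t ^+ 2))^-1 else 0.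

Lemma one_sub_sqr_gt0 (t : R) : (-1 < t < 1) = (0 < 1 - t ^+ 2).
Proof. by apply/idP/idP => [/andP[a b]|h]; [|apply/andP; split]; nra. Qed.

Lemma is_derive_cotangent_map (t : R) : -1 < t < 1 ->
  is_derive t 1 cotangent_map ((1 - t ^+ 2) * Num.sqrt (1 - t ^+ 2))^-1.
Proof.
rewrite one_sub_sqr_gt0 => t1.
have s0 : Num.sqrt (1 - t ^+ 2) != 0 by rewrite gt_eqF // sqrtr_gt0.
have d1 : is_derive t 1 (fun t : R => 1 - t ^+ 2) (- (2 * t)).
  by apply: is_derive_eq; rewrite /GRing.scale /=; ring.
have d2 := @is_derive1_comp R Num.sqrt (fun t : R => 1 - t ^+ 2) t _ _
  (is_derive1_sqrt t1) d1.
have d3 := @is_deriveV R (Num.sqrt \o (fun t : R => 1 - t ^+ 2)) t _ _ s0 d2.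
have d4 := is_deriveM (is_derive_id t 1) d3.
apply: is_derive_eq d4 _.
rewrite /GRing.scale /=.
have e : Num.sqrt (1 - t ^+ 2) ^+ 2 = 1 - t ^+ 2 by rewrite sqr_sqrtr // ltW.
set s := Num.sqrt _ in s0 e *.
rewrite (_ : t ^+ 2 = 1 - s ^+ 2); last by rewrite e; ring.
rewrite !opprB addrCA subrr addr0.
have tt : t * t = 1 - s * s by rewrite -!expr2 e; ring.
rewrite (_ : _ + _ = (s * s + t * t) / (s * s * s)); last by field.
by rewrite tt; field.
Qed.

Lemma measurable_cotangent_map : measurable_fun setT cotangent_map.
Proof.
apply: measurable_funM => //; apply: (measurableT_comp measurable_invr).
apply: (measurableT_comp measurable_sqrtr); apply: measurable_funB => //.
Qed.

Lemma measurable_cotangent_weight : measurable_fun setT cotangent_weight.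
Proof.
apply: measurable_fun_ifT => //.
  by apply: measurable_and; apply: measurable_fun_ltr.
have m1 : measurable_fun setT (fun t : R => 1 - t ^+ 2).
  by apply: measurable_funB => //; exact: exprn_measurable.
apply: (measurableT_comp measurable_invr); apply: measurable_funM => //.
exact: (measurableT_comp measurable_sqrtr).
Qed.

Lemma cotangent_weight_ge0 t : 0 <= cotangent_weight t.
Proof.
rewrite /cotangent_weight; case: ifPn => //; rewrite one_sub_sqr_gt0 => t1.
by rewrite invr_ge0 mulr_ge0 ?sqrtr_ge0 // ltW.
Qed.

Lemma cotangent_map_lt (t u : R) : -1 < t < 1 -> -1 < u < 1 ->
  t < u -> cotangent_map t < cotangent_map u.
Proof.
move=> t1 u1.
apply: (@gtr0_derive1_lt_oo R cotangent_map (-1) 1); rewrite ?in_itv //=.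
- by move=> x; rewrite in_itv /= => /is_derive_cotangent_map [].
- move=> x; rewrite in_itv /= => x1; have D := is_derive_cotangent_map x1.
  rewrite derive1E (@derive_val _ _ _ _ _ _ _ D).
  by rewrite one_sub_sqr_gt0 in x1; rewrite invr_gt0 mulr_gt0 // sqrtr_gt0.
- move=> x; rewrite inE /= in_itv /= => /is_derive_cotangent_map [+ _].
  by move=> /derivable1_diffP; exact: differentiable_continuous.
Qed.

Lemma cotangent_mapK (x : R) : exists2 t, -1 < t < 1 & cotangent_map t = x.
Proof.
have x1 : 0 < 1 + x ^+ 2 by rewrite ltr_pwDl // sqr_ge0.
pose r := Num.sqrt (1 + x ^+ 2).
have r0 : 0 < r by rewrite sqrtr_gt0.
have r2 : r ^+ 2 = 1 + x ^+ 2 by rewrite sqr_sqrtr // ltW.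
have e : 1 - (x / r) ^+ 2 = r^-1 ^+ 2.
  rewrite (_ : 1 = (r ^+ 2) / (r ^+ 2)); last by rewrite divff // sqrf_eq0 gt_eqF.
  by rewrite expr_div_n -mulrBl r2 addrK exprVn r2 mul1r.
exists (x / r).
  by rewrite one_sub_sqr_gt0 e exprn_gt0 // invr_gt0.
rewrite /cotangent_map e sqrtr_sqr ger0_norm ?invr_ge0 ?ltW // invrK divfK //.
by rewrite gt_eqF.
Qed.

(** The image under [cotangent_map] of the measure with density [cotangent_weight] is Lebesgue
    measure: on ]a, b] this is the fundamental theorem of calculus between the preimages of a and
    b. *)
Lemma ge0_integral_cotangent_map (f : R -> \bar R) : measurable_fun setT f ->
  (forall x, 0 <= f x)%E ->
  (\int[mu]_x f x
   = \int[mu]_t (f (cotangent_map t) * (cotangent_weight t)%:E))%E.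
Proof.
move=> mf f0.
have mw := measurable_cotangent_weight; have w0 := cotangent_weight_ge0.
pose nu := measure_with_density mu mw w0.
pose phi : measurableTypeR R -> measurableTypeR R := cotangent_map.
have mphi : measurable_fun setT phi := measurable_cotangent_map.
have E A : measurable A -> mu A = pushforward nu phi A.
  move=> mA; apply: (@lebesgue_measure_unique R (pushforward nu phi)) => //.
  move=> /= _ [[a b]] _ <-.
  have [s s1 sa] := cotangent_mapK a; have [u u1 ub] := cotangent_mapK b.
  have lt_mono x y : -1 < x < 1 -> -1 < y < 1 ->
      (cotangent_map x < cotangent_map y) = (x < y).
    move=> x1 y1; apply/idP/idP; last exact: cotangent_map_lt.
    apply: contraTT; rewrite -!leNgt le_eqVlt => /predU1P[->//|yx].
    by rewrite ltW // cotangent_map_lt.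
  rewrite lebesgue_measure_itv /= lte_fin.
  rewrite /pushforward /weighted_measure.
  have -> : (\int[mu]_(x in cotangent_map @^-1` `]a, b]) (cotangent_weight x)%:E =
     \int[mu]_(x in `]s, u]) (cotangent_weight x)%:E)%E.
    rewrite [LHS]integral_mkcond [RHS]integral_mkcond.
    apply: eq_integral => x _; rewrite /patch.
    have [x1|x1] := boolP (-1 < x < 1); last first.
      by rewrite /cotangent_weight (negbTE x1) !if_same.
    (* Monotonicity identifies the two sets inside ]-1, 1[; outside, the weight is 0 and the case is
       already settled. *)
    rewrite (_ : (x \in cotangent_map @^-1` `]a, b]) = (x \in `]s, u]%classic)) //.
    apply/idP/idP; rewrite !inE /= !in_itv /= -sa -ub lt_mono //;
      by move=> /andP[-> /=]; rewrite !leNgt lt_mono.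
  rewrite -sa -ub lt_mono //; case: ifPn => [su|]; last first.
    by rewrite -leNgt => us; rewrite set_itv_ge ?integral_set0 // bnd_simp -leNgt.
  rewrite integral_itv_obnd_cbnd; last first.
    by apply/measurable_EFinP; exact: measurable_funTS.
  have in1 x : s <= x <= u -> -1 < x < 1.
    move: s1 u1 => /andP[s1 _] /andP[_ u1] /andP[sx xu].
    by rewrite (lt_le_trans s1 sx) (le_lt_trans xu u1).
  under eq_integral => x.
    rewrite inE /= in_itv /= => /in1 x1.
    rewrite /cotangent_weight x1; over.
  pose g (t : R) := ((1 - t ^+ 2) * Num.sqrt (1 - t ^+ 2))^-1.
  have D x : s <= x <= u -> is_derive x 1 cotangent_map (g x).
    by move=> /in1; exact: is_derive_cotangent_map.
  have C x : s <= x <= u -> {for x, continuous g}.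
    move=> /in1; rewrite one_sub_sqr_gt0 => x1.
    have c1 : {for x, continuous (fun t : R => 1 - t ^+ 2)}.
      by apply: cvgB; [exact: cvg_cst|exact: exprn_continuous].
    apply: cvgV; first by rewrite gt_eqF // mulr_gt0 // sqrtr_gt0.
    apply: cvgM => //.
    by apply: continuous_comp => //; exact: sqrt_continuous.
  exact: esym (integral_is_derive su D C).
rewrite (@eq_measure_integral _ _ _ _ (pushforward nu phi)); last first.
  by move=> A mA _; exact: E.
rewrite (@ge0_integral_pushforward _ _ _ _ _ _ mphi
  nu setT f) //.
rewrite preimage_setT ge0_integral_weighted_measure //.
  by apply: (measurableT_comp mf).
by move=> x; exact: f0.
Qed.

End substitution.

(** * The Gegenbauer equation and the product formula *)

Section gegenbauer_equation.
Variable R : realType.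
Implicit Types (p P : {poly R}) (s t x N : R).

(** The Gegenbauer equation of index (d - 1) / 2. The degree k enters only through N = k (k + d -
    1), which is left free. *)
Definition geg_equation (d : nat) N p :=
  (1 - 'X^2) * p^`(2) - d%:R * 'X * p^`() + N%:P * p = 0.

Lemma geg_equation_lin d N a b p q : geg_equation d N p -> geg_equation d N q ->
  geg_equation d N (a%:P * p - b%:P * q).
Proof.
rewrite /geg_equation !derivnS derivn0 => hp hq.
rewrite !(derivB, deriv_mulC, derivM, derivC).
rewrite [LHS](_ : _ = a%:P * ((1 - 'X^2) * p^`()^`() - d%:R * 'X * p^`() + N%:P * p)
  - b%:P * ((1 - 'X^2) * q^`()^`() - d%:R * 'X * q^`() + N%:P * q)); last by ring.
by rewrite hp hq !mulr0 subr0.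
Qed.

(** Each differentiation raises the dimension parameter d by 2 and lowers the constant accordingly.
    The predecessor is harmless at m = 0, where it is multiplied by 0. *)
Lemma geg_equation_derivn d N p m : geg_equation d N p ->
  (1 - 'X^2) * p^`(m.+2) - (d + 2 * m)%:R * 'X * p^`(m.+1)
  + (N%:P - (m * m.-1 + d * m)%:R) * p^`(m) = 0.
Proof.
move=> hp; elim: m => [|m IH].
  by rewrite !muln0 addn0 subr0 derivn0; move: hp; rewrite /geg_equation derivnS.
have := congr1 deriv IH.
rewrite deriv0 !(derivD, derivN, derivB, derivM, derivX, derivC, derivXn) -!derivnS.
rewrite !linearMn /= !derivC => <-.
have -> : (m.+1 * m.+1.-1 = m * m.-1 + 2 * m)%N by case: m {IH} => //= m; nia.
rewrite !natrD !natrM -[m.+1%:R]natr1.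
ring.
Qed.

(* At 1 the leading coefficient 1 - x^2 vanishes, so that the equations satisfied
   by the successive derivatives determine the whole Taylor expansion there. *)
Lemma geg_equation_uniq d N p : (0 < d)%N -> geg_equation d N p -> p.[1] = 0 ->
  forall x, p.[x] = 0.
Proof.
move=> d0 hp p1 x.
have H m : p^`(m).[1] = 0.
  elim: m => // m IH.
  have := congr1 (horner^~ 1) (geg_equation_derivn m hp).
  rewrite -!polyC_natr !(hornerD, hornerN, hornerM, hornerXn, hornerX, hornerC).
  rewrite IH !mulr1 subrr mul0r mulr0 addr0 sub0r.
  move=> /eqP; rewrite oppr_eq0 mulf_eq0 => /orP[|/eqP //].
  rewrite pnatr_eq0; lia.
rewrite -(subrK 1 x) addrC nderiv_taylor; last exact: mulrC.
rewrite big1 // => i _.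
have := H i; rewrite nderivn_def hornerMn => /eqP.
by rewrite mulrn_eq0 -implyNb -lt0n fact_gt0 => /eqP ->; rewrite mul0r.
Qed.

(** In closed form 1 / (2 ^ j j! d (d + 2) ... (d + 2 j - 2)). The recursive form is what the
    telescoping in [mean_poly_equation] consumes. *)
Fixpoint mean_coef (d j : nat) : R :=
  if j is j'.+1 then mean_coef d j' / (2 * j%:R * (d + 2 * j')%:R) else 1.

Lemma mean_coefS d j : (0 < d)%N ->
  mean_coef d j = mean_coef d j.+1 * (2 * j.+1%:R * (d + 2 * j)%:R).
Proof.
move=> d0; rewrite /= divfK // -natrM -natrM pnatr_eq0; lia.
Qed.
Arguments mean_coef : simpl never.

(* The mean of p (s t + sqrt (1 - s ^ 2) sqrt (1 - t ^ 2) u), as a polynomial in s, where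
   u is a coordinate of a uniform point of S^(d-1): expand p at s t and use
   mean_coef d j = E (u ^ (2 j)) / (2 j)!. *)
Definition mean_poly d p t : {poly R} :=
  \sum_(j < (size p).+1)
    (mean_coef d j * (1 - t ^+ 2) ^+ j)%:P
    * ((p^`(2 * j) \Po (t%:P * 'X)) * (1 - 'X^2) ^+ j).

Lemma deriv_comp_scale p t : (p \Po (t%:P * 'X))^`() = t%:P * (p^`() \Po (t%:P * 'X)).
Proof. by rewrite deriv_comp derivM derivC derivX; ring. Qed.

(** P0, P1, P2 stand for consecutive derivatives of one polynomial composed with t X. Replacing X ^
    2 by 1 - q sorts the outcome into a multiple of q ^ n and a multiple of q ^ (n - 1); the latter
    has coefficient 0 when n = 0. *)
Lemma geg_operator_mul d (P0 P1 P2 : {poly R}) t n :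
  P0^`() = t%:P * P1 -> P1^`() = t%:P * P2 ->
  let q : {poly R} := 1 - 'X^2 in
  q * (P0 * q ^+ n)^`(2) - d%:R * 'X * (P0 * q ^+ n)^`()
  = q ^+ n * (t%:P ^+ 2 * q * P2 - (4 * n + d)%:R * 'X * t%:P * P1
              - (2 * n * (2 * n).-1 + 2 * n * d)%:R * P0)
    + (2 * n * (2 * n.-1 + d))%:R * q ^+ n.-1 * P0.
Proof.
move=> h0 h1 q.
have dq : q^`() = - 2%:R * 'X.
  by rewrite /q derivB derivC derivXn /=; ring.
have X2 : 'X * 'X = 1 - q by rewrite /q; ring.
have dt : t%:P^`() = 0 by rewrite derivC.
rewrite !derivnS derivn0.
case: n => [|[|n]].
- rewrite !expr0 !mulr1 h0 derivM dt h1 !muln0 !mul0n !addn0 !add0n; ring.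
- rewrite !expr1 expr0 !derivM h0 dq !derivD !derivM dt h1 h0 dq derivX !derivN derivMn derivC.
  rewrite (_ : (2 * 1 * (2 * 1).-1 + 2 * 1 * d = 2 + 2 * d)%N); last by lia.
  rewrite (_ : (2 * 1 * (2 * 1.-1 + d) = 2 * d)%N); last by lia.
  rewrite !natrD !natrM mul0rn oppr0 mul0r mul0r.
  transitivity (q * (t%:P ^+ 2 * q * P2 - (4 + d%:R) * 'X * t%:P * P1)
    - 2 * q * P0 + 2 * d%:R * ('X * 'X) * P0); first by ring.
  by rewrite X2; ring.
- set Q := q ^+ n; rewrite [q ^+ n.+2]exprS [n.+2.-1]/= [q ^+ n.+1]exprS -/Q.
  have dQ : (q * (q * Q))^`() = - (2 * n.+2)%:R * 'X * q * Q.
    by rewrite -!exprS deriv_exp dq /= exprS -/Q natrM; ring.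
  have dQ1 : (q * Q)^`() = - (2 * n.+1)%:R * 'X * Q.
    by rewrite -exprS deriv_exp dq /= -/Q natrM; ring.
  have dn k : (k%:R : {poly R})^`() = 0 by rewrite -polyC_natr derivC.
  have -> : (P0 * (q * (q * Q)))^`()
     = t%:P * P1 * (q * (q * Q)) - (2 * n.+2)%:R * 'X * P0 * (q * Q).
    by rewrite derivM h0 dQ; ring.
  have -> : (t%:P * P1 * (q * (q * Q)) - (2 * n.+2)%:R * 'X * P0 * (q * Q))^`()
     = t%:P ^+ 2 * P2 * (q * (q * Q)) - 2 * (2 * n.+2)%:R * 'X * t%:P * P1 * (q * Q)
       - (2 * n.+2)%:R * P0 * (q * Q)
       + (2 * n.+2)%:R * (2 * n.+1)%:R * ('X * 'X) * P0 * Q.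
    by rewrite derivB [(t%:P * _ * _)^`()]derivM [((2 * n.+2)%:R * _ * _ * _)^`()]derivM
      dQ dQ1 !derivM dt h0 h1 derivX dn; ring.
  have -> : (2 * n.+2 * (2 * n.+2).-1 + 2 * n.+2 * d)%:R
      = 2 * n.+2%:R * (2 * n.+1%:R + 1 + d%:R) :> {poly R}.
    by rewrite -natrM -natrM natr1 -natrD -natrM; congr _%:R; lia.
  have -> : (2 * n.+2 * (2 * n.+1 + d))%:R = 2 * n.+2%:R * (2 * n.+1%:R + d%:R) :> {poly R}.
    by rewrite -natrM -natrM -natrD -natrM.
  have -> : (4 * n.+2 + d)%:R = 4 * n.+2%:R + d%:R :> {poly R} by rewrite natrD natrM.
  have -> : (2 * n.+2)%:R = 2 * n.+2%:R :> {poly R} by rewrite natrM.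
  have -> : (2 * n.+1)%:R = 2 * n.+1%:R :> {poly R} by rewrite natrM.
  transitivity (q * (q * Q) * (t%:P ^+ 2 * q * P2
    - (4 * n.+2%:R + d%:R) * 'X * t%:P * P1 - 2 * n.+2%:R * P0)
    + 2 * n.+2%:R * (2 * n.+1%:R + d%:R) * ('X * 'X) * P0 * (q * Q)).
    by ring.
  by rewrite X2; ring.
Qed.

(* The operator maps the j-th term of the sum to U j - U j.+1. *)
Lemma mean_poly_equation d N p t : (0 < d)%N -> geg_equation d N p ->
  geg_equation d N (mean_poly d p t).
Proof.
move=> d0 hp; set q : {poly R} := 1 - 'X^2; pose r := 1 - t ^+ 2.
pose C k : {poly R} := p^`(k) \Po (t%:P * 'X).
pose c j : {poly R} := (mean_coef d j * r ^+ j)%:P.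
pose T j := C (2 * j)%N * q ^+ j.
pose U j := if j is j'.+1 then
  (mean_coef d j')%:P * (r ^+ j)%:P * q ^+ j' * C (2 * j)%N else 0.
have dC k : (C k)^`() = t%:P * C k.+1 by exact: deriv_comp_scale.
have key j : q * (T j)^`(2) - d%:R * 'X * (T j)^`()
   = - N%:P * T j + - r%:P * q ^+ j * C (2 * j).+2
     + (2 * j * (2 * j.-1 + d))%:R * q ^+ j.-1 * C (2 * j)%N.
  rewrite /T (@geg_operator_mul d _ _ _ t j (dC _) (dC _)) -/q.
  congr (_ + _).
  (* Since t ^ 2 (1 - X ^ 2) = (1 - t ^ 2 X ^ 2) - r, the equation of the derivative of order 2 j,
     taken at t X, accounts for everything except the term in -r. *)
  have := congr1 (fun p => p \Po (t%:P * 'X)) (geg_equation_derivn (2 * j) hp).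
  rewrite -!polyC_natr comp_poly0.
  rewrite !(comp_polyB, comp_polyD, comp_polyM, comp_polyC, comp_polyX, comp_Xn_poly).
  rewrite -/(C _) -/(C _) -/(C _) !polyC_natr => H.
  have -> : r%:P = 1 - t%:P ^+ 2 by rewrite /r rmorphB rmorphXn.
  apply/eqP; rewrite -subr_eq0.
  rewrite (_ : _ - _ = q ^+ j * 0); first by rewrite mulr0.
  rewrite -H /q.
  have -> : (d + 2 * (2 * j) = 4 * j + d)%N by lia.
  by rewrite (mulnC d); ring.
have step j : q * (c j * T j)^`(2) - d%:R * 'X * (c j * T j)^`() + N%:P * (c j * T j)
    = U j - U j.+1.
  have -> : (c j * T j)^`(2) = c j * (T j)^`(2).
    by rewrite !derivnS derivn0 /c !deriv_mulC.
  rewrite {2}/c deriv_mulC -/(c j).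
  transitivity (c j * (q * (T j)^`(2) - d%:R * 'X * (T j)^`() + N%:P * T j)).
    by ring.
  rewrite key /U /c; case: j => [|j].
    by rewrite !muln0 !mul0n !mul0r addr0 /= !expr0 expr1 muln1; ring.
  have -> : (2 * j.+1 * (2 * j + d))%:R = (2 * j.+1%:R * (d + 2 * j)%:R)%:P :> {poly R}.
    by rewrite -natrM -natrM polyC_natr; congr _%:R; lia.
  rewrite /= (_ : (2 * j.+2 = (2 * j.+1).+2)%N); last by lia.
  rewrite (mean_coefS j d0) !polyCM; ring.
have -> : mean_poly d p t = \sum_(j < (size p).+1) c j * T j by [].
rewrite /geg_equation [(\sum_(j < _) _)^`(2)]raddf_sum [(\sum_(j < _) _)^`()]raddf_sum /=.
rewrite !mulr_sumr -sumrB -big_split /=.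
under eq_bigr => j _ do rewrite -/q step.
rewrite -(big_mkord xpredT (fun j => U j - U j.+1)).
rewrite (@telescope_sumr_eq _ _ _ (fun j => - U j)) //; last first.
  by move=> j _; rewrite opprK addrC.
have z : p^`(2 * (size p).+1) = 0 by apply: derivn_poly0; lia.
by rewrite /U /C z comp_poly0 mulr0 subrr.
Qed.

(** At s = 1 the factors (1 - s ^ 2) ^ j kill all terms but j = 0, so the mean takes the value p(t)
    there; p(1) times the mean minus p(t) p is then a solution that vanishes at 1. *)
Lemma mean_poly_product d N p s t : (0 < d)%N -> geg_equation d N p ->
  p.[1] * (mean_poly d p t).[s] = p.[s] * p.[t].
Proof.
move=> d0 hp.
have E := geg_equation_lin p.[1] p.[t] (mean_poly_equation t d0 hp) hp.
have E1 : ((p.[1])%:P * mean_poly d p t - (p.[t])%:P * p).[1] = 0.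
  rewrite !(hornerD, hornerN, hornerM, hornerC).
  rewrite /mean_poly horner_sum big_ord_recl big1 ?addr0.
    rewrite muln0 derivn0 !expr0 !mulr1 !(hornerM, hornerC, horner_comp, hornerX).
    by rewrite mul1r mulr1 mulrC subrr.
  move=> i _; rewrite !(hornerM, hornerXn, horner_exp, hornerD, hornerN, hornerC, hornerX).
  by rewrite mulr1 subrr expr0n /= !mulr0.
have := geg_equation_uniq d0 E E1 s.
rewrite !(hornerD, hornerN, hornerM, hornerC) => /eqP; rewrite subr_eq0 => /eqP ->.
by rewrite mulrC.
Qed.

Lemma mean_polyE d p s t : (mean_poly d p t).[s] =
  \sum_(j < (size p).+1)
    mean_coef d j * ((1 - s ^+ 2) * (1 - t ^+ 2)) ^+ j * (p^`(2 * j)).[s * t].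
Proof.
rewrite /mean_poly horner_sum; apply: eq_bigr => j _.
rewrite !(hornerM, hornerXn, horner_exp, hornerD, hornerN, hornerC, horner_comp, hornerX).
by rewrite exprMn (mulrC t s); ring.
Qed.

(** The reflected polynomial solves the same equation, so uniqueness makes it proportional to p;
    evaluation at -1 shows p(1) ^ 2 = p(-1) ^ 2. This reduces the bound below to x >= 0. *)
Lemma geg_equation_parity d N p x : (0 < d)%N -> geg_equation d N p ->
  p.[- x] ^+ 2 = p.[x] ^+ 2.
Proof.
move=> d0 hp.
have hpN : geg_equation d N (p \Po - 'X).
  have := congr1 (fun q => q \Po - 'X) hp.
  rewrite /geg_equation !derivnS derivn0 comp_poly0 => H.
  rewrite -[RHS]H -!polyC_natr !deriv_comp derivN derivX.
  rewrite !(comp_polyB, comp_polyD, comp_polyM, comp_polyC, comp_polyX, comp_Xn_poly).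
  by rewrite !derivM deriv_comp !derivN derivC derivX; ring.
have E := geg_equation_lin p.[1] p.[-1] hpN hp.
have H y : p.[1] * p.[- y] = p.[-1] * p.[y].
  have := geg_equation_uniq d0 E _ y.
  rewrite !(hornerD, hornerN, hornerM, hornerC, horner_comp, hornerX).
  rewrite mulrC subrr => /(_ erefl) /eqP; rewrite subr_eq0 => /eqP <-.
  by [].
have [p1|p1] := eqVneq p.[1] 0.
  by rewrite !(geg_equation_uniq d0 hp p1).
have H1 : p.[1] ^+ 2 = p.[-1] ^+ 2 by have := H (-1); rewrite opprK -!expr2.
apply: (mulfI (x := p.[1] ^+ 2)); first by rewrite sqrf_eq0.
by rewrite -exprMn H exprMn H1.
Qed.

(* Sonin's function [p ^ 2 + (1 - x ^ 2) p' ^ 2 / N] is nondecreasing on [0, 1]. *)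
Lemma geg_equation_bound d N p x : (0 < d)%N -> 0 < N -> geg_equation d N p ->
  -1 <= x <= 1 -> `|p.[x]| <= `|p.[1]|.
Proof.
move=> d0 N0 hp.
wlog x0 : x / 0 <= x => [W /andP[x1 x2]|/andP[_ x1]].
  have [/W|x0] := leP 0 x; first by apply; rewrite x1.
  rewrite -ler_sqr ?nnegrE // !real_normK ?num_real //.
  rewrite -(geg_equation_parity x d0 hp).
  rewrite -[X in X <= _]real_normK ?num_real // -[X in _ <= X]real_normK ?num_real //.
  by rewrite ler_sqr ?nnegrE //; apply: W; [|apply/andP; split]; lra.
rewrite -ler_sqr ?nnegrE // !real_normK ?num_real //.
pose S : {poly R} := p ^+ 2 + (N^-1)%:P * ((1 - 'X^2) * p^`() ^+ 2).
have dS y : S^`().[y] = 2 * N^-1 * (d%:R - 1) * y * p^`().[y] ^+ 2.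
  have := congr1 (horner^~ y) hp.
  rewrite !derivnS derivn0 -!polyC_natr.
  rewrite !(hornerD, hornerN, hornerM, hornerXn, hornerX, hornerC) => H.
  rewrite /S !expr2 !(derivD, derivN, derivM, derivC, derivX).
  rewrite !(hornerD, hornerN, hornerM, hornerXn, hornerX, hornerC).
  have -> : p.[y] = N^-1 * (d%:R * y * p^`().[y] - (1 - y ^+ 2) * (p^`())^`().[y]).
    apply: (mulfI (lt0r_neq0 N0)); rewrite mulrA divff ?lt0r_neq0 // mul1r.
    by apply/eqP; rewrite -subr_eq0 -H expr2; apply/eqP; ring.
  by rewrite expr2; ring.
have SE y : S.[y] = p.[y] ^+ 2 + N^-1 * ((1 - y ^+ 2) * p^`().[y] ^+ 2).
  by rewrite /S !(hornerD, hornerN, hornerM, hornerXn, horner_exp, hornerX, hornerC).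
have : S.[x] <= S.[1].
  apply: (@ger0_derive1_le_cc R (horner S) 0 1); rewrite ?in_itv /= ?lexx ?ler01 ?x0 //.
  - move=> y; rewrite in_itv /= => /andP[y0 _].
    rewrite -derivE dS; apply: mulr_ge0; last exact: sqr_ge0.
    have i0 : 0 <= N^-1 by rewrite invr_ge0 ltW.
    have d1 : 0 <= d%:R - 1 :> R by rewrite subr_ge0 ler1n.
    by rewrite !mulr_ge0 // ltW.
  - by apply: continuous_subspaceT; exact: continuous_horner.
rewrite !SE expr1n subrr mul0r mulr0 addr0; apply: le_trans.
rewrite lerDl; apply: mulr_ge0; first by rewrite invr_ge0 ltW.
apply: mulr_ge0; [nra|exact: sqr_ge0].
Qed.

(** The Chebyshev pair (T_k, U_(k-1)); the recursion is the addition formula for cos ((k + 1) theta)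
    and sin ((k + 1) theta) / sin theta. *)
Fixpoint cheb (k : nat) : {poly R} * {poly R} :=
  if k is k'.+1 then
    ('X * (cheb k').1 - (1 - 'X^2) * (cheb k').2, (cheb k').1 + 'X * (cheb k').2)
  else (1, 0).

Lemma cheb_deriv k : (cheb k).1^`() = k%:R * (cheb k).2 /\
  (1 - 'X^2) * (cheb k).2^`() = 'X * (cheb k).2 - k%:R * (cheb k).1.
Proof.
elim: k => [|k [IH1 IH2]] /=.
  by split; rewrite ?derivC ?deriv0; ring.
have e k' : k'.+1%:R = k'%:R + 1 :> {poly R} by rewrite -natr1.
split.
  rewrite !(derivD, derivN, derivM, derivX, derivC, derivXn) IH1 e.
  transitivity ((cheb k).1 + 'X * (k%:R * (cheb k).2) + 2 * 'X * (cheb k).2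
     - (1 - 'X^2) * (cheb k).2^`()); first by ring.
  by rewrite IH2; ring.
rewrite !(derivD, derivM, derivX) IH1 e.
transitivity ((1 - 'X^2) * (k%:R * (cheb k).2 + (cheb k).2)
  + 'X * ((1 - 'X^2) * (cheb k).2^`())); first by ring.
by rewrite IH2; ring.
Qed.

Lemma cheb_equation k : geg_equation 1 (k%:R ^+ 2) (cheb k).1.
Proof.
have [H1 H2] := cheb_deriv k.
have H3 : (k%:R * (cheb k).2)^`() = k%:R * (cheb k).2^`().
  by rewrite -polyC_natr deriv_mulC.
rewrite /geg_equation !derivnS derivn0 H1 H3 rmorphXn /= polyC_natr.
transitivity (k%:R * ((1 - 'X^2) * (cheb k).2^`() - 'X * (cheb k).2 + k%:R * (cheb k).1)).
  by ring.
by rewrite H2; ring.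
Qed.

Lemma cheb_cos k x : (cheb k).1.[cos x] = cos (k%:R * x) /\
  sin x * (cheb k).2.[cos x] = sin (k%:R * x).
Proof.
elim: k => [|k [IH1 IH2]] /=; first by split; rewrite !hornerE ?mul0r ?cos0 ?sin0 ?mulr0.
have e : k.+1%:R * x = x + k%:R * x by rewrite -natr1 mulrDl mul1r addrC.
rewrite e cosD sinD -IH1 -IH2.
rewrite !(hornerD, hornerN, hornerM, hornerXn, hornerX, hornerC).
have s2 : 1 - cos x * cos x = sin x * sin x.
  by rewrite -!expr2 -(cos2Dsin2 x) addrC addKr.
by rewrite s2; split; ring.
Qed.

Definition geg_poly (lam : R) (k : nat) : {poly R} :=
  \sum_(j < k./2.+1)
     ((-1) ^+ j * (\prod_(i < k - j) (lam + i%:R))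
     / ((j`!)%:R * ((k - 2 * j)`!)%:R))%:P * (2%:P * 'X) ^+ (k - 2 * j).

Lemma geg_polyE lam k x : (geg_poly lam k).[x] = gegenbauer lam k x.
Proof.
rewrite /geg_poly horner_sum; apply: eq_bigr => j _.
by rewrite !(hornerM, horner_exp, hornerX, hornerC).
Qed.

(** The operator sends a monomial of degree m into degrees m and m - 2. The ratio of consecutive
    coefficients makes the lower part of each term cancel the upper part of the next. *)
Lemma geg_poly_equation d k : geg_equation d (k%:R * (k%:R + d%:R - 1))
  (geg_poly ((d%:R - 1) / 2) k).
Proof.
set lam := (d%:R - 1) / 2.
have lamE : d%:R = 2 * lam + 1 by rewrite /lam mulrC divfK ?subrK // pnatr_eq0.
pose b (j : nat) : R := (-1) ^+ j * (\prod_(i < k - j) (lam + i%:R))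
     / ((j`!)%:R * ((k - 2 * j)`!)%:R).
pose T j : {poly R} := (b j)%:P * (2%:P * 'X) ^+ (k - 2 * j).
pose U j : {poly R} := (4 * j%:R * (lam + k%:R - j%:R) * b j)%:P
   * (2%:P * 'X) ^+ (k - 2 * j).
have step j : (2 * j <= k)%N ->
    (1 - 'X^2) * (T j)^`(2) - d%:R * 'X * (T j)^`() + (k%:R * (k%:R + d%:R - 1))%:P * T j
    = U j - (if (2 * j.+1 <= k)%N then U j.+1 else 0).
  move=> jk; have [m km] : exists m, k = (2 * j + m)%N by exists (k - 2 * j)%N; lia.
  have mE : (k - 2 * j = m)%N by lia.
  have dY n : ((2%:P * 'X : {poly R}) ^+ n)^`() = (2 * n%:R)%:P * (2%:P * 'X) ^+ n.-1.
    by rewrite deriv_exp deriv_mulC derivX polyCM polyC_natr; ring.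
  have kR : k%:R = 2 * j%:R + m%:R :> R by rewrite km natrD natrM.
  have -> : (d%:R : {poly R}) = (2 * lam + 1)%:P by rewrite -lamE polyC_natr.
  have dT2 : (T j)^`(2) = (b j * (2 * m%:R) * (2 * m.-1%:R))%:P * (2%:P * 'X) ^+ m.-2.
    by rewrite !derivnS derivn0 /T mE deriv_mulC dY !deriv_mulC dY !polyCM; ring.
  have dT : (T j)^`() = (b j * (2 * m%:R))%:P * (2%:P * 'X) ^+ m.-1.
    by rewrite /T mE deriv_mulC dY !polyCM; ring.
  rewrite dT2 dT {dT2 dT dY jk}; set K := k%:R * _.
  have KE : K = (2 * j%:R + m%:R) * (2 * j%:R + m%:R + 2 * lam).
    by rewrite /K lamE kR; ring.
  set Y := 2%:P * 'X; have YE : Y = 2 * 'X by rewrite /Y polyC_natr.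
  transitivity ((b j * (2 * m%:R) * (2 * m.-1%:R))%:P * Y ^+ m.-2
    + ((K - (2 * lam + 1) * m%:R - m%:R * m.-1%:R) * b j)%:P * Y ^+ m).
    rewrite /T mE -/Y; case: m {km mE kR} K KE => [|[|m]] K _ /=.
    - by rewrite !(polyCM, polyCD, polyCN) !polyC0 !expr0; ring.
    - rewrite !(polyCM, polyCD, polyCN) !polyC0 !expr0 expr1 YE.
      by rewrite !polyC1 !polyC_natr; ring.
    - rewrite [_ ^+ m.+2]exprS [_ ^+ m.+1]exprS; set Q := _ ^+ m.
      by rewrite YE !(polyCM, polyCD, polyCN) !polyC1 !polyC_natr; ring.
  have -> : (K - (2 * lam + 1) * m%:R - m%:R * m.-1%:R) * b j
      = 4 * j%:R * (lam + k%:R - j%:R) * b j.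
    by congr (_ * _); rewrite KE kR; case: m {km mE kR KE} => [|m] /=; rewrite -?natr1; ring.
  rewrite /U mE -/Y addrC; congr (_ + _).
  case: m km mE {kR KE} => [|[|m]] km mE /=.
  - by rewrite ifF ?mulr0 ?mul0r ?polyC0 ?mul0r ?oppr0 //; apply/negbTE; lia.
  - by rewrite ifF ?mulr0 ?polyC0 ?mul0r ?oppr0 //; apply/negbTE; lia.
  rewrite ifT; last by lia.
  rewrite (_ : (k - 2 * j.+1 = m)%N); last by lia.
  rewrite -mulNr -polyCN; congr (_%:P * _).
  rewrite /b mE (_ : (k - 2 * j.+1 = m)%N); last by lia.
  rewrite (_ : (k - j = (k - j.+1).+1)%N); last by lia.
  rewrite big_ord_recr /= exprS !factS !natrM natrB; last by lia.
  have f1 : (j`!)%:R != 0 :> R by rewrite pnatr_eq0 -lt0n fact_gt0.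
  have f2 : (m`!)%:R != 0 :> R by rewrite pnatr_eq0 -lt0n fact_gt0.
  field; rewrite f1 f2 nat1r -natrD !pnatr_eq0 addSn /=.
  by rewrite nat1r pnatr_eq0.
rewrite /geg_equation.
have -> : geg_poly lam k = \sum_(j < k./2.+1) T j by [].
rewrite [(\sum_(j < _) _)^`(2)]raddf_sum [(\sum_(j < _) _)^`()]raddf_sum /=.
rewrite !mulr_sumr -sumrB -big_split /=.
(* Past the last term [k - 2 * j] is truncated to 0, so U is cut off there. The sum collapses to V
   0, which is 0 because U carries the factor j. *)
pose V j := if (2 * j <= k)%N then U j else 0.
rewrite (eq_bigr (fun j : 'I__ => V j - V j.+1)); last first.
  by move=> j _; rewrite /V ifT ?step //; have := ltn_ord j; lia.
rewrite -(big_mkord xpredT (fun j => V j - V j.+1)).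
rewrite (@telescope_sumr_eq _ _ _ (fun j => - V j)) //; last first.
  by move=> j _; rewrite opprK addrC.
rewrite /V ifF; last by apply/negbTE; lia.
by rewrite muln0 /= /U mulr0 mul0r mul0r mul0r subrr.
Qed.

End gegenbauer_equation.

(** * Integrals of homogeneous functions over the ball *)

Section radial.
Variable R : realType.
Notation mu := (@lebesgue_measure R).
Notation vec := (g_sigma_algebraType (@coord_sets R)).
Notation origin := (fun=> 0 : R).
Implicit Types (h k : vec -> \bar R) (v : vec) (n m : nat).

Lemma nnmeas_if (b : vec -> bool) h : measurable_fun setT b -> nnmeas h ->
  nnmeas (fun v => if b v then h v else 0%E).
Proof.
move=> mb [mh h0]; split; first exact: measurable_fun_ifT.
by move=> v; case: ifP.
Qed.

Lemma nnmeas_EFin (f : vec -> R) : measurable_fun setT f -> (forall v, 0 <= f v) ->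
  nnmeas (fun v => (f v)%:E).
Proof.
by move=> mf f0; split => [|v]; [exact/measurable_EFinP|rewrite lee_fin].
Qed.

Lemma nnmeas_cst (c : \bar R) : (0 <= c)%E -> nnmeas (fun=> c).
Proof. by move=> c0; split. Qed.

Lemma multi_int_le s h k : nnmeas h -> nnmeas k -> (forall v, h v <= k v)%E ->
  forall v, (multi_int s h v <= multi_int s k v)%E.
Proof.
elim: s h k => //= i s IH h k hh hk hkle v.
have [[mh h0] [mk k0]] := (hh, hk).
apply: IH; try exact: nnmeas_coord_int.
by move=> w; apply: ge0_le_integral => //; exact: measurable_upd_arg.
Qed.

Definition sqnorm n v := dotv n v v.

Lemma sqnorm_gt0 n v i : (i < n)%N -> v i != 0 -> 0 < sqnorm n v.
Proof.
move=> li vi; rewrite /sqnorm /dotv (bigD1 (Ordinal li)) //=.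
rewrite ltr_pwDl //; first by rewrite -expr2 exprn_even_gt0.
by apply: sumr_ge0 => j _; rewrite -expr2 sqr_ge0.
Qed.

Lemma measurable_sqnorm n : measurable_fun setT (sqnorm n).
Proof. exact: measurable_dotvv. Qed.

Lemma dotv_upd n a x v : dotv n a (upd n x v) = dotv n a v.
Proof.
by apply: eq_bigr => j _; rewrite upd_neq // neq_ltn ltn_ord.
Qed.

Lemma sqnorm_upd n x v : sqnorm n (upd n x v) = sqnorm n v.
Proof.
by apply: eq_bigr => j _; rewrite upd_neq // neq_ltn ltn_ord.
Qed.

Lemma dotv_dilate n a c v : dotv n a (dilate (iota 0 n) c v) = c * dotv n a v.
Proof.
rewrite -dotvZ; apply: eq_bigr => j _; rewrite /dilate mem_iota add0n ltn_ord.
by [].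
Qed.

Lemma sqnorm_dilate n c v : sqnorm n (dilate (iota 0 n) c v) = c ^+ 2 * sqnorm n v.
Proof.
rewrite /sqnorm dotv_dilate dotvC dotv_dilate; ring.
Qed.

(** The origin is left out as in [cone_integrand], so that v / |v| makes sense throughout. *)
Definition in_ball n v := (0 < sqnorm n v) && (sqnorm n v <= 1).

Lemma measurable_in_ball n : measurable_fun setT (in_ball n).
Proof.
have mq := measurable_sqnorm n.
by apply: measurable_and; [apply: measurable_fun_ltr|apply: measurable_fun_ler].
Qed.

Definition ball_int n h :=
  multi_int (iota 0 n) (fun v => if in_ball n v then h v else 0%E) origin.

Lemma nnmeas_in_ball n h : nnmeas h ->
  nnmeas (fun v => if in_ball n v then h v else 0%E).
Proof. by move=> hh; apply: nnmeas_if => //; exact: measurable_in_ball. Qed.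

Lemma ball_int_ge0 n h : nnmeas h -> (0 <= ball_int n h)%E.
Proof. by move=> /(@nnmeas_in_ball n)/(nnmeas_multi_int (iota 0 n)) [_]; exact. Qed.

(** Homogeneity of degree b in the first n coordinates; the second clause keeps coordinate n free
    for the level variable of [ge0_layer_cake]. *)
Definition homogeneous n (b : R) h :=
  (forall c v, 0 < c -> h (dilate (iota 0 n) c v) = ((c `^ b)%:E * h v)%E) /\
  (forall x v, h (upd n x v) = h v).

(** Scaling the ball of radius sqrt r to the unit ball: r ^ (n / 2) is the Jacobian and r ^ (b / 2)
    comes from homogeneity. *)
Lemma multi_int_ball n (r b : R) h : 0 < r -> nnmeas h -> homogeneous n b h ->
  multi_int (iota 0 n) (fun v => if (0 < sqnorm n v) && (sqnorm n v <= r) then h v else 0%E)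
    origin = ((r `^ ((n%:R + b) / 2))%:E * ball_int n h)%E.
Proof.
move=> r0 hh [hb _]; set k := fun v => _.
have hk : nnmeas k.
  apply: nnmeas_if => //; have mq := measurable_sqnorm n.
  by apply: measurable_and; [apply: measurable_fun_ltr|apply: measurable_fun_ler].
have u0 : 0 < Num.sqrt r by rewrite sqrtr_gt0.
rewrite -(multi_int_dilate (iota_uniq 0 n) u0 hk) size_iota.
have -> : k \o dilate (iota 0 n) (Num.sqrt r) =
    (fun v => (Num.sqrt r `^ b)%:E * (if in_ball n v then h v else 0))%E.
  apply/funext => v; rewrite /k /= sqnorm_dilate (sqr_sqrtr (ltW r0)) /in_ball.
  by rewrite pmulr_rgt0 // ger_pMr // hb //; case: ifP; rewrite ?mule0.
rewrite (@multi_intZ R _ (fun=> (Num.sqrt r `^ b)%:E)) //; last first.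
  exact: nnmeas_in_ball.
rewrite muleA -EFinM; congr (_%:E * _)%E.
rewrite -powR_mulrn ?(ltW u0) // -powR12_sqrt ?(ltW r0) // -!powRrM -powRD; last first.
  by rewrite (gt_eqF r0) implybT.
by congr (_ `^ _); lra.
Qed.

(* Coordinate n, on which h does not depend, serves as the level r. *)
Lemma ge0_layer_cake n (b : R) (w : R -> R) h : (0 < n)%N ->
  measurable_fun setT w -> (forall r, 0 <= w r) -> nnmeas h -> homogeneous n b h ->
  multi_int (iota 0 n) (fun v => if (0 < sqnorm n v)%R then
      (\int[mu]_(r in `[sqnorm n v, +oo[) (w r)%:E) * h v else 0)%E origin
  = ((\int[mu]_(r in `]0%R, +oo[) (w r * r `^ ((n%:R + b) / 2))%:E) * ball_int n h)%E.
Proof.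
move=> n0 mw w0 hh hb.
have mq := measurable_sqnorm n.
pose H v := (if ((0 < sqnorm n v) && (sqnorm n v <= v n))%R
  then (w (v n))%:E * h v else 0)%E.
have mB : measurable_fun setT (fun v : vec => (0 < sqnorm n v) && (sqnorm n v <= v n)).
  apply: measurable_and; [exact: measurable_fun_ltr|apply: measurable_fun_ler => //].
  exact: measurable_coord.
have hw : nnmeas (fun v : vec => (w (v n))%:E).
  by apply: nnmeas_EFin => //; apply: (measurableT_comp mw); exact: measurable_coord.
have hH : nnmeas H by apply: nnmeas_if => //; exact: nnmeasM.
transitivity (multi_int (iota 0 n) (coord_int n H) origin).
  congr (multi_int _ _ _); apply/funext => v; rewrite /coord_int /H.
  under [RHS]eq_integral do rewrite upd_same sqnorm_upd hb.2.
  case: ifPn => q0 /=; last by rewrite integral0.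
  rewrite integral_mkcond -ge0_integralZr //.
  - apply: eq_integral => r _; rewrite /patch mem_setE /= in_itv /= andbT.
    by case: ifP => _; rewrite ?mul0e.
  - rewrite (_ : patch _ _ _ = (EFin \o (fun r => if sqnorm n v <= r then w r else 0))).
      by apply/measurable_EFinP; apply: measurable_fun_ifT => //; exact: measurable_fun_ler.
    apply/funext => r; rewrite /patch mem_setE /= in_itv /= andbT.
    by case: ifP.
  - by move=> r _; rewrite /patch; case: ifP => _; rewrite ?lee_fin.
  - exact: hh.2.
(* With the level r outermost, the inner integral runs over the punctured ball of radius sqrt r. *)
rewrite multi_int_coord_int // /coord_int.
rewrite -ge0_integralZr //; last 3 first.
- apply/measurable_EFinP; apply: measurable_funM.
    exact: measurable_funTS.
  by apply: measurable_funTS; exact: measurable_powR.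
- by move=> r _; rewrite lee_fin mulr_ge0 // powR_ge0.
- exact: ball_int_ge0.
rewrite [RHS]integral_mkcond; apply: eq_integral => r _.
rewrite /patch mem_setE /= in_itv /= andbT.
have ni : n \notin iota 0 n by rewrite mem_iota add0n ltnn.
rewrite -[LHS](congr1 (fun f => f origin) (@multi_int_upd R _ _ r H ni)) /H.
under eq_fun do rewrite upd_same sqnorm_upd hb.2.
case: ifPn => r0; last first.
  have -> : (fun v => if ((0 < sqnorm n v) && (sqnorm n v <= r))%R
      then (w r)%:E * h v else 0)%E = (fun v => 0 * 0)%E.
    apply/funext => v; rewrite mul0e ifF //; apply/negbTE.
    by apply: contra r0 => /andP[]; exact: lt_le_trans.
  rewrite (@multi_intZ R _ (fun=> 0%E)) ?mul0e //.
have -> : (fun v => if ((0 < sqnorm n v) && (sqnorm n v <= r))%R then (w r)%:E * h v else 0)%E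
  = (fun v => (w r)%:E * (if ((0 < sqnorm n v) && (sqnorm n v <= r))%R then h v else 0))%E.
  by apply/funext => v; case: ifP; rewrite ?mule0.
rewrite (@multi_intZ R _ (fun=> (w r)%:E)) //; last 2 first.
- by apply: nnmeas_cst; rewrite lee_fin.
- apply: nnmeas_if => //.
  by apply: measurable_and; [apply: measurable_fun_ltr|apply: measurable_fun_ler].
by rewrite (multi_int_ball r0 hh hb) EFinM muleA.
Qed.

End radial.

(** * The Gamma integral and its functional equation *)

Section gamma_integral.
Variable R : realType.
Notation mu := (@lebesgue_measure R).

Lemma measurable_mul_powR (a b : R) : measurable_fun setT (fun t : R => a * t `^ b).
Proof. exact: measurable_funM (measurable_cst a) (measurable_powR b). Qed.

Lemma measurable_expRN : measurable_fun setT (fun t : R => expR (- t)).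
Proof. exact: (measurableT_comp (@measurable_expR R) (@oppr_measurable R setT)). Qed.

Lemma ge0_integralZl_real (D : set R) (c : R) (f : R -> R) : measurable D ->
  measurable_fun D f -> (forall x, 0 <= f x) -> 0 <= c ->
  (\int[mu]_(x in D) (c * f x)%:E = c%:E * \int[mu]_(x in D) (f x)%:E)%E.
Proof.
move=> mD mf f0 c0; under eq_integral do rewrite EFinM.
rewrite ge0_integralZl // => [|x _]; [exact/measurable_EFinP|by rewrite lee_fin].
Qed.

Lemma is_derive_powR (a x : R) : 0 < x ->
  is_derive x 1 (fun y => y `^ a) (a * x `^ (a - 1)).
Proof.
move=> x0; apply: DeriveDef; first by apply: derivable_powR; rewrite in_itv /= x0.
by rewrite -derive1E powR_derive1 // in_itv /= x0.
Qed.

Lemma continuous_powR (a x : R) : 0 < x -> {for x, continuous (fun y : R => y `^ a)}.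
Proof.
by move=> /(is_derive_powR a) [/derivable1_diffP + _]; exact: differentiable_continuous.
Qed.

Lemma integral_powR_itv (a x y : R) : 0 < x -> x < y ->
  (\int[mu]_(t in `[x, y]) (a * t `^ (a - 1))%:E = (y `^ a - x `^ a)%:E)%E.
Proof.
move=> x0 xy.
have t0 t : x <= t <= y -> 0 < t by move=> /andP[/(lt_le_trans x0)].
apply: (integral_is_derive (F := fun y => y `^ a)) => // t /t0.
  exact: is_derive_powR.
by move=> tp; apply: cvgM; [exact: cvg_cst|exact: continuous_powR].
Qed.

Lemma integral_powR (a u : R) : 0 < a -> 0 < u ->
  (\int[mu]_(t in `]0%R, u]) (a * t `^ (a - 1))%:E = (u `^ a)%:E)%E.
Proof.
move=> a0 u0.
(* The integrand may be unbounded at 0, so ]0, u] is exhausted by compact intervals; k + 2 keeps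
   their left end points strictly below u. *)
pose A (k : nat) : set R := `[u / k.+2%:R, u]%classic.
have uk k : 0 < u / k.+2%:R by rewrite divr_gt0.
have AE : \bigcup_k A k = `]0, u]%classic.
  apply/seteqP; split => x.
    move=> [k _]; rewrite /A /= !in_itv /= => /andP[ux ->].
    by rewrite (lt_le_trans (uk k)).
  rewrite /= in_itv /= => /andP[x0 xu].
  have [k kx] : exists k : nat, u / x < k.+2%:R.
    exists (Num.truncn (u / x)); apply: lt_le_trans (truncnS_gt _) _.
    by rewrite ler_nat.
  exists k => //; rewrite /A /= in_itv /= xu andbT.
  by rewrite ler_pdivrMr // mulrC -ler_pdivrMr // ltW.
have ndA : nondecreasing_seq A.
  apply/nondecreasing_seqP => k; apply/subsetPset => x.
  rewrite /A /= !in_itv /= => /andP[ux ->]; rewrite andbT.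
  by apply: le_trans ux; rewrite ler_pM2l // lef_pV2 ?posrE // ler_nat.
have mf (D : set R) : measurable_fun D (fun t : R => (a * t `^ (a - 1))%:E).
  apply/measurable_EFinP; apply: measurable_funTS; exact: measurable_mul_powR.
have f0 (D : set R) x : D x -> (0 <= (a * x `^ (a - 1))%:E)%E.
  by move=> _; rewrite lee_fin mulr_ge0 ?powR_ge0 // ltW.
have := @ge0_nondecreasing_set_cvg_integral _ (measurableTypeR R) R A
  (fun t : R => (a * t `^ (a - 1))%:E) mu ndA (fun i => measurable_itv _)
  (fun i => mf _) (fun i => f0 _).
rewrite AE => H; apply: (cvg_unique _ H) => //.
have -> : (fun i => \int[mu]_(x in A i) (a * x `^ (a - 1))%:E)%E =
    (fun i => (u `^ a - (u / i.+2%:R) `^ a)%:E).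
  apply/funext => i; apply: integral_powR_itv => //.
  by rewrite ltr_pdivrMr // ltr_pMr // ltr1n.
apply: cvg_EFin; first by near=> i.
rewrite -[X in _ --> X]subr0; apply: cvgB; first exact: cvg_cst.
have /cvg_at_rightP := @powR_cvg0 R a a0; apply; split => //.
rewrite -(mulr0 u); apply: cvgM; first exact: cvg_cst.
by have := @cvg_harmonic R; rewrite -cvg_shiftS.
Unshelve. all: by end_near. Qed.

(** This is Gamma(a + 1): the exponent is the one delivered by the layer cake. *)
Definition gamma_integral (a : R) : \bar R :=
  (\int[mu]_(r in `]0%R, +oo[) (expR (- r) * r `^ a)%:E)%E.

Lemma integral_expRN (q : R) :
  (\int[mu]_(r in `[q, +oo[) (expR (- r))%:E = (expR (- q))%:E)%E.
Proof.
have dE (x : R) : is_derive x 1 (fun r : R => - expR (- r)) (expR (- x)).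
  by apply: is_derive_eq; rewrite /GRing.scale /=; ring.
have cE (x : R) : {for x, continuous (fun r : R => expR (- r))}.
  apply: continuous_comp; first exact: opp_continuous.
  exact: continuous_expR.
rewrite (@ge0_continuous_FTC2y _ (fun r => expR (- r)) (fun r => - expR (- r)) q 0).
- by rewrite EFinN sub0e oppeK.
- by move=> x _; exact: expR_ge0.
- by apply: continuous_subspaceT; exact: cE.
- rewrite -[X in _ --> X]oppr0; apply: cvgN; exact: cvgr_expR.
- by move=> x _; have [] := dE x.
- apply: cvg_at_right_filter; apply: cvgN; exact: cE.
- by move=> x _; rewrite derive1E; apply: derive_val.
Qed.

(** Tonelli for exp (- x) a y ^ (a - 1) on 0 < y <= x: integrating y first gives exp (- x) x ^ a,
    integrating x first gives a y ^ (a - 1) exp (- y). There are no boundary terms. *)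
Lemma gamma_integralS (a : R) : 0 < a ->
  (gamma_integral a = a%:E * gamma_integral (a - 1))%E.
Proof.
move=> a0.
pose f (z : measurableTypeR R * measurableTypeR R) : \bar R :=
  (if (0 < z.2) && (z.2 <= z.1) then expR (- z.1) * (a * z.2 `^ (a - 1)) else 0)%:E.
have m1 : measurable_fun setT (fun z : measurableTypeR R * measurableTypeR R => z.1 : R).
  exact: measurable_fst.
have m2 : measurable_fun setT (fun z : measurableTypeR R * measurableTypeR R => z.2 : R).
  exact: measurable_snd.
have mf : measurable_fun setT f.
  apply/measurable_EFinP; apply: measurable_fun_ifT => //.
    by apply: measurable_and; [apply: measurable_fun_ltr|apply: measurable_fun_ler].
  apply: measurable_funM; first exact: (measurableT_comp measurable_expRN m1).
  exact: (measurableT_comp (measurable_mul_powR a (a - 1)) m2).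
have f0 z : (0 <= f z)%E.
  rewrite /f lee_fin; case: ifP => // _.
  by rewrite !mulr_ge0 ?expR_ge0 ?powR_ge0 // ltW.
have := @fubini_tonelli _ _ _ _ R mu mu f mf f0; rewrite /f /=.
have -> : (\int[mu]_x \int[mu]_y (if ((0 < y) && (y <= x))%R
   then (expR (- x) * (a * y `^ (a - 1)))%R else 0%R)%:E = gamma_integral a)%E.
  rewrite /gamma_integral [RHS]integral_mkcond; apply: eq_integral => x _.
  rewrite /patch mem_setE in_itv andbT; case: ifPn => x0; last first.
    rewrite (eq_integral (cst 0%E)) ?integral0 // => y _ /=; rewrite ifF //.
    by apply/negbTE; apply: contra x0 => /andP[]; exact: lt_le_trans.
  have p0 y : 0 <= a * y `^ (a - 1) by rewrite mulr_ge0 ?powR_ge0 // ltW.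
  rewrite EFinM -(integral_powR a0 x0) -ge0_integralZl_real ?expR_ge0 //; last first.
    exact: measurable_funTS (measurable_mul_powR _ _).
  rewrite [RHS]integral_mkcond; apply: eq_integral => y _.
  by rewrite /patch mem_setE /= in_itv /=; case: ifP.
move=> ->.
rewrite /gamma_integral -ge0_integralZl_real; first last.
- exact: ltW.
- by move=> y; rewrite mulr_ge0 ?expR_ge0 ?powR_ge0.
- apply: measurable_funTS; apply: measurable_funM; first exact: measurable_expRN.
  exact: (measurable_powR (a - 1)).
- exact: measurable_itv.
rewrite [RHS]integral_mkcond; apply: eq_integral => y _.
rewrite /patch mem_setE /= in_itv /= andbT; case: ifPn => y0; last first.
  by rewrite (eq_integral (cst 0%E)) ?integral0 // => x _ /=.
rewrite (_ : a * (expR (- y) * _) = (a * y `^ (a - 1)) * expR (- y)); last by ring.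
rewrite EFinM -(integral_expRN y) -ge0_integralZl_real; first last.
- by rewrite mulr_ge0 ?powR_ge0 // ltW.
- by move=> x; rewrite expR_ge0.
- exact: measurable_funTS measurable_expRN.
- exact: measurable_itv.
rewrite [RHS]integral_mkcond; apply: eq_integral => x _.
by rewrite /patch mem_setE /= in_itv /= andbT; case: ifP; rewrite // mulrC.
Qed.

End gamma_integral.

(** * Gaussian and radial weights on homogeneous functions *)

Section moments.
Variable R : realType.
Notation mu := (@lebesgue_measure R).
Notation vec := (g_sigma_algebraType (@coord_sets R)).
Notation origin := (fun=> 0 : R).
Implicit Types (h k : vec -> \bar R) (v : vec) (n m : nat) (a b c : R).

Lemma eq_ball_int n h k : (forall v, in_ball n v -> h v = k v) ->
  ball_int n h = ball_int n k.
Proof.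
move=> hk; congr (multi_int _ _ _); apply/funext => v.
by case: ifP => // /hk.
Qed.

Lemma ball_intD n h k : nnmeas h -> nnmeas k ->
  ball_int n (fun v => h v + k v)%E = (ball_int n h + ball_int n k)%E.
Proof.
move=> hh hk; rewrite /ball_int.
have -> : (fun v => if in_ball n v then h v + k v else 0)%E
  = (fun v => (if in_ball n v then h v else 0) + (if in_ball n v then k v else 0))%E.
  by apply/funext => v; case: ifP; rewrite ?adde0.
by rewrite multi_intD //; exact: nnmeas_in_ball.
Qed.

Lemma ball_intZ n c h : 0 <= c -> nnmeas h ->
  ball_int n (fun v => c%:E * h v)%E = (c%:E * ball_int n h)%E.
Proof.
move=> c0 hh; rewrite /ball_int.
have -> : (fun v => if in_ball n v then c%:E * h v else 0)%E
  = (fun v => c%:E * (if in_ball n v then h v else 0))%E.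
  by apply/funext => v; case: ifP; rewrite ?mule0.
rewrite (@multi_intZ R _ (fun=> c%:E)) //; exact: nnmeas_in_ball.
Qed.

Lemma ball_int_le n h k : nnmeas h -> nnmeas k ->
  (forall v, in_ball n v -> h v <= k v)%E -> (ball_int n h <= ball_int n k)%E.
Proof.
move=> hh hk hkle; apply: multi_int_le; try exact: nnmeas_in_ball.
by move=> v; case: ifP => // /hkle.
Qed.

(** The layer cake for w(r) = exp (- r), whose integral from q to infinity is exp (- q). The origin,
    which the layer cake omits, lies in a null hyperplane. *)
Lemma gaussian_homogeneous n b h : (0 < n)%N -> nnmeas h -> homogeneous n b h ->
  multi_int (iota 0 n) (fun v => (expR (- sqnorm n v))%:E * h v)%E origin
  = (gamma_integral ((n%:R + b) / 2) * ball_int n h)%E.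
Proof.
move=> n0 hh hb.
have me : measurable_fun setT (fun v => expR (- sqnorm n v)).
  exact: (measurableT_comp (@measurable_expRN R) (@measurable_sqnorm R n)).
have hE : nnmeas (fun v => (expR (- sqnorm n v))%:E * h v)%E.
  by apply: nnmeasM => //; apply: nnmeas_EFin => // v; exact: expR_ge0.
have := ge0_layer_cake n0 (@measurable_expRN R) (fun r => expR_ge0 (- r)) hh hb.
under eq_fun do rewrite integral_expRN.
rewrite -/(gamma_integral _) => <-.
congr (_ origin); apply: (multi_int_neq0 (i := 0%N)) => //.
- by rewrite mem_iota.
- by apply: nnmeas_if => //; apply: measurable_fun_ltr => //; exact: measurable_sqnorm.
- by move=> v v0; rewrite (sqnorm_gt0 n0 v0).
Qed.

(** The tail integral of w(r) = (a / 2) r ^ (a / 2 - 1), cut at r = 1, is 1 - |v| ^ a on the ball.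
    The layer cake therefore evaluates the integral of (1 - |v| ^ a) h as a / (n + a + b) times that
    of h; finiteness allows the subtraction. *)
Lemma ball_int_radial n a b h : (0 < n)%N -> 0 < a -> 0 <= b ->
  nnmeas h -> homogeneous n b h -> (ball_int n h < +oo)%E ->
  ball_int n (fun v => (sqnorm n v `^ (a / 2))%:E * h v)%E
  = (((n%:R + b) / (n%:R + a + b))%:E * ball_int n h)%E.
Proof.
move=> n0 a0 b0 hh hb hfin.
have nR : 0 < n%:R :> R by rewrite ltr0n.
pose w (r : R) := if r <= 1 then a / 2 * r `^ (a / 2 - 1) else 0.
have a2 : 0 < a / 2 by rewrite divr_gt0.
have mw : measurable_fun setT w.
  apply: measurable_fun_ifT => //; first exact: measurable_fun_ler.
  exact: measurable_mul_powR.
have w0 r : 0 <= w r.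
  by rewrite /w; case: ifP => // _; rewrite mulr_ge0 ?powR_ge0 // ltW.
have mq := @measurable_sqnorm R n.
have := ge0_layer_cake n0 mw w0 hh hb.
have -> : (fun v => if (0 < sqnorm n v)%R then
      (\int[mu]_(r in `[sqnorm n v, +oo[) (w r)%:E) * h v else 0)%E =
   (fun v => if in_ball n v then (1 - sqnorm n v `^ (a / 2))%:E * h v else 0)%E.
  apply/funext => v; rewrite /in_ball; case: ifPn => //= q0.
  have -> : (\int[mu]_(r in `[sqnorm n v, +oo[) (w r)%:E
     = \int[mu]_(r in `[sqnorm n v, 1%R]) (a / 2 * r `^ (a / 2 - 1))%:E)%E.
    rewrite [LHS]integral_mkcond [RHS]integral_mkcond; apply: eq_integral => r _.
    rewrite /patch !mem_setE /= !in_itv /= andbT /w.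
    by case: (sqnorm n v <= r) => //=; case: ifP.
  case: ltgtP => q1.
  - by rewrite integral_powR_itv // powR1.
  - by rewrite set_itv_ge ?integral_set0 ?mul0e // bnd_simp -ltNge.
  - by rewrite q1 set_itv1 integral_set1 powR1 subrr.
have -> : (\int[mu]_(r in `]0%R, +oo[) (w r * r `^ ((n%:R + b) / 2))%:E
   = (a / (n%:R + a + b))%:E)%E.
  pose e := (n%:R + a + b) / 2.
  have e0 : 0 < e by rewrite /e; lra.
  transitivity (\int[mu]_(r in `]0%R, 1%R]) ((a / 2 / e) * (e * r `^ (e - 1)))%:E)%E.
    rewrite [LHS]integral_mkcond [RHS]integral_mkcond; apply: eq_integral => r _.
    rewrite /patch !mem_setE /= !in_itv /= andbT /w.
    case: ifPn => //= r0; case: ifPn => r1; last by rewrite mul0r.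
    rewrite mulrA divfK ?gt_eqF // -mulrA -powRD; last by rewrite (gt_eqF r0) implybT.
    by congr (_ * _ `^ _)%:E; rewrite /e; lra.
  rewrite ge0_integralZl_real; first last.
  - by rewrite divr_ge0 ?ltW.
  - by move=> r; rewrite mulr_ge0 ?powR_ge0 // ltW.
  - exact: measurable_funTS (measurable_mul_powR _ _).
  - exact: measurable_itv.
  rewrite integral_powR // powR1 mule1; congr _%:E; rewrite /e.
  by field; rewrite gt_eqF //; lra.
rewrite -/(ball_int n (fun v => (1 - sqnorm n v `^ (a / 2))%:E * h v)%E).
set x := ball_int n _ => xE.
have hq : nnmeas (fun v => (sqnorm n v `^ (a / 2))%:E * h v)%E.
  apply: nnmeasM => //; apply: nnmeas_EFin => [|v]; last exact: powR_ge0.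
  exact: (measurableT_comp (measurable_powR (a / 2)) mq).
(* The truncation makes the factor nonnegative outside the ball as well, as [nnmeas] demands. *)
pose g v := Num.max 0 (1 - sqnorm n v `^ (a / 2)).
have hg : nnmeas (fun v => (g v)%:E * h v)%E.
  apply: nnmeasM => //; apply: nnmeas_EFin => [|v]; last by rewrite le_max lexx.
  apply: measurable_maxr => //; apply: measurable_funB => //.
  exact: (measurableT_comp (measurable_powR (a / 2)) mq).
have gE v : in_ball n v -> g v = 1 - sqnorm n v `^ (a / 2).
  move=> /andP[q0 q1]; apply/max_idPr; rewrite subr_ge0.
  have := @ge0_ler_powR R (a / 2) (ltW a2) (sqnorm n v) 1.
  by rewrite powR1; apply; rewrite ?nnegrE ?(ltW q0).
have xg : x = ball_int n (fun v => (g v)%:E * h v)%E.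
  by apply: eq_ball_int => v /gE ->.
have := ball_intD n hg hq; rewrite -xg xE.
have -> : ball_int n (fun v => (g v)%:E * h v + (sqnorm n v `^ (a / 2))%:E * h v)%E
   = ball_int n h.
  apply: eq_ball_int => v vb.
  rewrite -ge0_muleDl ?lee_fin ?powR_ge0 ?le_max ?lexx // -EFinD gE // subrK.
  by rewrite mul1e.
have : ball_int n h \is a fin_num by rewrite ge0_fin_numE // ball_int_ge0.
move=> /fineK <-; move: (ball_int n (fun v => (sqnorm n v `^ (a / 2))%:E * h v)%E).
move=> [y| |] //; rewrite -!EFinM -?EFinD => -[] // E.
congr _%:E; move: (fine _) E => z E.
have -> : y = z - a / (n%:R + a + b) * z by rewrite [X in X - _]E; ring.
by field; rewrite gt_eqF //; lra.
Qed.

End moments.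

(** * Even moments of one coordinate over the ball *)

Section gaussian_moments.
Variable R : realType.
Notation mu := (@lebesgue_measure R).
Notation vec := (g_sigma_algebraType (@coord_sets R)).
Notation origin := (fun=> 0 : R).
Implicit Types (h k : vec -> \bar R) (v : vec) (n m j : nat) (a b c : R).

Lemma sqnorm_recr n v : sqnorm n.+1 v = sqnorm n v + v n ^+ 2.
Proof. by rewrite /sqnorm dotv_recr expr2. Qed.

Lemma multi_int_recr n h v :
  multi_int (iota 0 n.+1) h v = (\int[mu]_x multi_int (iota 0 n) h (upd n x v))%E.
Proof.
have -> : iota 0 n.+1 = iota 0 n ++ [:: n] by rewrite -addn1 iotaD.
by rewrite multi_int_cat.
Qed.

Lemma nnmeas_gaussian n : nnmeas (fun v => (expR (- sqnorm n v))%:E).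
Proof.
apply: nnmeas_EFin => [|v]; last exact: expR_ge0.
exact: (measurableT_comp (@measurable_expRN R) (@measurable_sqnorm R n)).
Qed.

(** The value of the Gaussian integral in n coordinates is a hypothesis, so that f = 1 provides the
    inductive step of [multi_int_gaussian]. *)
Lemma multi_int_gaussian_axis n (f : R -> R) v :
  measurable_fun setT f -> (forall x, 0 <= f x) ->
  (forall w, multi_int (iota 0 n) (fun v => (expR (- sqnorm n v))%:E) w
     = (Num.sqrt pi ^+ n)%:E) ->
  multi_int (iota 0 n.+1) (fun v => (expR (- sqnorm n.+1 v))%:E * (f (v n))%:E)%E v
  = ((Num.sqrt pi ^+ n)%:E * \int[mu]_x (expR (- x ^+ 2) * f x)%:E)%E.
Proof.
move=> mf f0 IH; rewrite multi_int_recr.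
have mn := @measurable_coord R n.
have mfn : measurable_fun [set: vec] (fun v : vec => f (v n)) by exact: (measurableT_comp mf mn).
have me : measurable_fun setT (fun x : R => expR (- x ^+ 2)).
  by apply: (measurableT_comp (@measurable_expRN R)); exact: exprn_measurable.
have men : measurable_fun [set: vec] (fun v : vec => expR (- v n ^+ 2)).
  exact: (measurableT_comp me mn).
have -> : (fun v : vec => (expR (- sqnorm n.+1 v))%:E * (f (v n))%:E)%E
  = (fun v : vec => (expR (- v n ^+ 2) * f (v n))%:E * (expR (- sqnorm n v))%:E)%E.
  by apply/funext => w; rewrite sqnorm_recr opprD expRD -!EFinM; congr _%:E; ring.
under eq_integral => x _.
  rewrite (@multi_intZ R _ (fun v => (expR (- v n ^+ 2) * f (v n))%:E)); first last.
  - move=> i y w; rewrite mem_iota add0n => /andP[_ lin].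
    by rewrite upd_neq // neq_ltn lin orbT.
  - exact: nnmeas_gaussian.
  - apply: nnmeas_EFin => [|w]; last by rewrite mulr_ge0 ?expR_ge0.
    exact: measurable_funM.
  rewrite IH upd_same; over.
rewrite ge0_integralZr // 1?muleC //.
  by apply/measurable_EFinP; exact: measurable_funM.
by move=> x _; rewrite lee_fin mulr_ge0 ?expR_ge0.
Qed.

Lemma multi_int_gaussian n w :
  multi_int (iota 0 n) (fun v => (expR (- sqnorm n v))%:E) w = (Num.sqrt pi ^+ n)%:E.
Proof.
elim: n w => [|n IH] w.
  by rewrite /= /sqnorm /dotv big_ord0 oppr0 expR0 expr0.
have := @multi_int_gaussian_axis n (fun=> 1) w (measurable_cst _) (fun=> ler01) IH.
under eq_fun do rewrite mule1.
move=> ->; under eq_integral do rewrite mulr1.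
by rewrite integralT_gauss -EFinM -exprSr.
Qed.

Definition gaussian_moment j : \bar R := (\int[mu]_x (expR (- x ^+ 2) * x ^+ (2 * j))%:E)%E.

Definition axis_power n c j v := ((c * v n) ^+ (2 * j))%:E.

Lemma even_power_ge0 (x : R) j : 0 <= x ^+ (2 * j).
Proof. by rewrite exprM exprn_ge0 // sqr_ge0. Qed.

Lemma nnmeas_axis_power n c j : nnmeas (axis_power n c j).
Proof.
apply: nnmeas_EFin => [|v]; last exact: even_power_ge0.
apply: measurable_funX; apply: measurable_funM => //; exact: measurable_coord.
Qed.

Lemma homogeneous_axis_power n c j :
  homogeneous n.+1 (2 * j)%:R (axis_power n c j).
Proof.
split=> [a v a0|x v]; rewrite /axis_power.
  rewrite /dilate mem_iota add0n ltnS leqnn /= mulrCA exprMn EFinM.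
  by rewrite powR_mulrn // ltW.
by rewrite upd_neq // neq_ltn ltnSn.
Qed.

Lemma gaussian_axis_power n c j :
  multi_int (iota 0 n.+1)
    (fun v => (expR (- sqnorm n.+1 v))%:E * axis_power n c j v)%E origin
  = ((c ^+ (2 * j) * Num.sqrt pi ^+ n)%:E * gaussian_moment j)%E.
Proof.
have mX i : measurable_fun setT (fun x : R => x ^+ i) by exact: exprn_measurable.
rewrite (@multi_int_gaussian_axis n (fun x => (c * x) ^+ (2 * j))) //; last 3 first.
- exact: (measurableT_comp (mX _) (mulrl_measurable c)).
- by move=> x; exact: even_power_ge0.
- exact: multi_int_gaussian.
rewrite mulrC EFinM -muleA; congr (_ * _)%E.
under eq_integral do rewrite exprMn mulrCA.
rewrite ge0_integralZl_real //.
- apply: measurable_funM => //; apply: (measurableT_comp (@measurable_expRN R)).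
  exact: mX.
- by move=> x; rewrite mulr_ge0 ?expR_ge0 ?even_power_ge0.
- exact: even_power_ge0.
Qed.

(** In dimension 1 the ball is [-1, 1] without 0, and the integral is elementary; it calibrates
    [gaussian_momentE]. *)
Lemma ball_int1_axis_power j :
  ball_int 1 (axis_power 0 1 j) = (2 / (2 * j).+1%:R)%:E.
Proof.
have mX (D : set R) : measurable_fun D (fun x : R => (x ^+ (2 * j))%:E).
  by apply/measurable_EFinP; apply: measurable_funTS; exact: exprn_measurable.
have j0 : (2 * j).+1%:R != 0 :> R by rewrite pnatr_eq0.
transitivity (\int[mu]_(x in `[(- 1)%R, 1%R] `\ 0%R) (x ^+ (2 * j))%:E)%E.
  rewrite /ball_int /= /coord_int [RHS]integral_mkcond; apply: eq_integral => x _.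
  rewrite /in_ball /sqnorm /dotv big_ord1 /axis_power !upd_same mul1r.
  rewrite /patch (_ : (x \in _) = (0 < x * x) && (x * x <= 1)) //.
  apply/idP/idP => [|/andP[h1 h2]]; rewrite inE /= in_itv /=.
    move=> [/andP[h1 h2] /eqP h3]; rewrite lt_def mulf_neq0 //= -expr2 sqr_ge0 /=; nra.
  split; first by apply/andP; split; nra.
  by move=> x0; rewrite x0 mul0r ltxx in h1.
rewrite integral_setD1 //; last by apply: measurableD.
pose P : {poly R} := ((2 * j).+1%:R^-1)%:P * 'X^((2 * j).+1).
have dF (x : R) : -1 <= x <= 1 -> is_derive x 1 (horner P) (x ^+ (2 * j)).
  move=> _; apply: is_derive_eq (is_derive_poly P x) _.
  rewrite deriv_mulC derivXn !(hornerM, hornerC, hornerMn, hornerXn).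
  by rewrite -(mulr_natl (x ^+ (2 * j))) mulrA mulVf // mul1r.
have cF (x : R) : -1 <= x <= 1 -> {for x, continuous (fun x : R => x ^+ (2 * j))}.
  by move=> _; exact: exprn_continuous.
rewrite (integral_is_derive _ dF cF); last by lra.
rewrite !(hornerM, hornerC, hornerXn) expr1n exprS exprM sqrrN !expr1n; congr _%:E.
by field.
Qed.

(** [gaussian_homogeneous] in dimension 1 plays the part of the substitution r = x ^ 2; the factor 2
    / (2 j + 1) cancels against the functional equation at j + 1/2. *)
Lemma gaussian_momentE j : gaussian_moment j = gamma_integral (j%:R - 2^-1).
Proof.
have := gaussian_axis_power 0 1 j.
rewrite expr0 mulr1 expr1n mul1e => <-.
rewrite (gaussian_homogeneous _ (nnmeas_axis_power _ _ _) (homogeneous_axis_power 0 1 j)) //.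
rewrite ball_int1_axis_power.
have -> : (1 + (2 * j)%:R) / 2 = j%:R + 2^-1 :> R by rewrite natrM; field.
rewrite gamma_integralS; last by rewrite ltr_wpDl // invr_gt0.
have -> : j%:R + 2^-1 - 1 = j%:R - 2^-1 :> R by field.
rewrite muleAC -EFinM (_ : _ * _ = 1) ?mul1e //.
have j0 : 0 <= j%:R :> R by [].
by rewrite -[(2 * j).+1%:R]natr1 natrM; field; lra.
Qed.

(** Finiteness and positivity propagate in steps of 2 by the functional equation, from the Gaussian
    integral and from the exponential one. *)
Lemma gamma_integral_half n :
  exists2 g : R, 0 < g & gamma_integral (n.+1%:R / 2 - 1) = g%:E.
Proof.
have gS m (g : R) : 0 < g -> gamma_integral (m.+1%:R / 2 - 1) = g%:E ->
    exists2 g' : R, 0 < g' & gamma_integral (m.+3%:R / 2 - 1) = g'%:E.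
  move=> g0 gE; exists (m.+1%:R / 2 * g); first by rewrite mulr_gt0 ?divr_gt0.
  have -> : m.+3%:R / 2 - 1 = m.+1%:R / 2 :> R.
    by rewrite -addn2 natrD; field.
  by rewrite gamma_integralS ?gE ?divr_gt0.
have [n0 n1] : (exists2 g : R, 0 < g & gamma_integral (1 / 2 - 1) = g%:E) /\
    (exists2 g : R, 0 < g & gamma_integral (2 / 2 - 1) = g%:E).
  split.
    exists (Num.sqrt pi); first by rewrite sqrtr_gt0 pi_gt0.
    rewrite (_ : 1 / 2 - 1 = 0%:R - 2^-1); last by field.
    rewrite -gaussian_momentE /gaussian_moment muln0.
    under eq_integral do rewrite expr0 mulr1.
    exact: integralT_gauss.
  exists 1 => //; rewrite divff // subrr /gamma_integral.
  under eq_integral do rewrite powRr0 mulr1.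
  rewrite integral_itv_obnd_cbnd; first by rewrite integral_expRN oppr0 expR0.
  by apply/measurable_EFinP; apply: measurable_funTS; exact: measurable_expRN.
suff [] : (exists2 g : R, 0 < g & gamma_integral (n.+1%:R / 2 - 1) = g%:E) /\
  (exists2 g : R, 0 < g & gamma_integral (n.+2%:R / 2 - 1) = g%:E) by [].
elim: n => [|n [IH1 IH2]]; first exact: (conj n0 n1).
split; first exact: IH2.
by have [g g0 gE] := IH1; exact: gS gE.
Qed.

(** Gamma(n / 2) as a real number, in view of the shift by 1 in [gamma_integral]. *)
Definition half_gamma n : R := fine (gamma_integral (n%:R / 2 - 1)).

Lemma half_gammaE n : (0 < n)%N -> gamma_integral (n%:R / 2 - 1) = (half_gamma n)%:E.
Proof.
by case: n => // n _; rewrite /half_gamma; have [g _ ->] := gamma_integral_half n.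
Qed.

Lemma half_gamma_gt0 n : (0 < n)%N -> 0 < half_gamma n.
Proof.
by case: n => // n _; rewrite /half_gamma; have [g g0 ->] := gamma_integral_half n.
Qed.

Lemma half_gammaSS n : (0 < n)%N -> half_gamma n.+2 = n%:R / 2 * half_gamma n.
Proof.
move=> n0; have := half_gammaE (ltn0Sn n.+1); have nR : 0 < n%:R / 2 :> R.
  by rewrite divr_gt0 // ltr0n.
have -> : n.+2%:R / 2 - 1 = n%:R / 2 :> R by rewrite -addn2 natrD; field.
by rewrite gamma_integralS // half_gammaE // -EFinM => -[].
Qed.

Lemma half_gamma1 : half_gamma 1 = Num.sqrt pi.
Proof.
rewrite /half_gamma (_ : 1 / 2 - 1 = 0%:R - 2^-1); last by field.
rewrite -gaussian_momentE /gaussian_moment muln0.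
under eq_integral do rewrite expr0 mulr1.
by rewrite integralT_gauss.
Qed.

Lemma Gamma_half n : Gamma (n%:R / 2 : R) = half_gamma n.
Proof.
rewrite /Gamma /Rintegral /half_gamma /gamma_integral; congr fine.
by apply: eq_integral => x _; rewrite mulrC.
Qed.

(** One Gaussian integral computed twice, coordinate by coordinate and by homogeneity; the ball
    integral is the quotient. For j = 0 it is the volume of the ball. *)
Lemma ball_int_axis_power n c j : ball_int n.+1 (axis_power n c j)
  = (c ^+ (2 * j) * Num.sqrt pi ^+ n * half_gamma (2 * j).+1
     / half_gamma (n.+1 + 2 * j).+2)%:E.
Proof.
have := gaussian_axis_power n c j.
rewrite (gaussian_homogeneous _ (nnmeas_axis_power _ _ _) (homogeneous_axis_power n c j)) //.
rewrite gaussian_momentE.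
have -> : j%:R - 2^-1 = (2 * j).+1%:R / 2 - 1 :> R.
  by rewrite -[(2 * j).+1%:R]natr1 natrM; field.
have -> : (n.+1%:R + (2 * j)%:R) / 2 = (n.+1 + 2 * j).+2%:R / 2 - 1 :> R.
  by rewrite -[(_ + _).+2]addn2 !natrD; field.
rewrite !half_gammaE //.
have g0 : half_gamma (n.+1 + 2 * j).+2 != 0 by rewrite gt_eqF // half_gamma_gt0.
move=> H; rewrite -[LHS]mul1e -(mulVf g0) EFinM -muleA H -!EFinM; congr _%:E.
by rewrite mulrC.
Qed.

End gaussian_moments.

(** * Averages of functions of one coordinate *)

Section cone_mean.
Variable R : realType.
Notation vec := (g_sigma_algebraType (@coord_sets R)).
Implicit Types (h : vec -> \bar R) (v : vec) (m i j : nat) (a : R) (f g : R -> R).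
Variables (n : nat) (c : R).
Hypothesis c01 : 0 <= c <= 1.

Definition axis_cos v : R := c * v n / Num.sqrt (sqnorm n.+1 v).

(* The weight |v| is the one left by the substitution in [ball_int_axis_slab]; the
   maximum with 0 keeps the integrand nonnegative for every f. *)
Definition cone_mean f : \bar R :=
  ball_int n.+1 (fun v => (Num.sqrt (sqnorm n.+1 v) * Num.max 0 (f (axis_cos v)))%:E).

Lemma measurable_norm : measurable_fun setT (fun v => Num.sqrt (sqnorm n.+1 v)).
Proof. exact: (measurableT_comp (@measurable_sqrtr R) (@measurable_sqnorm R n.+1)). Qed.

Lemma measurable_axis_cos : measurable_fun setT axis_cos.
Proof.
apply: measurable_funM.
  by apply: measurable_funM => //; exact: measurable_coord.
exact: (measurableT_comp (@measurable_invr R) measurable_norm).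
Qed.

Lemma nnmeas_cone f : measurable_fun setT f -> 
  nnmeas (fun v => (Num.sqrt (sqnorm n.+1 v) * Num.max 0 (f (axis_cos v)))%:E).
Proof.
move=> mf; apply: nnmeas_EFin => [|v]; last by rewrite mulr_ge0 ?sqrtr_ge0 // le_max lexx.
apply: measurable_funM; first exact: measurable_norm.
by apply: measurable_maxr => //; exact: (measurableT_comp mf measurable_axis_cos).
Qed.

Lemma axis_cos_bound v : 0 < sqnorm n.+1 v -> `|axis_cos v| <= 1.
Proof.
move=> q0; have s0 : 0 < Num.sqrt (sqnorm n.+1 v) by rewrite sqrtr_gt0.
rewrite /axis_cos normrM normfV (gtr0_norm s0) ler_pdivrMr // mul1r.
rewrite -ler_sqr ?nnegrE ?sqrtr_ge0 // (sqr_sqrtr (ltW q0)) real_normK ?num_real //.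
move: c01 => /andP[c0 c1]; rewrite sqnorm_recr exprMn.
have := dotvv_ge0 n v; rewrite -/(sqnorm n v) => q1.
have c2 : c ^+ 2 <= 1 by rewrite expr2; nra.
have c3 : c ^+ 2 * v n ^+ 2 <= v n ^+ 2 by rewrite ler_piMl ?sqr_ge0.
lra.
Qed.

Lemma eq_cone_mean f g : (forall x, `|x| <= 1 -> f x = g x) -> cone_mean f = cone_mean g.
Proof.
by move=> fg; apply: eq_ball_int => v /andP[/axis_cos_bound/fg -> _].
Qed.

(** The truncation at 0 is not additive, hence the sign conditions on [-1, 1], where it is then
    inactive. *)
Lemma cone_meanD f g : measurable_fun setT f -> measurable_fun setT g ->
  (forall x, `|x| <= 1 -> 0 <= f x) -> (forall x, `|x| <= 1 -> 0 <= g x) ->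
  cone_mean (fun x => f x + g x) = (cone_mean f + cone_mean g)%E.
Proof.
move=> mf mg f0 g0; rewrite -ball_intD; try exact: nnmeas_cone.
apply: eq_ball_int => v /andP[/axis_cos_bound v1 _]; rewrite -EFinD -mulrDr.
by rewrite !max_r ?addr_ge0 ?f0 ?g0.
Qed.

Lemma cone_meanZ a f : 0 <= a -> measurable_fun setT f ->
  cone_mean (fun x => a * f x) = (a%:E * cone_mean f)%E.
Proof.
move=> a0 mf; rewrite -ball_intZ //; last exact: nnmeas_cone.
apply: eq_ball_int => v _; rewrite -EFinM; congr _%:E; rewrite mulrCA; congr (_ * _).
by rewrite maxr_pMr // mulr0.
Qed.

Lemma cone_meanN f : measurable_fun setT f -> cone_mean (f \o -%R) = cone_mean f.
Proof.
move=> mf; rewrite /cone_mean /ball_int.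
rewrite -(@multi_int_opp R (iota 0 n.+1) n (fun v => if in_ball n.+1 v
   then (Num.sqrt (sqnorm n.+1 v) * Num.max 0 (f (axis_cos v)))%:E else 0%E)).
- congr (multi_int _ _ _); apply/funext => v.
  have qE : sqnorm n.+1 (upd n (- v n) v) = sqnorm n.+1 v.
    by rewrite !sqnorm_recr sqnorm_upd upd_same sqrrN.
  rewrite /in_ball qE; case: ifP => // _; congr (_ * Num.max _ (f _))%:E.
  by rewrite /axis_cos qE upd_same mulrN mulNr.
- by rewrite mem_iota add0n ltnSn.
- by apply: nnmeas_in_ball; exact: nnmeas_cone.
Qed.

(** The integral of u ^ (2 j) over S^n, u being one coordinate, divided by n + 2: the radial
    integral of |v| over the ball of R^(n+1) contributes 1 / (n + 2). *)
Definition axis_moment j : R :=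
  2 * Num.sqrt pi ^+ n * half_gamma R (2 * j).+1 / (n.+2%:R * half_gamma R (n.+1 + 2 * j)).

Lemma homogeneous_cone f : measurable_fun setT f -> 
  homogeneous n.+1 1
    (fun v => (Num.sqrt (sqnorm n.+1 v) * Num.max 0 (f (axis_cos v)))%:E).
Proof.
move=> mf; split=> [a v a0|x v]; last first.
  by rewrite /axis_cos sqnorm_upd upd_neq // neq_ltn ltnSn.
have -> : axis_cos (dilate (iota 0 n.+1) a v) = axis_cos v.
  rewrite /axis_cos sqnorm_dilate sqrtrM ?sqr_ge0 // sqrtr_sqr gtr0_norm //.
  rewrite /dilate mem_iota add0n ltnSn /= invfM; set s := (Num.sqrt _)^-1.
  transitivity (a / a * (c * v n * s)); first by ring.
  by rewrite divff ?mul1r // gt_eqF.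
rewrite sqnorm_dilate sqrtrM ?sqr_ge0 // sqrtr_sqr gtr0_norm //.
by rewrite powRr1 ?ltW // -EFinM mulrA.
Qed.

(** The integrand is homogeneous of degree 1, and multiplied by |v| ^ (2 j - 1) it becomes the axis
    power (c v_n) ^ (2 j). So [ball_int_radial] with a = 2 j - 1 reduces the claim to
    [ball_int_axis_power]. *)
Lemma cone_mean_even j :
  cone_mean (fun x => x ^+ (2 * j)) = (c ^+ (2 * j) * axis_moment j)%:E.
Proof.
have mX (i : nat) : measurable_fun setT (fun x : R => x ^+ i) by exact: exprn_measurable.
have g0 i : half_gamma R i.+1 != 0 by rewrite gt_eqF // half_gamma_gt0.
have nn : n.+2%:R != 0 :> R by rewrite pnatr_eq0.
have hg := nnmeas_cone (mX (2 * j)%N).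
have hb := homogeneous_cone (mX (2 * j)%N).
have fin : (cone_mean (fun x => x ^+ (2 * j))%R < +oo)%E.
  apply: (@le_lt_trans _ _ (ball_int n.+1 (axis_power n 1 0))); last first.
    by rewrite ball_int_axis_power ltry.
  apply: ball_int_le => //; first exact: nnmeas_axis_power.
  move=> v /andP[q0 q1]; rewrite /axis_power muln0 expr0 lee_fin.
  rewrite max_r ?even_power_ge0 // mulr_ile1 ?sqrtr_ge0 ?even_power_ge0 //.
    by rewrite -sqrtr1 ler_wsqrtr.
  have := axis_cos_bound q0; rewrite exprM -real_normK ?num_real // => h.
  by rewrite exprn_ile1 // exprn_ile1.
(* At j = 0 the exponent 2 j - 1 would be negative; there the weight |v| is instead added to the
   constant 1, with a = 1 and degree 0. *)
have [j0|j0] := posnP j.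
  have h1 : homogeneous n.+1 0 (axis_power n (1 : R) 0).
    by have := @homogeneous_axis_power R n 1 0; rewrite muln0 mulr0n.
  have := @ball_int_radial R n.+1 1 0 _ (ltn0Sn n) ltr01 (lexx 0)
    (nnmeas_axis_power n 1 0) h1.
  rewrite ball_int_axis_power ltry => /(_ erefl).
  rewrite -EFinM => E; rewrite /cone_mean j0 muln0 expr0 mul1r.
  transitivity (ball_int n.+1 (fun v => (sqnorm n.+1 v `^ (1 / 2))%:E * axis_power n 1 0 v)%E).
    apply: eq_ball_int => v /andP[q0 _]; rewrite /axis_power muln0 !expr0 max_r // mul1r.
    by rewrite powR12_sqrt ?ltW // mule1 mulr1.
  rewrite E /axis_moment muln0 addn0 half_gammaSS // expr1n; congr _%:E.
  by field; rewrite g0 nat1r -natrD !pnatr_eq0.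
pose a : R := (2 * j).-1%:R.
have aE : a + 1 = (2 * j)%:R by rewrite /a natr1; congr _%:R; lia.
have a0 : 0 < a by rewrite /a ltr0n; lia.
have := ball_int_radial (ltn0Sn n) a0 ler01 hg hb fin.
rewrite (_ : ball_int _ _ = ball_int n.+1 (axis_power n c j)); last first.
  apply: eq_ball_int => v /andP[q0 _].
  rewrite /axis_power max_r ?even_power_ge0 // -EFinM; congr _%:E.
  set s := Num.sqrt _; have s0 : s != 0 by rewrite gt_eqF // sqrtr_gt0.
  have -> : sqnorm n.+1 v `^ (a / 2) = s ^+ (2 * j).-1.
    by rewrite mulrC powRrM powR12_sqrt ?powR_mulrn ?sqrtr_ge0 ?(ltW q0).
  rewrite mulrA -exprSr prednK ?muln_gt0 // /axis_cos -/s expr_div_n mulrC divfK //.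
  exact: expf_neq0.
rewrite ball_int_axis_power -[ball_int _ _]/(cone_mean (fun x => x ^+ (2 * j))).
move: fin (ball_int_ge0 n.+1 hg); rewrite -[ball_int _ _]/(cone_mean (fun x => x ^+ (2 * j))).
move: (cone_mean _) => [z| |] //= _ _; rewrite -EFinM => -[E]; congr _%:E.
move: E; rewrite -addrA aE natr1 -natrD half_gammaSS ?addSn // -addSn /axis_moment => E.
have n2 : (n.+1 + 2 * j)%:R != 0 :> R by rewrite pnatr_eq0.
have g1 : half_gamma R (n.+1 + 2 * j) != 0 by exact: g0.
move: nn n2 E; move: (n.+2%:R) ((n.+1 + 2 * j)%:R) => p q p0 q0 E.
have -> : z = q / p * (p / q * z) by field; rewrite p0 q0.
by rewrite -E; field; rewrite g1 p0 q0.
Qed.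

Definition cone_moment i : R := if odd i then 0 else c ^+ i * axis_moment i./2.

Lemma cone_mean_cst a : 0 <= a -> cone_mean (fun=> a) = (a * cone_moment 0)%:E.
Proof.
move=> a0; have -> : cone_moment 0 = c ^+ (2 * 0) * axis_moment 0.
  by rewrite /cone_moment muln0.
rewrite EFinM -cone_mean_even -cone_meanZ //.
by apply: eq_cone_mean => x _; rewrite muln0 expr0 mulr1.
Qed.

Lemma cone_mean_monomial a i :
  cone_mean (fun x => a * x ^+ i + `|a|)
  = (a * cone_moment i + `|a| * cone_moment 0)%:E.
Proof.
have mX (k : nat) : measurable_fun setT (fun x : R => x ^+ k) by exact: exprn_measurable.
have m0 : cone_mean (fun=> 1) = (cone_moment 0)%:E by rewrite cone_mean_cst ?mul1r.
have X1 (x : R) k : `|x| <= 1 -> -1 <= x ^+ k <= 1.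
  by move=> x1; rewrite -ler_norml normrX exprn_ile1.
have mp : measurable_fun setT (fun x : R => 1 + x ^+ i) by exact: measurable_funD.
have mm : measurable_fun setT (fun x : R => 1 - x ^+ i) by exact: measurable_funB.
have p0 (x : R) : `|x| <= 1 -> 0 <= 1 + x ^+ i by move=> /(X1 x i)/andP[]; lra.
have q0 (x : R) : `|x| <= 1 -> 0 <= 1 - x ^+ i by move=> /(X1 x i)/andP[]; lra.
have key : cone_mean (fun x => 1 + x ^+ i) = (cone_moment 0 + cone_moment i)%:E /\
           cone_mean (fun x => 1 - x ^+ i) = (cone_moment 0 - cone_moment i)%:E.
  have [io|ie] := boolP (odd i).
    have mi : cone_moment i = 0 by rewrite /cone_moment io.
    have e : cone_mean (fun x => 1 - x ^+ i) = cone_mean (fun x => 1 + x ^+ i).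
      rewrite -(cone_meanN mp); apply: eq_cone_mean => x _ /=.
      by rewrite exprNn -signr_odd io expr1 mulN1r.
    (* For odd i the reflection gives 1 + x ^ i and 1 - x ^ i the same mean; as they add up to 2, it
       is the mean of 1. *)
    have := cone_meanD mp mm p0 q0; rewrite e mi addr0 subr0.
    rewrite (@eq_cone_mean _ (fun x => 2 * (fun=> 1) x)); last by move=> x _; lra.
    rewrite cone_meanZ // m0.
    have := ball_int_ge0 n.+1 (nnmeas_cone mp); rewrite -/(cone_mean _).
    move: (cone_mean _) => [z| |] //= _; rewrite -EFinM -EFinD => -[E].
    by split; congr _%:E; lra.
  have iE : (2 * i./2 = i)%N by rewrite mul2n even_halfK.
  have mi : cone_mean (fun x => x ^+ i) = (cone_moment i)%:E.
    by rewrite /cone_moment (negbTE ie) -{2}iE -cone_mean_even iE.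
  have Xi (x : R) : `|x| <= 1 -> 0 <= x ^+ i by rewrite -iE even_power_ge0.
  split; first by rewrite cone_meanD // m0 mi -EFinD.
  have := cone_meanD (mX i) mm Xi q0.
  rewrite (@eq_cone_mean _ (fun=> 1)); last by move=> x _; lra.
  have := ball_int_ge0 n.+1 (nnmeas_cone mm); rewrite -/(cone_mean _) m0 mi.
  move: (cone_mean (fun x => 1 - x ^+ i)) => [z| |] //= _; rewrite -EFinD => -[E].
  by congr _%:E; lra.
have [a0|a0] := leP 0 a.
  rewrite (@eq_cone_mean _ (fun x => a * (1 + x ^+ i))) ?cone_meanZ ?key.1 -?EFinM //.
    by congr _%:E; rewrite ger0_norm //; ring.
  by move=> x _; rewrite ger0_norm //; ring.
rewrite (@eq_cone_mean _ (fun x => (- a) * (1 - x ^+ i))).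
  rewrite cone_meanZ ?key.2 -?EFinM ?oppr_ge0 ?ltW //.
  by congr _%:E; rewrite ltr0_norm //; ring.
by move=> x _; rewrite ltr0_norm //; ring.
Qed.

(* Adding |a| to each monomial makes all integrands nonnegative; these constants are
   cancelled at the end. *)
Lemma cone_mean_poly N (a : nat -> R) :
  (forall x, `|x| <= 1 -> 0 <= \sum_(i < N) a i * x ^+ i) ->
  cone_mean (fun x => \sum_(i < N) a i * x ^+ i)
  = (\sum_(i < N) a i * cone_moment i)%:E.
Proof.
have mS M : measurable_fun setT (fun x : R => \sum_(i < M) a i * x ^+ i).
  apply: measurable_sum => i; apply: measurable_funM => //; exact: exprn_measurable.
move=> f0.
have [K [K0 KP KE]] : exists K, [/\ 0 <= K,
    forall x, `|x| <= 1 -> 0 <= \sum_(i < N) a i * x ^+ i + K &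
    cone_mean (fun x => \sum_(i < N) a i * x ^+ i + K)
    = (\sum_(i < N) a i * cone_moment i + K * cone_moment 0)%:E].
  elim: N {f0} => [|N [K [K0 KP KE]]].
    exists 0; split => // [x _|]; first by rewrite big_ord0 addr0.
    rewrite big_ord0 mul0r addr0 (@eq_cone_mean _ (fun=> 0)) ?cone_mean_cst ?mul0r //.
    by move=> x _; rewrite big_ord0 addr0.
  have X1 (x : R) : `|x| <= 1 -> 0 <= a N * x ^+ N + `|a N|.
    move=> x1; rewrite -lerBlDr sub0r lerNl.
    apply: le_trans (ler_norm _) _.
    by rewrite normrN normrM ler_piMr // normrX exprn_ile1.
  exists (K + `|a N|); split; first by rewrite addr_ge0.
    by move=> x x1; rewrite big_ord_recr /= addrACA addr_ge0 ?KP ?X1.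
  rewrite (@eq_cone_mean _ (fun x => (\sum_(i < N) a i * x ^+ i + K)
    + (a N * x ^+ N + `|a N|))); last by move=> x _; rewrite big_ord_recr /= addrACA.
  rewrite cone_meanD //.
  - rewrite KE cone_mean_monomial -EFinD big_ord_recr /=; congr _%:E; ring.
  - by apply: measurable_funD.
  - apply: measurable_funD => //; apply: measurable_funM => //; exact: exprn_measurable.
have := cone_meanD (mS N) (measurable_cst K) f0 (fun _ _ => K0).
rewrite KE cone_mean_cst //.
have := ball_int_ge0 n.+1 (nnmeas_cone (mS N)); rewrite -/(cone_mean _).
move: (cone_mean (fun x => \sum_(i < N) a i * x ^+ i)) => [z| |] //= _.
by rewrite -EFinD => -[/addIr ->].
Qed.

End cone_mean.

(** * Disintegration of the ball along an axis *)

Arguments multi_int : simpl never.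

Section disintegration.
Variable R : realType.
Notation mu := (@lebesgue_measure R).
Notation vec := (g_sigma_algebraType (@coord_sets R)).
Notation origin := (fun=> 0 : R).
Implicit Types (h : vec -> \bar R) (v a b : vec) (m i j n : nat).
Variables (B : set R) (mB : measurable B) (g : R -> R).
Hypothesis mg : measurable_fun setT g.
Hypothesis g0 : forall x, 0 <= g x.

Definition norm n v := Num.sqrt (sqnorm n v).

Lemma measurable_dir n a : measurable_fun setT (fun v => dotv n a v / norm n v).
Proof.
apply: measurable_funM; first exact: measurable_dotv.
apply: (measurableT_comp (@measurable_invr R)).
exact: (measurableT_comp (@measurable_sqrtr R) (@measurable_sqnorm R n)).
Qed.

Lemma nnmeas_slab n a b : nnmeas (fun v =>
  (\1_B (dotv n a v / norm n v) * g (dotv n b v / norm n v))%:E).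
Proof.
apply: nnmeas_EFin => [|v]; last by rewrite mulr_ge0.
apply: measurable_funM; last exact: (measurableT_comp mg (measurable_dir n b)).
have mI : measurable_fun setT (\1_B : R -> R) by exact: measurable_indic.
exact: (measurableT_comp mI (measurable_dir n a)).
Qed.

Lemma ball_int_isometry n (T T' : vec -> vec) h : isometry_pair n T T' -> nnmeas h ->
  ball_int n (h \o T) = ball_int n h.
Proof.
move=> [mT iT _ oT _] hh; rewrite /ball_int -[in RHS]iT; last exact: nnmeas_in_ball.
congr (multi_int _ _ _); apply/funext => v /=.
by rewrite /in_ball /sqnorm oT.
Qed.

(** The rotation taking a to the last axis turns b into a vector with last entry a . b, so the
    square length 1 - (a . b) ^ 2 remains for the other entries b'. *)
Lemma slab_to_axis n a b : dotv n.+1 a a = 1 -> dotv n.+1 b b = 1 ->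
  exists2 b' : vec, dotv n b' b' = 1 - dotv n.+1 a b ^+ 2 &
  ball_int n.+1 (fun v =>
    (\1_B (dotv n.+1 a v / norm n.+1 v) * g (dotv n.+1 b v / norm n.+1 v))%:E)
  = ball_int n.+1 (fun v => (\1_B (v n / norm n.+1 v)
      * g ((dotv n b' v + dotv n.+1 a b * v n) / norm n.+1 v))%:E).
Proof.
move=> a1 b1; have [T [T' [TT' Ta0 Tan]]] := isometry_to_axis n a.
have [mT iT aT oT oT'] := TT'.
have aE v : dotv n.+1 (T' a) v = v n.
  rewrite dotv_recr Tan a1 sqrtr1 mul1r {1}/dotv big1 ?add0r // => k _.
  by rewrite Ta0 ?mul0r.
have bn : T' b n = dotv n.+1 a b by rewrite -oT' aE.
exists (T' b).
  by rewrite -b1 -(oT' b b) dotv_recr bn -expr2 addrK.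
rewrite -(ball_int_isometry TT'); last exact: nnmeas_slab.
apply: eq_ball_int => v _ /=.
have -> : norm n.+1 (T v) = norm n.+1 v by rewrite /norm /sqnorm oT.
by rewrite !aT aE dotv_recr bn.
Qed.

Section axis.
Variables (n : nat) (b : vec) (s : R).

Definition axis_slab v : R :=
  \1_B (v n.+1 / norm n.+2 v) * g ((dotv n.+1 b v + s * v n.+1) / norm n.+2 v).

(** [axis_slab] after the substitution v_(n+1) = |y| cotangent_map t, where y consists of the first
    n + 1 coordinates: the Jacobian is |y| cotangent_weight t, and v / |v| becomes (sqrt (1 - t ^ 2)
    y / |y|, t). *)
Definition polar_slab v : R :=
  let t := v n.+1 in
  norm n.+1 v * cotangent_weight t
  * (\1_B t * g (s * t + Num.sqrt (1 - t ^+ 2) * (dotv n.+1 b v / norm n.+1 v))).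

Lemma nnmeas_axis_slab : nnmeas (fun v => (axis_slab v)%:E).
Proof.
have mI : measurable_fun setT (\1_B : R -> R) by exact: measurable_indic.
have mc := @measurable_coord R n.+1.
have mi : measurable_fun [set: vec] (fun v : vec => (norm n.+2 v)^-1).
  apply: (measurableT_comp (@measurable_invr R)).
  exact: (measurableT_comp (@measurable_sqrtr R) (@measurable_sqnorm R n.+2)).
apply: nnmeas_EFin => [|v]; last by rewrite mulr_ge0.
apply: measurable_funM.
  have m : measurable_fun [set: vec] (fun v : vec => v n.+1 / norm n.+2 v).
    exact: measurable_funM.
  exact: (measurableT_comp mI m).
have m : measurable_fun [set: vec]
    (fun v : vec => (dotv n.+1 b v + s * v n.+1) / norm n.+2 v).
  apply: measurable_funM => //; apply: measurable_funD; first exact: measurable_dotv.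
  exact: measurable_funM.
exact: (measurableT_comp mg m).
Qed.

Lemma nnmeas_polar_slab : nnmeas (fun v => (polar_slab v)%:E).
Proof.
have mI : measurable_fun setT (\1_B : R -> R) by exact: measurable_indic.
have mc := @measurable_coord R n.+1.
have mn : measurable_fun [set: vec] (norm n.+1).
  exact: (measurableT_comp (@measurable_sqrtr R) (@measurable_sqnorm R n.+1)).
apply: nnmeas_EFin => [|v]; last first.
  by rewrite !mulr_ge0 ?sqrtr_ge0 ?cotangent_weight_ge0.
apply: measurable_funM.
  by apply: measurable_funM => //; exact: (measurableT_comp (@measurable_cotangent_weight R) mc).
apply: measurable_funM; first exact: (measurableT_comp mI mc).
have m1 : measurable_fun setT (fun t : R => Num.sqrt (1 - t ^+ 2)).
  have m2 : measurable_fun setT (fun t : R => 1 - t ^+ 2).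
    by apply: measurable_funB => //; exact: exprn_measurable.
  exact: (measurableT_comp (@measurable_sqrtr R) m2).
have m : measurable_fun [set: vec] (fun v : vec => s * v n.+1
    + Num.sqrt (1 - v n.+1 ^+ 2) * (dotv n.+1 b v / norm n.+1 v)).
  apply: measurable_funD; first exact: measurable_funM.
  apply: measurable_funM; first exact: (measurableT_comp m1 mc).
  exact: measurable_dir.
exact: (measurableT_comp mg m).
Qed.

(** The substituted vector has square norm |y| ^ 2 / (1 - t ^ 2), so the unit ball becomes |y| ^ 2
    <= 1 - t ^ 2. The condition on coordinate 0 ensures |y| > 0. *)
Lemma axis_slab_polar v : v 0%N != 0 ->
  coord_int n.+1 (fun v => if in_ball n.+2 v then (axis_slab v)%:E else 0%E) v
  = coord_int n.+1 (fun v => if sqnorm n.+1 v <= 1 - v n.+1 ^+ 2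
                             then (polar_slab v)%:E else 0%E) v.
Proof.
move=> v0; have q0 : 0 < sqnorm n.+1 v by exact: sqnorm_gt0 v0.
set r := norm n.+1 v; have r0 : 0 < r by rewrite sqrtr_gt0.
have r2 : r ^+ 2 = sqnorm n.+1 v by rewrite sqr_sqrtr // ltW.
pose H (z : R) := if in_ball n.+2 (upd n.+1 z v)
  then (axis_slab (upd n.+1 z v))%:E else 0%E.
have [mH H0] : nnmeas (fun v => if in_ball n.+2 v then (axis_slab v)%:E else 0%E).
  by apply: nnmeas_in_ball; exact: nnmeas_axis_slab.
have mHu := measurable_upd_arg n.+1 v mH.
rewrite /coord_int -(ge0_integral_dilate r0 mHu (fun z => H0 _)).
rewrite ge0_integral_cotangent_map //; last first.
  exact: (measurableT_comp mHu (mulrl_measurable r)).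
rewrite -ge0_integralZl //; last 3 first.
- apply: emeasurable_funM.
    apply: (measurableT_comp mHu); apply: measurable_funM => //.
    exact: measurable_cotangent_map.
  by apply/measurable_EFinP; exact: measurable_cotangent_weight.
- by move=> t _; rewrite mule_ge0 // lee_fin cotangent_weight_ge0.
- by rewrite lee_fin ltW.
apply: eq_integral => t _.
rewrite /polar_slab upd_same sqnorm_upd -/r.
have -> : norm n.+1 (upd n.+1 t v) = r by rewrite /norm sqnorm_upd.
have [t1|t1] := boolP (-1 < t < 1); last first.
  by rewrite /cotangent_weight (negbTE t1) !mulr0 !mul0r !mule0 if_same.
have q1 := t1; rewrite one_sub_sqr_gt0 in q1.
have E : sqnorm n.+2 (upd n.+1 (r * cotangent_map t) v) = r ^+ 2 / (1 - t ^+ 2).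
  rewrite sqnorm_recr sqnorm_upd upd_same -r2 /cotangent_map !exprMn exprVn.
  have -> := sqr_sqrtr (ltW q1). by field; exact: lt0r_neq0.
set tau := Num.sqrt (1 - t ^+ 2).
have tau0 : 0 < tau by rewrite sqrtr_gt0.
have nE : norm n.+2 (upd n.+1 (r * cotangent_map t) v) = r / tau.
  rewrite /norm E sqrtrM ?sqr_ge0 // sqrtr_sqr gtr0_norm //.
  by rewrite sqrtrV // ltW.
rewrite /in_ball E divr_gt0 ?exprn_gt0 //= ler_pdivrMr // mul1r r2.
case: ifP => _; last by rewrite mul0e mule0.
rewrite -!EFinM; congr _%:E.
rewrite /axis_slab nE upd_same dotv_upd /cotangent_map -/tau.
have -> : r * (t / tau) / (r / tau) = t by field; rewrite !gt_eqF.
have -> : (dotv n.+1 b v + s * (r * (t / tau))) / (r / tau)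
    = s * t + tau * (dotv n.+1 b v / r) by field; rewrite !gt_eqF.
by rewrite dotv_upd; ring.
Qed.

(** For fixed t the integrand has degree 1 on a ball of radius sqrt (1 - t ^ 2) in R^(n+1), which
    gives (1 - t ^ 2) ^ ((n + 2) / 2); together with the weight (1 - t ^ 2) ^ (-3/2) the exponent is
    (n + 1) / 2 - 1. *)
Lemma ball_int_axis_slab :
  ball_int n.+2 (fun v => (axis_slab v)%:E)
  = (\int[mu]_(t in `](- 1)%R, 1%R[) ((\1_B t * (1 - t ^+ 2) `^ (n.+1%:R / 2 - 1))%:E
     * ball_int n.+1 (fun v => (norm n.+1 v
         * g (s * t + Num.sqrt (1 - t ^+ 2) * (dotv n.+1 b v / norm n.+1 v)))%:E)))%E.
Proof.
have hA := nnmeas_in_ball n.+2 nnmeas_axis_slab.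
have mq := @measurable_sqnorm R n.+1.
have mc := @measurable_coord R n.+1.
have hK : nnmeas (fun v => if sqnorm n.+1 v <= 1 - v n.+1 ^+ 2
                           then (polar_slab v)%:E else 0%E).
  apply: nnmeas_if; last exact: nnmeas_polar_slab.
  apply: measurable_fun_ler => //; apply: measurable_funB => //.
  exact: measurable_funX.
rewrite /ball_int.
have -> : iota 0 n.+2 = iota 0 n.+1 ++ [:: n.+1] by rewrite -addn1 iotaD.
rewrite multi_int_cat -[multi_int [:: _] _]/(coord_int _ _) -multi_int_coord_int //.
rewrite (@multi_int_neq0 _ (iota 0 n.+1) 0%N _ _ _ (nnmeas_coord_int n.+1 hA)
  (nnmeas_coord_int n.+1 hK)) //; last by move=> v; exact: axis_slab_polar.
rewrite multi_int_coord_int // [RHS]integral_mkcond.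
apply: eq_integral => t _.
have ni : n.+1 \notin iota 0 n.+1 by rewrite mem_iota add0n ltnn.
rewrite -[LHS](congr1 (fun f => f origin) (@multi_int_upd R _ _ t _ ni)).
rewrite /patch mem_setE /= in_itv /=.
pose k v := (norm n.+1 v
         * g (s * t + Num.sqrt (1 - t ^+ 2) * (dotv n.+1 b v / norm n.+1 v)))%:E.
have kE v : (polar_slab (upd n.+1 t v))%:E = ((cotangent_weight t * \1_B t)%:E * k v)%E.
  rewrite /polar_slab upd_same dotv_upd /norm sqnorm_upd -EFinM; congr _%:E.
  by rewrite -/(norm n.+1 v); ring.
have mn : measurable_fun [set: vec] (norm n.+1).
  exact: (measurableT_comp (@measurable_sqrtr R) mq).
have hk : nnmeas k.
  apply: nnmeas_EFin => [|v]; last by rewrite mulr_ge0 ?sqrtr_ge0.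
  apply: measurable_funM => //.
  have m : measurable_fun [set: vec] (fun v : vec => s * t
      + Num.sqrt (1 - t ^+ 2) * (dotv n.+1 b v / norm n.+1 v)).
    by apply: measurable_funD => //; apply: measurable_funM => //; exact: measurable_dir.
  exact: (measurableT_comp mg m).
have hb : homogeneous n.+1 1 k.
  split=> [a v a0|x v]; last by rewrite /k dotv_upd /norm sqnorm_upd.
  have E : norm n.+1 (dilate (iota 0 n.+1) a v) = a * norm n.+1 v.
    by rewrite /norm sqnorm_dilate sqrtrM ?sqr_ge0 // sqrtr_sqr gtr0_norm.
  rewrite /k E dotv_dilate powRr1 ?(ltW a0) // -EFinM; congr _%:E.
  rewrite [RHS]mulrA; congr (_ * g (_ + _ * _)).
  by rewrite invfM; set x := (norm _ _)^-1; rewrite mulrACA divff ?mul1r // gt_eqF.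
have -> : (fun v => if sqnorm n.+1 (upd n.+1 t v) <= 1 - upd n.+1 t v n.+1 ^+ 2
    then (polar_slab (upd n.+1 t v))%:E else 0%E)
  = (fun v => (cotangent_weight t * \1_B t)%:E *
      (if (sqnorm n.+1 v <= 1 - t ^+ 2)%R then k v else 0))%E.
  by apply/funext => v; rewrite sqnorm_upd upd_same kE; case: ifP; rewrite ?mule0.
rewrite (@multi_intZ R _ (fun=> (cotangent_weight t * \1_B t)%:E)) //; last first.
- by apply: nnmeas_if => //; apply: measurable_fun_ler.
- by apply: nnmeas_cst; rewrite lee_fin mulr_ge0 ?cotangent_weight_ge0.
case: ifPn => t1; last by rewrite /cotangent_weight (negbTE t1) mul0r mul0e.
have q1 := t1; rewrite one_sub_sqr_gt0 in q1.
(* The origin may be excluded, as in [multi_int_ball], because the factor |v| of k vanishes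
   there. *)
have -> : (fun v => if sqnorm n.+1 v <= 1 - t ^+ 2 then k v else 0%E)
  = (fun v => if (0 < sqnorm n.+1 v) && (sqnorm n.+1 v <= 1 - t ^+ 2) then k v else 0%E).
  apply/funext => v; have [//|q0] := ltP 0 (sqnorm n.+1 v).
  by rewrite /= /k /norm ler0_sqrtr // mul0r if_same.
rewrite (multi_int_ball q1 hk hb) muleA -EFinM; congr (_%:E * _)%E.
rewrite [_ * \1_B t]mulrC -mulrA; congr (_ * _).
have -> : cotangent_weight t = (1 - t ^+ 2) `^ (- (1 + 2^-1)).
  rewrite /cotangent_weight t1 powRN powRD ?(gt_eqF q1) ?implybT //.
  by rewrite powRr1 ?(ltW q1) // powR12_sqrt ?(ltW q1).
rewrite -powRD ?(gt_eqF q1) ?implybT //; congr (_ `^ _).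
by rewrite -[n.+1%:R]natr1; field.
Qed.

End axis.
End disintegration.

(** * The product formula as an integral mean *)

Section gegenbauer_mean.
Variable R : realType.
Implicit Types (P : {poly R}) (s t : R).

Lemma geg_poly_deriv (lam : R) k : (0 < k)%N ->
  (geg_poly lam k)^`() = (2 * lam)%:P * geg_poly (lam + 1) k.-1.
Proof.
case: k => // k _; rewrite /geg_poly raddf_sum mulr_sumr /=.
have dY n : ((2%:P * 'X : {poly R}) ^+ n)^`() = (2 * n%:R)%:P * (2%:P * 'X) ^+ n.-1.
  by rewrite deriv_exp deriv_mulC derivX polyCM polyC_natr; ring.
pose F j : {poly R} := ((-1) ^+ j * (\prod_(i < k.+1 - j) (lam + i%:R))
     / ((j`!)%:R * ((k.+1 - 2 * j)`!)%:R))%:P * (2%:P * 'X) ^+ (k.+1 - 2 * j).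
pose G j : {poly R} := (2 * lam)%:P * (((-1) ^+ j * (\prod_(i < k - j) (lam + 1 + i%:R))
     / ((j`!)%:R * ((k - 2 * j)`!)%:R))%:P * (2%:P * 'X) ^+ (k - 2 * j)).
have FG j : (2 * j <= k)%N -> (F j)^`() = G j.
  move=> jk; rewrite /F /G deriv_mulC dY (_ : (k.+1 - 2 * j = (k - 2 * j).+1)%N); last by lia.
  rewrite /= !mulrA -!polyCM; congr (_%:P * _).
  rewrite (_ : (k.+1 - j = (k - j).+1)%N); last by lia.
  rewrite big_ord_recl /= addr0.
  rewrite (eq_bigr (fun i : 'I_(k - j) => lam + 1 + i%:R)); last first.
    by move=> i _; rewrite /bump /= natrD addrA.
  rewrite factS natrM.
  have f1 : (j`!)%:R != 0 :> R by rewrite pnatr_eq0 -lt0n fact_gt0.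
  have f2 : ((k - 2 * j)`!)%:R != 0 :> R by rewrite pnatr_eq0 -lt0n fact_gt0.
  by field; rewrite f1 f2 nat1r pnatr_eq0.
transitivity (\sum_(j < k./2.+1) (F j)^`()); last first.
  by apply: eq_bigr => j _; rewrite FG // ; have := ltn_ord j; lia.
have [ko|ke] := boolP (odd k); last first.
  rewrite (_ : (uphalf k).+1 = k./2.+1) //.
  by rewrite uphalf_half (negbTE ke).
(* The polynomial of degree k + 1 has one more term than that of degree k here; it is constant and
   disappears under differentiation. *)
rewrite (_ : (uphalf k).+1 = k./2.+2); last by rewrite uphalf_half ko.
rewrite big_ord_recr /= -[RHS]addr0; congr (_ + _).
rewrite (_ : (k.+1 - 2 * k./2.+1 = 0)%N); last by lia.
by rewrite expr0 mulr1 derivC.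
Qed.

Lemma sum_ord_double (F : nat -> R) n :
  \sum_(i < 2 * n) F i = \sum_(j < n) (F (2 * j)%N + F (2 * j).+1).
Proof.
elim: n => [|n IH]; first by rewrite muln0 !big_ord0.
rewrite (_ : (2 * n.+1 = (2 * n).+2)%N); last by lia.
by rewrite !big_ord_recr /= IH addrA.
Qed.

(** The link between analysis and algebra: the functional equation of Gamma gives the true moments
    on S^n the recursion imposed on [mean_coef] by the differential equation. *)
Lemma axis_moment_mean_coef n j :
  axis_moment R n j = axis_moment R n 0 * ((2 * j)`!)%:R * mean_coef R n.+1 j.
Proof.
elim: j => [|j IH]; first by rewrite muln0 fact0 !mulr1.
have g0 i : half_gamma R i.+1 != 0 by rewrite gt_eqF // half_gamma_gt0.
have -> : axis_moment R n j.+1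
    = axis_moment R n j * ((2 * j).+1%:R / (n.+1 + 2 * j)%:R).
  rewrite /axis_moment (_ : (2 * j.+1 = (2 * j).+2)%N); last by lia.
  rewrite half_gammaSS // !addnS half_gammaSS //.
  have h1 : half_gamma R (n.+1 + 2 * j) != 0 by exact: g0.
  have h2 : (n.+1 + 2 * j)%:R != 0 :> R by rewrite pnatr_eq0.
  have h3 : n.+2%:R != 0 :> R by rewrite pnatr_eq0.
  move: h1 h2 h3; move: (half_gamma R (n.+1 + 2 * j)) ((n.+1 + 2 * j)%:R) (n.+2%:R).
  by move=> x y z x0 y0 z0; field; rewrite x0 y0 z0.
rewrite IH (mean_coefS R j (ltn0Sn n)) (_ : (2 * j.+1 = (2 * j).+2)%N); last by lia.
rewrite !factS !natrM.
have -> : (2 * j).+2%:R = 2 * j.+1%:R :> R by rewrite -natrM; congr _%:R; lia.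
have h2 : (n.+1 + 2 * j)%:R != 0 :> R by rewrite pnatr_eq0.
by move: h2; move: ((n.+1 + 2 * j)%:R) => y y0; field.
Qed.

(** In the Taylor expansion at s t the odd powers of x average to 0 and the even ones reproduce
    [mean_poly]. The function g is prescribed on [-1, 1] only, to admit truncated densities. *)
Lemma cone_mean_geg n N P (s t rho om : R) (g : R -> R) :
  geg_equation n.+1 N P -> -1 <= s <= 1 -> -1 <= t <= 1 ->
  (forall x, -1 <= x <= 1 -> 0 <= (1 + rho * (P.[x] / P.[1])) / om) ->
  (forall x, -1 <= x <= 1 -> g x = (1 + rho * (P.[x] / P.[1])) / om) ->
  cone_mean n 1 (fun x => g (s * t
     + Num.sqrt (1 - t ^+ 2) * (Num.sqrt (1 - s ^+ 2) * x)))
  = (axis_moment R n 0 * ((1 + rho * (P.[s] / P.[1]) * (P.[t] / P.[1])) / om))%:E.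
Proof.
move=> hP s1 t1 W0 gW.
have sq1 (x : R) : -1 <= x <= 1 -> 0 <= 1 - x ^+ 2 by move=> /andP[? ?]; nra.
set tau := Num.sqrt (1 - t ^+ 2); set c := Num.sqrt (1 - s ^+ 2).
have tau2 : tau ^+ 2 = 1 - t ^+ 2 by rewrite sqr_sqrtr ?sq1.
have c2 : c ^+ 2 = 1 - s ^+ 2 by rewrite sqr_sqrtr ?sq1.
(* Cauchy-Schwarz in Lagrange's form, with s ^ 2 + c ^ 2 = 1 and t ^ 2 + tau ^ 2 x ^ 2 <= 1. *)
have in1 (x : R) : `|x| <= 1 -> -1 <= s * t + tau * (c * x) <= 1.
  move=> x1; rewrite -ler_norml -(@ler_pXn2r _ 2) ?nnegrE // expr1n real_normK ?num_real //.
  have x2 : x ^+ 2 <= 1 by rewrite -real_normK ?num_real // exprn_ile1.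
  have : (s ^+ 2 + c ^+ 2) * (t ^+ 2 + tau ^+ 2 * x ^+ 2) - (s * t + tau * (c * x)) ^+ 2
    = (s * tau * x - c * t) ^+ 2 by ring.
  have := sqr_ge0 (s * tau * x - c * t); have := sq1 t t1; rewrite c2 tau2; nra.
(* 2 M Taylor terms pair up into the M terms of [mean_poly]; those beyond the degree are 0. *)
pose M := (size P).+1.
pose b i := P^`N(i).[s * t] * (tau * c) ^+ i.
pose a i := ((i == 0%N)%:R + rho / P.[1] * b i) / om.
have aE x : \sum_(i < 2 * M) a i * x ^+ i
    = (1 + rho * (P.[s * t + tau * (c * x)] / P.[1])) / om.
  rewrite (@nderiv_taylor_wide _ (2 * M) P (s * t)); [|exact: mulrC|rewrite /M; lia].
  transitivity (\sum_(i < 2 * M) ((i == 0%N :> nat)%:R * x ^+ i / om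
     + rho / P.[1] / om * (P^`N(i).[s * t] * (tau * (c * x)) ^+ i))).
    by apply: eq_bigr => i _; rewrite /a /b !mulrA !exprMn; ring.
  rewrite big_split /= -mulr_sumr [X in X + _ = _](_ : _ = om^-1); first by ring.
  rewrite [LHS](_ : _ = \sum_(i < (2 * size P).+2) (i == 0%N :> nat)%:R * x ^+ i / om).
    by rewrite big_ord_recl /= big1 ?addr0 => [|i _]; rewrite ?expr0 ?mul1r ?mul0r.
  by rewrite /M (_ : (2 * (size P).+1 = (2 * size P).+2)%N) //; lia.
rewrite (@eq_cone_mean _ _ _ _ _ (fun x => \sum_(i < 2 * M) a i * x ^+ i)); last 2 first.
- by rewrite ler01 lexx.
- by move=> x /in1 x1; rewrite aE gW.
rewrite cone_mean_poly; last 2 first.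
- by rewrite ler01 lexx.
- by move=> x /in1 x1; rewrite aE W0.
congr _%:E; rewrite (sum_ord_double (fun i => a i * cone_moment n (1 : R) i)).
have -> : \sum_(j < M) (a (2 * j)%N * cone_moment n (1 : R) (2 * j)
     + a (2 * j).+1 * cone_moment n (1 : R) (2 * j).+1)
   = axis_moment R n 0 * ((1 + rho / P.[1] * (mean_poly n.+1 P t).[s]) / om).
  transitivity (\sum_(j < M) (axis_moment R n 0 / om * ((j == 0%N :> nat)%:R
     + rho / P.[1] * (mean_coef R n.+1 j * ((1 - s ^+ 2) * (1 - t ^+ 2)) ^+ j
                        * (P^`(2 * j)).[s * t])))).
    apply: eq_bigr => j _; rewrite /cone_moment oddS oddM /= mulr0 addr0.
    rewrite expr1n mul1r (_ : (2 * j)./2 = j); last by lia.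
    rewrite axis_moment_mean_coef /a /b nderivn_def hornerMn (exprM (tau * c))
      [(tau * c) ^+ 2]exprMn tau2 c2.
    have -> : ((2 * j)%N == 0%N) = (j == 0%N :> nat) by rewrite muln_eq0.
    case: (posnP j) => [->|j0].
      by rewrite muln0 fact0 !mulr1n /=; ring.
    rewrite -[X in _ = _ * (_ + _ * (_ * X))]mulr_natr [(1 - t ^+ 2) * _]mulrC mulr0n.
    by move: (_ ^+ j) (_ `!%:R) => x y; ring.
  rewrite -mulr_sumr big_split /= -mulr_sumr -mean_polyE.
  rewrite big_ord_recl /= big1 // addr0; ring.
have := mean_poly_product s t (ltn0Sn n) hP.
(* If P(1) = 0, all quotients by it are 0 by convention and both sides reduce to the same
   constant. *)
have [->|P1] := eqVneq P.[1] 0.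
  by rewrite invr0 !(mulr0, mul0r).
move=> E; have -> : (mean_poly n.+1 P t).[s] = P.[s] * P.[t] / P.[1].
  by rewrite -E mulrC mulKf.
by ring.
Qed.

End gegenbauer_mean.

(** * The law of a projection *)

Section projected_slab.
Variable R : realType.
Notation mu := (@lebesgue_measure R).
Notation vec := (g_sigma_algebraType (@coord_sets R)).
Implicit Types (v a b : vec) (s t x : R) (g : R -> R) (n : nat).

(** A further rotation, of the n + 1 remaining coordinates, takes b to sqrt (1 - s ^ 2) times the
    last axis, so that a single direction cosine is left. *)
Lemma ball_int_zonal n b s t g : dotv n.+1 b b = 1 - s ^+ 2 ->
  measurable_fun setT g -> (forall x, 0 <= g x) ->
  ball_int n.+1 (fun v => (norm n.+1 v
     * g (s * t + Num.sqrt (1 - t ^+ 2) * (dotv n.+1 b v / norm n.+1 v)))%:E)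
  = cone_mean n 1 (fun x => g (s * t
     + Num.sqrt (1 - t ^+ 2) * (Num.sqrt (1 - s ^+ 2) * x))).
Proof.
move=> bs mg g0; have [T [T' [TT' Tb0 Tbn]]] := isometry_to_axis n b.
have [mT iT aT oT oT'] := TT'.
rewrite -(ball_int_isometry TT'); last first.
  apply: nnmeas_EFin => [|v]; last by rewrite mulr_ge0 ?sqrtr_ge0.
  apply: measurable_funM.
    exact: (measurableT_comp (@measurable_sqrtr R) (@measurable_sqnorm R n.+1)).
  have m : measurable_fun [set: vec] (fun v : vec => s * t
      + Num.sqrt (1 - t ^+ 2) * (dotv n.+1 b v / norm n.+1 v)).
    by apply: measurable_funD => //; apply: measurable_funM => //; exact: measurable_dir.
  exact: (measurableT_comp mg m).
apply: eq_ball_int => v _ /=.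
have -> : norm n.+1 (T v) = norm n.+1 v by rewrite /norm /sqnorm oT.
rewrite aT dotv_recr Tbn bs {1}/dotv big1 ?add0r => [|i _]; last by rewrite Tb0 ?mul0r.
by rewrite max_r // /axis_cos mul1r !mulrA.
Qed.

(** P is any solution of the equation: the choice P = 0 serves in [integrable_jacobi_weight]. *)
Lemma ball_int_geg n N (P : {poly R}) a b rho om (B : set R) g :
  let s := dotv n.+2 a b in
  dotv n.+2 a a = 1 -> dotv n.+2 b b = 1 -> measurable B ->
  geg_equation n.+1 N P -> measurable_fun setT g -> (forall x, 0 <= g x) ->
  (forall x, -1 <= x <= 1 -> g x = (1 + rho * (P.[x] / P.[1])) / om) ->
  ball_int n.+2 (fun v =>
    (\1_B (dotv n.+2 a v / norm n.+2 v) * g (dotv n.+2 b v / norm n.+2 v))%:E)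
  = (\int[mu]_(t in `](- 1)%R, 1%R[) (\1_B t * (1 - t ^+ 2) `^ (n.+1%:R / 2 - 1)
     * (axis_moment R n 0 * ((1 + rho * (P.[s] / P.[1]) * (P.[t] / P.[1])) / om)))%:E)%E.
Proof.
move=> s a1 b1 mB hP mg g0 gE.
have s1 : -1 <= s <= 1.
  rewrite -ler_norml -(@ler_pXn2r _ 2) ?nnegrE // expr1n real_normK ?num_real //.
  by have := cauchy_schwarz_dotv n.+2 a b; rewrite a1 b1 mulr1.
have [b' b's ->] := slab_to_axis mB mg g0 a1 b1.
rewrite (ball_int_axis_slab mB mg g0 _ b'); apply: eq_integral => t.
rewrite inE /= in_itv /= => /andP[t0 t1].
rewrite (@ball_int_zonal n b' s t g b's mg g0).
rewrite (cone_mean_geg hP s1 _ _ gE) ?(ltW t0) ?(ltW t1) // => x x1.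
by rewrite -gE.
Qed.

End projected_slab.

(** * Zonal polynomials and areas of spheres *)

Section zonal_polynomial.
Variable R : realType.

(** For d = 1, [gegC] is written with acos and agrees with this polynomial on [-1, 1]; the
    polynomial form puts both cases under one equation. *)
Definition zonal_poly d k : {poly R} :=
  if d == 1%N then (cheb R k).1 else geg_poly ((d%:R - 1) / 2) k.

Lemma zonal_poly_equation d k :
  geg_equation d (k%:R * (k%:R + d%:R - 1)) (zonal_poly d k).
Proof.
rewrite /zonal_poly; have [->|_] := eqVneq d 1%N; last exact: geg_poly_equation.
by rewrite addrK; exact: cheb_equation.
Qed.

Lemma gegC_zonal_poly d k (x : R) : -1 <= x <= 1 -> gegC d k x = (zonal_poly d k).[x].
Proof.
move=> x1; rewrite /gegC /zonal_poly; case: eqP => _; last by rewrite geg_polyE.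
by rewrite -(cheb_cos k (acos x)).1 acosK.
Qed.

Lemma zonal_poly_ratio d k (x : R) : (0 < d)%N -> (0 < k)%N -> -1 <= x <= 1 ->
  `|(zonal_poly d k).[x] / (zonal_poly d k).[1]| <= 1.
Proof.
move=> d0 k0 x1; set P := zonal_poly d k.
have N0 : 0 < k%:R * (k%:R + d%:R - 1) :> R.
  rewrite mulr_gt0 ?ltr0n //.
  have : 1 <= k%:R :> R by rewrite ler1n.
  have : 1 <= d%:R :> R by rewrite ler1n.
  lra.
have h := geg_equation_bound d0 N0 (zonal_poly_equation d k) x1.
have [P0|P0] := eqVneq P.[1] 0; first by rewrite P0 invr0 mulr0 normr0.
by rewrite normrM normfV ler_pdivrMr ?normr_gt0 // mul1r.
Qed.

Lemma zonal_poly_density_ge0 d k (r x : R) : (0 < d)%N -> (0 < k)%N -> `|r| <= 1 ->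
  -1 <= x <= 1 -> 0 <= 1 + r * ((zonal_poly d k).[x] / (zonal_poly d k).[1]).
Proof.
move=> d0 k0 r1 x1; rewrite -lerBlDl sub0r lerNl; apply: le_trans (ler_norm _) _.
by rewrite normrN normrM mulr_ile1 // zonal_poly_ratio.
Qed.

Lemma omega_half_gamma n :
  omega R n = 2 * Num.sqrt pi ^+ n.+1 / half_gamma R n.+1.
Proof.
rewrite /omega Gamma_half; congr (_ * _ / _).
by rewrite mulrC powRrM powR12_sqrt ?powR_mulrn ?sqrtr_ge0 ?(ltW (pi_gt0 R)).
Qed.

(** In polar coordinates |v| integrates to omega_n / (n + 2) over the ball of R^(n+1). The same n +
    2 is the factor of the cone construction on S^(n+1), whence the ratio of areas in the
    density. *)
Lemma omega_axis_moment n : n.+2%:R * axis_moment R n 0 = omega R n.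
Proof.
rewrite omega_half_gamma /axis_moment muln0 addn0 half_gamma1 exprSr.
have := half_gamma_gt0 R (ltn0Sn n); move: (half_gamma _ _) => x x0.
have n0 : n.+2%:R != 0 :> R by rewrite pnatr_eq0.
by move: n0; move: (n.+2%:R) => y y0; field; rewrite y0 gt_eqF.
Qed.

Lemma omega_gt0 n : 0 < omega R n.
Proof.
rewrite omega_half_gamma divr_gt0 ?half_gamma_gt0 // mulr_gt0 // exprn_gt0 //.
by rewrite sqrtr_gt0 pi_gt0.
Qed.

End zonal_polynomial.

(** * The law of the projection as an integral over ]-1, 1[ *)

Section projected_law.
Variable R : realType.
Notation mu := (@lebesgue_measure R).
Notation vec := (g_sigma_algebraType (@coord_sets R)).
Variables (n k : nat) (k0 : (0 < k)%N) (c gam : 'rV[R]_(n.+2)) (rho : R).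
Hypotheses (hc : @sphere R n.+1 c) (hgam : @sphere R n.+1 gam) (r1 : -1 <= rho <= 1).

Notation P := (zonal_poly R n.+1 k).
Notation d := (n.+1).
Let s := dotp gam c.

Definition vec_of_row (u : 'rV[R]_(n.+2)) : vec := fun i => u ord0 (inord i).

Lemma dotp_vec_of_row u (v : vec) :
  dotp u (\row_(i < n.+2) v i : 'rV[R]_(n.+2)) = dotv n.+2 (vec_of_row u) v.
Proof.
by apply: eq_bigr => i _; rewrite /vec_of_row inord_val mxE.
Qed.

Lemma dotp_dotv u v : dotp u v = dotv n.+2 (vec_of_row u) (vec_of_row v).
Proof. by apply: eq_bigr => i _; rewrite /vec_of_row !inord_val. Qed.

(** The truncation yields a nonnegative function on the whole line; on [-1, 1] it changes nothing,
    thanks to |P| <= |P(1)|. *)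
Definition zonal_density (x : R) : R :=
  Num.max 0 ((1 + rho * (P.[x] / P.[1])) / omega R d).

Lemma measurable_horner (p : {poly R}) : measurable_fun setT (fun x => p.[x]).
Proof. by apply: continuous_measurable_fun; exact: continuous_horner. Qed.

Lemma measurable_zonal_density : measurable_fun setT zonal_density.
Proof.
apply: measurable_maxr => //; apply: measurable_funM => //.
apply: measurable_funD => //; apply: measurable_funM => //.
by apply: measurable_funM => //; exact: measurable_horner.
Qed.

Lemma zonal_densityE x : -1 <= x <= 1 ->
  zonal_density x = (1 + rho * (P.[x] / P.[1])) / omega R d.
Proof.
move=> x1; rewrite /zonal_density max_r // divr_ge0 ?(ltW (omega_gt0 _ _)) //.
by rewrite zonal_poly_density_ge0 // ler_norml.
Qed.

Lemma gegtilde_zonal_poly x : -1 <= x <= 1 -> gegtilde d k x = P.[x] / P.[1].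
Proof. by move=> x1; rewrite /gegtilde !gegC_zonal_poly // lexx andbT; lra. Qed.

Lemma dotp_cos u (v : vec) : @sphere R n.+1 u -> 0 < sqnorm n.+2 v ->
  -1 <= dotv n.+2 (vec_of_row u) v / norm n.+2 v <= 1.
Proof.
move=> hu q0; have nn0 : 0 < norm n.+2 v by rewrite sqrtr_gt0.
rewrite -ler_norml normrM normfV (gtr0_norm nn0) ler_pdivrMr // mul1r.
rewrite -(@ler_pXn2r _ 2) ?nnegrE ?(ltW nn0) // real_normK ?num_real //.
rewrite (sqr_sqrtr (ltW q0)) (le_trans (cauchy_schwarz_dotv _ _ _)) //.
by rewrite -dotp_dotv hu mul1r.
Qed.

Lemma proj_law_ball_int B : proj_law k c rho gam B
  = (n.+2%:R%:E * ball_int n.+2 (fun v => (\1_B (dotv n.+2 (vec_of_row gam) v / norm n.+2 v)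
       * zonal_density (dotv n.+2 (vec_of_row c) v / norm n.+2 v))%:E))%E.
Proof.
rewrite /proj_law /sphere_int /leb_int iterintE; congr (_ * multi_int _ _ _)%E.
apply/funext => v; rewrite /cone_integrand.
have -> : dotp (\row_(i < n.+2) v i : 'rV[R]_(n.+2)) (\row_(i < n.+2) v i) = sqnorm n.+2 v.
  by apply: eq_bigr => i _; rewrite !mxE.
rewrite /in_ball; case: ifP => // /andP[q0 _].
have E u : dotp u ((Num.sqrt (sqnorm n.+2 v))^-1 *: (\row_(i < n.+2) v i))
    = dotv n.+2 (vec_of_row u) v / norm n.+2 v.
  rewrite -dotp_vec_of_row /dotp mulr_suml; apply: eq_bigr => i _.
  by rewrite !mxE /norm; ring.
have C u w : dotp u w = dotp w u :> R by apply: eq_bigr => i _; rewrite mulrC.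
rewrite /Ck_density [dotp _ c]C !E indicE; case: (_ \in B); rewrite ?mul0r // mul1r.
by rewrite gegtilde_zonal_poly ?zonal_densityE ?dotp_cos.
Qed.

Lemma dotp_sphere_bound : -1 <= s <= 1.
Proof.
rewrite -ler_norml -(@ler_pXn2r _ 2) ?nnegrE // expr1n real_normK ?num_real // /s dotp_dotv.
by rewrite (le_trans (cauchy_schwarz_dotv _ _ _)) // -!dotp_dotv hc hgam mulr1.
Qed.

Definition proj_density (t : R) : R :=
  f_d d t * (1 + rho * gegtilde d k s * gegtilde d k t).

Lemma proj_density_zonal_poly t : -1 <= t <= 1 ->
  proj_density t = f_d d t * (1 + rho * (P.[s] / P.[1]) * (P.[t] / P.[1])).
Proof.
by move=> t1; rewrite /proj_density !gegtilde_zonal_poly // dotp_sphere_bound.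
Qed.

Lemma proj_law_itv B : measurable B -> proj_law k c rho gam B
  = (\int[mu]_(t in `](- 1)%R, 1%R[) (\1_B t * proj_density t)%:E)%E.
Proof.
move=> mB; rewrite proj_law_ball_int.
have ha : dotv n.+2 (vec_of_row gam) (vec_of_row gam) = 1 by rewrite -dotp_dotv.
have hb : dotv n.+2 (vec_of_row c) (vec_of_row c) = 1 by rewrite -dotp_dotv.
have z0 x : 0 <= zonal_density x by rewrite le_max lexx.
rewrite (ball_int_geg ha hb mB (zonal_poly_equation R d k) measurable_zonal_density z0
  zonal_densityE) -dotp_dotv.
pose f t := \1_B t * (1 - t ^+ 2) `^ (d%:R / 2 - 1) * (axis_moment R n 0 *
  ((1 + rho * (P.[s] / P.[1]) * (P.[t] / P.[1])) / omega R d)).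
have w0 t : -1 <= t <= 1 -> 0 <= 1 + rho * (P.[s] / P.[1]) * (P.[t] / P.[1]).
  move=> t1; apply: zonal_poly_density_ge0 => //.
  by rewrite normrM mulr_ile1 ?zonal_poly_ratio ?dotp_sphere_bound // ler_norml.
have om0 := omega_gt0 R d.
rewrite -ge0_integralZl ?lee_fin //.
- apply: eq_integral => t; rewrite inE /= in_itv /= => /andP[t0 t1].
  rewrite -EFinM proj_density_zonal_poly ?(ltW t0) ?(ltW t1) //; congr _%:E.
  rewrite /f_d -[omega R n.+1.-1]omega_axis_moment; move: (_ `^ _) => w; ring.
- apply/measurable_EFinP; apply: measurable_funTS.
  have mI : measurable_fun setT (\1_B : R -> R) by exact: measurable_indic.
  apply: measurable_funM.
    apply: measurable_funM => //; apply: (measurableT_comp (measurable_powR _)).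
    by apply: measurable_funB => //; exact: exprn_measurable.
  apply: measurable_funM => //; apply: measurable_funM => //.
  apply: measurable_funD => //; apply: measurable_funM => //.
  by apply: measurable_funM => //; exact: measurable_horner.
- move=> t; rewrite /= in_itv /= => /andP[t0 t1].
  have m0 : 0 <= axis_moment R n 0.
    by rewrite -(@pmulr_rge0 _ n.+2%:R) // omega_axis_moment ltW ?omega_gt0.
  have w1 := w0 t; rewrite (ltW t0) (ltW t1) in w1.
  rewrite lee_fin; apply: mulr_ge0; first by rewrite mulr_ge0 ?powR_ge0.
  by apply: mulr_ge0 => //; rewrite divr_ge0 ?w1 ?(ltW om0).
Qed.

End projected_law.

(** * The primitive of the projected density *)

Section zonal_primitive.
Variable R : realType.
Notation mu := (@lebesgue_measure R).
Notation vec := (g_sigma_algebraType (@coord_sets R)).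
Implicit Types (P : {poly R}) (x t a b : R) (n d : nat).

(* f may be unbounded at the end points, as [jacobi_weight 1] is. *)
Lemma integral_open_is_derive (f F : R -> R) a b : a < b ->
  mu.-integrable `[a, b] (EFin \o f) ->
  (forall t, a < t < b -> {for t, continuous f}) ->
  {within `[a, b], continuous F} ->
  (forall t, a < t < b -> is_derive t 1 F (f t)) ->
  \int[mu]_(t in `[a, b]) f t = F b - F a.
Proof.
move=> ab intf cf cF dF.
pose I y := \int[mu]_(t in `[a, y]) f t.
have dH t : t \in `]a, b[%R -> is_derive t 1 (I \- F) (cst 0 t).
  rewrite in_itv /= => tab; have /andP[at_ tb] := tab.
  have [dI I't] := continuous_FTC1_closed tb intf at_ (cf t tab).
  have dIt : is_derive t 1 I (f t).
    by apply: DeriveDef; [exact: dI|rewrite -derive1E; exact: I't].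
  have dFt := dF t tab.
  by apply: is_derive_eq; rewrite subrr.
have cH : {within `[a, b], continuous (I \- F)}.
  have cI := parameterized_integral_continuous (ltW ab) intf.
  move=> y; apply: cvgB; [exact: cI|exact: cF].
have [c _] := MVT ab dH cH.
have -> : (I \- F) a = - F a by rewrite /= /I set_itv1 Rintegral_set1 sub0r.
by rewrite /cst mul0r /= opprK => /eqP; rewrite addrAC subr_eq0 -/(I b) => /eqP; lra.
Qed.

Definition jacobi_weight d t : R := (1 - t ^+ 2) `^ (d%:R / 2 - 1).

Lemma measurable_jacobi_weight d : measurable_fun setT (jacobi_weight d).
Proof.
have m : measurable_fun setT (fun t : R => 1 - t ^+ 2).
  by apply: measurable_funB => //; exact: exprn_measurable.
exact: (measurableT_comp (measurable_powR _) m).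
Qed.

Lemma itv_cc_setD2 x : -1 <= x <= 1 ->
  `[-1, x] `\` [set -1; 1] = `]-1, 1[ `&` `]-oo, x] :> set R.
Proof.
move=> /andP[x0 x1]; apply/seteqP; split => t /=; rewrite !in_itv /=.
  move=> [/andP[t0 tx] t1]; rewrite tx; split => //.
  rewrite !lt_neqAle t0 (le_trans tx x1) !andbT; apply/andP.
  by split; apply/eqP => e; apply: t1; [left|right].
move=> [/andP[t0 t1] tx]; split; first by rewrite tx (ltW t0).
by move=> [] e; move: t0 t1; rewrite e ltxx.
Qed.

Lemma lebesgue_measure_set2 a b : mu [set a; b] = 0.
Proof. by rewrite measureU0 //; exact: lebesgue_measure_set1. Qed.

(** The disintegration supplies the bound: with g = 1 and B the whole line it equates a positive
    multiple of the integral with the volume of the unit ball of R^(n+2). *)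
Lemma integrable_jacobi_weight n : mu.-integrable `[-1, 1] (EFin \o jacobi_weight n.+1).
Proof.
have m := @measurable_jacobi_weight n.+1.
apply/integrableP; split; first by apply/measurable_EFinP; exact: measurable_funTS.
have -> : (\int[mu]_(t in `[(-1)%R, 1%R]) `|(EFin \o jacobi_weight n.+1) t|
    = \int[mu]_(t in `[(-1)%R, 1%R]) (jacobi_weight n.+1 t)%:E)%E.
  by apply: eq_integral => t _; rewrite /= ger0_norm // powR_ge0.
rewrite (@ge0_negligible_integral _ _ _ mu `[-1, 1]%classic [set -1; 1]) //; last 4 first.
- exact: measurableU.
- by apply/measurable_EFinP; exact: measurable_funTS.
- by move=> t _; rewrite lee_fin powR_ge0.
- exact: lebesgue_measure_set2.
rewrite itv_cc_setD2 ?lexx ?andbT; last by lra.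
rewrite setIidl; last by move=> t /=; rewrite !in_itv /= => /andP[_ /ltW].
pose a : vec := fun i => (i == 0%N)%:R.
have a1 : dotv n.+2 a a = 1.
  by rewrite /dotv big_ord_recl big1 ?mulr1 ?addr0 // => i _; rewrite mulr0.
have P0 : geg_equation n.+1 0 (0 : {poly R}).
  by rewrite /geg_equation !linear0 !mulr0 subrr addr0.
have := @ball_int_geg R n 0 0 a a 0 1 setT (fun=> 1) a1 a1 measurableT P0
  (@measurable_cst _ _ _ _ _ _) (fun _ => ler01).
have E (x : R) : -1 <= x <= 1 -> 1 = (1 + 0 * ((0 : {poly R}).[x] / (0 : {poly R}).[1])) / 1.
  by rewrite mul0r addr0 divr1.
move=> /(_ E) H.
have am0 : 0 < axis_moment R n 0.
  by rewrite -(@pmulr_rgt0 _ n.+2%:R) // omega_axis_moment omega_gt0.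
have : ((axis_moment R n 0)%:E * \int[mu]_(t in `](-1)%R, 1%R[) (jacobi_weight n.+1 t)%:E < +oo)%E.
  rewrite -ge0_integralZl //; last 3 first.
  - by apply/measurable_EFinP; exact: measurable_funTS.
  - by move=> t _; rewrite lee_fin powR_ge0.
  - by rewrite lee_fin ltW.
  rewrite [X in (X < _)%E](_ : _ = ball_int n.+2 (axis_power n.+1 1 0)).
    by rewrite ball_int_axis_power ltry.
  transitivity (ball_int n.+2 (fun v => (\1_setT (dotv n.+2 a v / norm n.+2 v) * 1)%:E)).
    rewrite H; apply: eq_integral => t _.
    by rewrite -EFinM indicT !mul0r addr0 divr1 mulr1 mul1r mulrC.
  by apply: eq_ball_int => v _; rewrite /axis_power indicT mulr1 muln0 expr0.
rewrite -/(jacobi_weight n.+1).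
have : (0 <= \int[mu]_(t in `](-1)%R, 1%R[) (jacobi_weight n.+1 t)%:E)%E.
  by apply: integral_ge0 => t _; rewrite lee_fin powR_ge0.
move: (\int[mu]_(t in _) _)%E => [z| |] //= _; first by rewrite !ltry.
by rewrite gt0_muley ?lte_fin.
Qed.

Lemma integrable_jacobi_weightM n P :
  mu.-integrable `[-1, 1] (EFin \o (fun t => jacobi_weight n.+1 t * P.[t])).
Proof.
pose C := \sum_(i < size P) `|P`_i|.
have PC t : -1 <= t <= 1 -> `|P.[t]| <= C.
  rewrite -ler_norml => t1; rewrite horner_coef (le_trans (ler_norm_sum _ _ _)) //.
  by apply: ler_sum => i _; rewrite normrM ler_piMr // normrX exprn_ile1.
apply: (@le_integrable _ _ _ mu _ _ _ (fun t => C%:E * (jacobi_weight n.+1 t)%:E)%E) => //.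
- apply/measurable_EFinP; apply: measurable_funTS; apply: measurable_funM.
    exact: measurable_jacobi_weight.
  exact: measurable_horner.
- move=> t; rewrite /= in_itv /= => /PC h; rewrite lee_fin !normrM mulrC.
  by rewrite ler_wpM2r // (le_trans h) // ler_norm.
- by apply: integrableZl => //; exact: integrable_jacobi_weight.
Qed.

(** The primitive is written with a power of the square root, which is continuous up to -1 and 1
    even where the weight is unbounded, and it vanishes at -1. *)
Lemma integral_jacobi_weight n N P x : N != 0 -> geg_equation n.+1 N P -> -1 <= x <= 1 ->
  \int[mu]_(t in `[-1, x]) (jacobi_weight n.+1 t * P.[t])
  = - (Num.sqrt (1 - x ^+ 2) ^+ n.+1 * P^`().[x] / N).
Proof.
move=> N0 hP; rewrite le_eqVlt => /andP[/orP[/eqP <- _|x0 x1]].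
  by rewrite set_itv1 Rintegral_set1 sqrrN expr1n subrr sqrtr0 expr0n mul0r mul0r oppr0.
pose u : R -> R := horner (1 - 'X^2 : {poly R}).
have uE t : u t = 1 - t ^+ 2 by rewrite /u !hornerE.
have cu : continuous u by exact: continuous_horner.
pose F y := - N^-1 * (Num.sqrt (u y) ^+ n.+1 * P^`().[y]).
have cs : continuous (fun y : R => Num.sqrt (u y)).
  move=> y; apply: continuous_comp; first exact: cu.
  exact: sqrt_continuous.
have u0 t : -1 < t < x -> 0 < u t.
  by rewrite uE -one_sub_sqr_gt0 => /andP[-> tx]; rewrite (lt_le_trans tx).
transitivity (F x - F (-1)); last first.
  rewrite /F !uE sqrrN expr1n subrr sqrtr0 expr0n /=.
  by ring.
apply: integral_open_is_derive => //.
- apply: integrableS (integrable_jacobi_weightM n P) => //.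
  by move=> t /=; rewrite !in_itv /= => /andP[-> tx]; rewrite (le_trans tx).
- move=> t tx; apply: cvgM; last exact: continuous_horner.
  have c1 : {for t, continuous (u)} by exact: cu.
  have := continuous_comp c1 (@continuous_powR R (n.+1%:R / 2 - 1) _ (u0 t tx)).
  rewrite (_ : _ \o _ = jacobi_weight n.+1) //.
  by apply/funext => y; rewrite /= uE.
- apply: continuous_subspaceT => y; apply: cvgM; first exact: cvg_cst.
  apply: cvgM; last exact: continuous_horner.
  exact: (continuous_comp (cs y) (@exprn_continuous R n.+1 _)).
- move=> t tx; have ut := u0 t tx.
  have dS := is_derive1_comp (is_derive1_sqrt ut) (is_derive_poly (1 - 'X^2 : {poly R}) t).
  have dP := is_derive_poly P^`() t.
  have dn := is_deriveX n.+1 dS.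
  have := is_deriveZ (- N^-1) (is_deriveM dn dP).
  rewrite (_ : _ \*: _ = F); last by apply/funext => y; rewrite /F /= exprfctE.
  move=> D; apply: (is_derive_eq D).
  rewrite exprfctE /= /GRing.scale /=.
  have -> : (1 - 'X^2 : {poly R})^`().[t] = - (2 * t).
    by rewrite derivB derivC derivXn !hornerE /=; ring.
  have := congr1 (horner^~ t) hP; rewrite !derivnS derivn0 -!polyC_natr.
  rewrite !(hornerD, hornerN, hornerM, hornerXn, hornerX, hornerC) => ode.
  set S := Num.sqrt (u t); have S0 : 0 < S by rewrite sqrtr_gt0.
  have S2 : S ^+ 2 = 1 - t ^+ 2 by rewrite -uE sqr_sqrtr // ltW.
  have -> : jacobi_weight n.+1 t = S ^+ n.+1 / S ^+ 2.
    have q0 : 0 < 1 - t ^+ 2 by rewrite -uE.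
    rewrite /jacobi_weight powRB ?(gt_eqF q0) ?implybT // powRr1 ?(ltW q0) // S2.
    by congr (_ / _); rewrite mulrC powRrM powR12_sqrt ?powR_mulrn ?sqrtr_ge0 ?(ltW q0) // -uE.
  have PE : P.[t] = (n.+1%:R * t * P^`().[t] - S ^+ 2 * P^`()^`().[t]) / N.
    by apply: (mulfI N0); rewrite mulrCA divff // mulr1 S2; lra.
  rewrite PE exprS; move: (S ^+ n) (n.+1%:R) => w m; field; rewrite N0 gt_eqF //.
Qed.

End zonal_primitive.

(** For d = 1 this is T_k' = k U_(k-1) with sin theta U_(k-1) = sin (k theta); for d >= 2 it is the
    derivative rule for index (d - 1) / 2, whose factor 2 lambda is d - 1. *)
Lemma G_k_zonal_poly (R : realType) n k (x : R) : (0 < k)%N -> -1 <= x <= 1 ->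
  G_k n.+1 k x = Num.sqrt (1 - x ^+ 2) ^+ n.+1 * (zonal_poly R n.+1 k)^`().[x]
                 / (k%:R * (k%:R + n.+1%:R - 1)).
Proof.
move=> k0 x1; rewrite /G_k /zonal_poly; case: eqP => [[->]|n0].
  rewrite (cheb_deriv R k).1 addrK expr1 -[k%:R in RHS]polyC_natr hornerM hornerC.
  rewrite -(cheb_cos k (acos x)).2 sin_acos // acosK //.
  have kk : k%:R != 0 :> R by rewrite pnatr_eq0 -lt0n.
  by field.
rewrite geg_poly_deriv // hornerM hornerC geg_polyE.
have -> : (n.+1%:R - 1) / 2 + 1 = (n.+1%:R + 1) / 2 :> R by lra.
have q0 : 0 <= 1 - x ^+ 2 by move: x1 => /andP[? ?]; nra.
rewrite [n.+1%:R / 2]mulrC powRrM powR12_sqrt // powR_mulrn ?sqrtr_ge0 //.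
by rewrite [2 * _]mulrC divfK //; ring.
Qed.

(** * Density and distribution function of the projection *)

Section conclusion.
Variable R : realType.
Notation mu := (@lebesgue_measure R).
Variables (n k : nat) (k0 : (0 < k)%N) (c gam : 'rV[R]_(n.+2)) (rho : R).
Hypotheses (hc : @sphere R n.+1 c) (hgam : @sphere R n.+1 gam) (r1 : -1 <= rho <= 1).

Notation P := (zonal_poly R n.+1 k).
Notation d := (n.+1).
Let s := dotp gam c.

(** The coefficient of P(t) in the density; times the ratio of areas it equals rho times [eta_k]. *)
Definition zonal_coef := rho * (P.[s] / P.[1]) / P.[1].

Lemma proj_density_ge0 t : -1 <= t <= 1 -> 0 <= proj_density k c gam rho t.
Proof.
move=> t1; rewrite proj_density_zonal_poly // mulr_ge0 //.
  by rewrite mulr_ge0 ?powR_ge0 // divr_ge0 // ltW ?omega_gt0.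
rewrite zonal_poly_density_ge0 // normrM mulr_ile1 ?zonal_poly_ratio ?dotp_sphere_bound //.
by rewrite ler_norml.
Qed.

Lemma proj_densityE t : -1 <= t <= 1 -> proj_density k c gam rho t
  = omega R n / omega R d * (jacobi_weight d t + zonal_coef * (jacobi_weight d t * P.[t])).
Proof.
move=> t1; rewrite proj_density_zonal_poly // /f_d /= /zonal_coef -/(jacobi_weight d t) -/s.
move: (jacobi_weight _ _) => w; ring.
Qed.

Lemma measurable_proj_density (B : set R) : measurable B -> B `<=` `[-1, 1] ->
  measurable_fun B (fun t => (proj_density k c gam rho t)%:E).
Proof.
move=> mB B1; apply/measurable_EFinP.
apply: (eq_measurable_fun (fun t => omega R n / omega R d
   * (jacobi_weight d t + zonal_coef * (jacobi_weight d t * P.[t])))).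
  by move=> t; rewrite inE => /B1 /=; rewrite in_itv /= => /proj_densityE ->.
apply: measurable_funTS; apply: measurable_funM => //.
have mw := @measurable_jacobi_weight R d.
apply: measurable_funD => //; apply: measurable_funM => //.
by apply: measurable_funM => //; exact: measurable_horner.
Qed.

Lemma proj_law_integral (B : set R) : measurable B -> proj_law k c rho gam B
  = (\int[mu]_(t in `](-1)%R, 1%R[ `&` B) (proj_density k c gam rho t)%:E)%E.
Proof.
move=> mB; rewrite proj_law_itv // integral_mkcondr; apply: eq_integral => t _.
rewrite patchE indicE; case: (t \in B); by rewrite ?mul1r ?mul0r.
Qed.

Lemma integral_proj_density_setD2 (B : set R) : measurable B -> B `<=` `[-1, 1] ->
  (\int[mu]_(t in B) (proj_density k c gam rho t)%:E
   = \int[mu]_(t in B `\` [set (-1)%R; 1%R]) (proj_density k c gam rho t)%:E)%E.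
Proof.
move=> mB B1; rewrite (@ge0_negligible_integral _ _ _ mu B [set -1; 1]) //.
- exact: measurableU.
- exact: measurable_proj_density.
- by move=> t /B1 /=; rewrite in_itv /= lee_fin; exact: proj_density_ge0.
- exact: lebesgue_measure_set2.
Qed.

Lemma proj_law_density (B : set R) : measurable B -> B `<=` `[-1, 1] ->
  proj_law k c rho gam B = (\int[mu]_(t in B) (proj_density k c gam rho t)%:E)%E.
Proof.
move=> mB B1; rewrite proj_law_integral // (integral_proj_density_setD2 mB B1).
suff -> : `]-1, 1[ `&` B = B `\` [set -1; 1] by [].
apply/seteqP; split => t /=; rewrite in_itv /=.
  move=> [/andP[t0 t1] Bt]; split => // -[] e; move: t0 t1; rewrite e ltxx //.
move=> [Bt t1]; split => //; have := B1 _ Bt; rewrite /= in_itv /= !lt_neqAle => /andP[-> ->].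
by rewrite !andbT; apply/andP; split; apply/eqP => e; apply: t1; [left|right].
Qed.

Lemma proj_law_cdf x : -1 <= x <= 1 -> proj_law k c rho gam `]-oo, x]
  = (F_d d x - rho * eta_k d k s * G_k d k x)%:E.
Proof.
move=> x1; have x1' : x <= 1 by case/andP: x1.
have sub : (`[-1, x] : set R) `<=` `[-1, 1].
  by move=> t /=; rewrite !in_itv /= => /andP[-> /le_trans->].
rewrite proj_law_integral // -itv_cc_setD2 // -integral_proj_density_setD2 //.
have iw : mu.-integrable `[-1, x] (EFin \o jacobi_weight d).
  exact: integrableS (integrable_jacobi_weight R n).
have iP : mu.-integrable `[-1, x] (EFin \o (fun t => jacobi_weight d t * P.[t])).
  exact: integrableS (integrable_jacobi_weightM n P).
have iZ : mu.-integrable `[-1, x]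
    (EFin \o (fun t => zonal_coef * (jacobi_weight d t * P.[t]))).
  exact: (@integrableZl _ _ _ mu _ _ zonal_coef _ iP).
have iD : mu.-integrable `[-1, x]
    (EFin \o (fun t => jacobi_weight d t + zonal_coef * (jacobi_weight d t * P.[t]))).
  exact: (@integrableD _ _ _ mu _ _ _ _ iw iZ).
have iO : mu.-integrable `[-1, x] (EFin \o (fun t => omega R n / omega R d
    * (jacobi_weight d t + zonal_coef * (jacobi_weight d t * P.[t])))).
  exact: (@integrableZl _ _ _ mu _ _ (omega R n / omega R d) _ iD).
transitivity (\int[mu]_(t in `[(-1)%R, x]) (omega R n / omega R d
    * (jacobi_weight d t + zonal_coef * (jacobi_weight d t * P.[t])))%:E)%E.
  apply: eq_integral => t; rewrite inE => /sub /=; rewrite in_itv /= => t1.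
  by rewrite proj_densityE.
rewrite -[LHS]fineK; last exact: integrable_fin_num.
congr _%:E; rewrite -[fine _]/(Rintegral _ _ _).
rewrite RintegralZl // RintegralD // RintegralZl //.
have kk : k%:R != 0 :> R by rewrite pnatr_eq0 -lt0n.
have kd : k%:R + d%:R - 1 != 0 :> R.
  by rewrite -[d%:R]natr1 addrA addrK -natrD pnatr_eq0 addn_eq0 negb_and -lt0n k0.
rewrite (integral_jacobi_weight _ (zonal_poly_equation R d k) x1) ?mulf_neq0 //.
rewrite -G_k_zonal_poly // mulrDr /F_d /f_d RintegralZl // -[in RHS]/(jacobi_weight d).
congr (_ + _); rewrite /eta_k !gegC_zonal_poly ?dotp_sphere_bound ?lexx ?andbT //.
by rewrite /zonal_coef -/s -exprVn [d.-1]/=; ring.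
Qed.

End conclusion.

Theorem theorem6 (R : realType) (d k : nat) (hd : (1 <= d)%N) (hk : (1 <= k)%N)
  (mu : 'rV[R]_(d.+1)) (hmu : @sphere R d mu) (rho : R) (hrho : -1 <= rho <= 1)
  (gam : 'rV[R]_(d.+1)) (hgam : @sphere R d gam) :
  (forall B : set R, measurable B -> B `<=` `[-1, 1] ->
     proj_law k mu rho gam B =
     (\int[@lebesgue_measure R]_(x in B)
        (f_d d x * (1 + rho * gegtilde d k (dotp gam mu) * gegtilde d k x))%:E)%E)
  /\
  (forall x : R, -1 <= x <= 1 ->
     proj_law k mu rho gam `]-oo, x] =
     (F_d d x - rho * eta_k d k (dotp gam mu) * G_k d k x)%:E).
Proof.
case: d hd mu hmu gam hgam => // n _ c hc g hg; split=> [B mB B1|x x1].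
  exact: proj_law_density.
exact: proj_law_cdf.
Qed.
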